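(* Let $\lambda\ge0$. Let $X_n(j)$ be the number of nodes labelled $j$ in a uniformly random labelled plane tree with $n$ edges, and $Y_n(j)=X_n(j)/n^{3/4}$. The sequence $Y_n(\lfloor\lambda n^{1/4}\rfloor)$ converges in distribution to a non-negative random variable $Y(\lambda)$ whose Laplace transform is given, for $|a|<4/\sqrt3$, by $\mathbb{E}(e^{aY(\lambda)})=L(\lambda,a)$, where $$L(\lambda,a)=1+\frac{48}{i\sqrt\pi}\int_\Gamma\frac{A(a/v^3)e^{-2\lambda v}}{(1+A(a/v^3)e^{-2\lambda v})^2}\,v^5e^{v^4}\,dv,$$ $A(x)$ is the unique solution of $A=\frac{x(1+A)^3}{24(1-A)}$ with $A(0)=0$, and $\Gamma=\{1-te^{-i\pi/4}: t\in(\infty,0]\}\cup\{1+te^{-i\pi/4}: t\in[0,\infty)\}$. More precisely, the Laplace transform of $Y_n(\lfloor\lambda n^{1/4}\rfloor)$ converges pointwise to $L(\lambda,\cdot)$ on $(-4/\sqrt3,4/\sqrt3)$, and all moments of $Y_n(\lfloor\lambda n^{1/4}\rfloor)$ converge to those of $Y(\lambda)$.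
   Context: A labelled plane tree is a rooted plane tree whose nodes carry integer labels, with the root labelled $0$ and labels of adjacent nodes differing by $+1$ or $-1$. Trees with $n$ edges are taken uniformly at random.
   Formalization: The contour Γ as printed (e^{-iπ/4} in both pieces, t∈(∞,0]) is a misprint that makes the formula false; it is taken as coming in from infinity along 1+te^{-iπ/4} and going out along 1+te^{iπ/4}, t≥0. *)

(* Defs.v *)
From HB Require Import structures.
From mathcomp Require Import all_boot all_order all_algebra.
From mathcomp Require Import all_classical all_reals all_analysis.
From mathcomp Require Import complex.

Set Implicit Arguments.
Unset Strict Implicit.
Unset Printing Implicit Defensive.

Import Order.TTheory GRing.Theory Num.Theory.
Import numFieldNormedType.Exports.

Local Open Scope ring_scope.

Inductive ltree : Type := LNode of int & seq ltree.

Fixpoint ltree_enc (t : ltree) : GenTree.tree int :=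
  let: LNode l cs := t in GenTree.Node 0 (GenTree.Leaf l :: map ltree_enc cs).

Fixpoint ltree_dec (g : GenTree.tree int) : option ltree :=
  match g with
  | GenTree.Node _ (GenTree.Leaf l :: gs) => Some (LNode l (pmap ltree_dec gs))
  | _ => None
  end.

Fixpoint ltree_encK_aux (t : ltree) : ltree_dec (ltree_enc t) = Some t :=
  match t return ltree_dec (ltree_enc t) = Some t with
  | LNode l cs =>
      f_equal (fun s => Some (LNode l s))
        ((fix F (cs : seq ltree) : pmap ltree_dec (map ltree_enc cs) = cs :=
            match cs return pmap ltree_dec (map ltree_enc cs) = cs with
            | [::] => erefl
            | c :: cs' =>
                @eq_ind_r _ (Some c) (fun o => oapp (cons^~ (pmap ltree_dec (map ltree_enc cs')))
                                        (pmap ltree_dec (map ltree_enc cs')) o = c :: cs')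
                  (f_equal (cons c) (F cs')) _ (ltree_encK_aux c)
            end) cs)
  end.

Lemma ltree_encK : pcancel ltree_enc ltree_dec.
Proof. exact: ltree_encK_aux. Qed.

HB.instance Definition _ := Countable.copy ltree (pcan_type ltree_encK).

Definition label (t : ltree) : int := let: LNode l _ := t in l.

Fixpoint wf_labels (t : ltree) : bool :=
  let: LNode l cs := t in
  all (fun c => (label c == l + 1) || (label c == l - 1)) cs && all wf_labels cs.

Fixpoint nedges (t : ltree) : nat :=
  let: LNode _ cs := t in sumn (map (fun c => (nedges c).+1) cs).

Fixpoint nlabel (j : int) (t : ltree) : nat :=
  let: LNode l cs := t in (l == j) + sumn (map (nlabel j) cs).

Definition labelled_trees (n : nat) : set ltree :=
  [set t | label t = 0 /\ wf_labels t /\ nedges t = n].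

Definition unif_expect (R : realType) (n : nat) (f : ltree -> R) : R :=
  (\sum_(t \in labelled_trees n) f t) / (\sum_(t \in labelled_trees n) (1 : R)).

Definition Yn (R : realType) (n : nat) (j : int) (t : ltree) : R :=
  (nlabel j t)%:R / (n%:R `^ (3 / 4)).

Definition Ylam (R : realType) (lam : R) (n : nat) (t : ltree) : R :=
  @Yn R n (Num.floor (lam * n%:R `^ (1 / 4))) t.

Definition conv (R : realType) (f g : nat -> R) (n : nat) : R :=
  \sum_(i < n.+1) f i * g (n - i)%N.

Definition onep (R : realType) (c : nat -> R) (n : nat) : R :=
  (n == 0%N)%:R + c n.

(* c is the coefficient sequence of the formal power series A(x) with
   A(0) = 0 and A = x (1+A)^3 / (24 (1-A)), i.e. 24 A (1 - A) = x (1+A)^3. *)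
Definition is_A_coef (R : realType) (c : nat -> R) : Prop :=
  c 0%N = 0 /\
  forall n, 24 * (c n - conv c c n) =
            (if n is m.+1 then conv (onep c) (conv (onep c) (onep c)) m else 0).

Local Open Scope complex_scope.

Definition Aval (R : realType) (c : nat -> R) (z : R[i]) : R[i] :=
  limn (series (fun k => complex.Re ((c k)%:C * z ^+ k)))
  +i* limn (series (fun k => complex.Im ((c k)%:C * z ^+ k))).

Definition cexp (R : realType) (z : R[i]) : R[i] :=
  (expR (complex.Re z))%:C * (cos (complex.Im z) +i* sin (complex.Im z)).

Definition cint_pos (R : realType) (h : R -> R[i]) : R[i] :=
  Rintegral (@lebesgue_measure R) [set x : R | 0 <= x] (fun t => complex.Re (h t))
  +i* Rintegral (@lebesgue_measure R) [set x : R | 0 <= x] (fun t => complex.Im (h t)).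

Definition ray_int (R : realType) (v0 d : R[i]) (g : R[i] -> R[i]) : R[i] :=
  cint_pos (fun t : R => g (v0 + t%:C * d) * d).

Definition e_ip4 (R : realType) : R[i] :=
  (Num.sqrt 2 / 2) +i* (Num.sqrt 2 / 2).
Definition e_mip4 (R : realType) : R[i] :=
  (Num.sqrt 2 / 2) -i* (Num.sqrt 2 / 2).

Definition Gamma_int (R : realType) (g : R[i] -> R[i]) : R[i] :=
  ray_int 1 (@e_ip4 R) g - ray_int 1 (@e_mip4 R) g.

Definition L_lap (R : realType) (c : nat -> R) (lam a : R) : R[i] :=
  1 + (48%:R / ('i * (Num.sqrt (pi : R))%:C)) *
      Gamma_int (fun v =>
        let B := Aval c (a%:C / v ^+ 3) * cexp (- (2 * lam)%:C * v) in
        B / (1 + B) ^+ 2 * v ^+ 5 * cexp (v ^+ 4)).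

(* Main.v *)
(* Let [S_l] count the labelled trees with root label [l], with weight [1 + x] on each node
   labelled [j]. The system [S_l = (1 + x)^[l = j] + t (S_(l+1) + S_(l-1)) S_l] becomes explicit
   after the substitution [t = w / (2 (1 + w)^2)]: in terms of [Z + 1/Z = 2/w],
   [S_l = (1 + w) (1 + D_(|l-j|))] with [1 + D_i = a_i a_(i+4) / (a_(i+1) a_(i+3))] and
   [a_i = 1 + m Z^i], where the series [m] is algebraic in [Z] and [x].  Cauchy's formula on the
   circle of radius [exp (- 2 / sqrt n)], at the scale [x ~ a / n^(3/4)], [j ~ lambda n^(1/4)],
   writes the Laplace transform as an integral that converges by domination: [Z] behaves like
   [exp (- 2 v / n^(1/4))] with [v^2 = 1 + i y], and [m] tends to [A (a / v^3)].  The limit is an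
   integral over the hyperbola [v^2 = 1 + i y], which a homotopy deforms into Gamma.

   Pointwise convergence of the Laplace transform on a neighbourhood of 0 gives convergence of all
   moments, then, by Taylor expansion, of the expectations of [exp (- k s Y)] for all [k], hence,
   by Bernstein polynomials in [exp (- s Y)], of those of all continuous functions that are
   eventually constant.  Piecewise linear cutoffs then define the distribution function of the
   limit law, and exponential tail bounds extend the convergence to functions of growth
   [exp (c Y)] with [c < 4 / sqrt 3]. *)

Require Import Defs.
From HB Require Import structures.
From mathcomp Require Import all_boot all_order all_algebra.
From mathcomp Require Import all_classical all_reals all_analysis.
From mathcomp Require Import complex measurable_realfun.
From mathcomp Require Import ring lra zify.
Import Order.TTheory GRing.Theory Num.Theory.
Import numFieldNormedType.Exports.
Local Open Scope classical_set_scope.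
Local Open Scope ring_scope.

Set Implicit Arguments.
Unset Strict Implicit.
Unset Printing Implicit Defensive.

(** * Formal power series *)

(** [Z] is the decaying mode of the system linearised about its constant solution [1 + w]. It has a
    square-root singularity at [w = 1], since [(1 - Z)^2 = (1 - w) (1 + Z^2)]; this produces the
    scale [n^(1/4)] of the labels. The obstacle is to control [m] on the whole circle, uniformly in
    [n]. A majorant does it: with series replaced by norms and powers of [Z] by 1, the equation of
    [m] becomes [A0 = A0^2 + |x| kappa (1 + A0)^3], of the same shape as that of [A]. The term
    [|x| kappa] is the value at the real point of the circle; the radius [exp (- 2 / sqrt n)] places
    that point at [v = 1] in the limit, so [|x| kappa] tends to [|a| / 24] and the bound is
    available exactly for [|a| < 4 / sqrt 3]. One constant [A0] then serves for [m], for [A], and on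
    the half plane [Re v >= 1], which contains the hyperbola, Gamma and the homotopy. Divided
    differences of the cubic equation of [A], bounded below, give the limit of [m] and the
    differentiability of [A]. Cauchy's theorem enters only as an equality of mixed derivatives along
    the homotopy. *)

Lemma sum_ord_vanish (V : nmodType) (F : nat -> V) m N : (m <= N)%N ->
  (forall i, (m <= i < N)%N -> F i = 0) -> \sum_(i < N) F i = \sum_(i < m) F i.
Proof.
move=> mN F0; rewrite -!(big_mkord xpredT F) (@big_cat_nat _ _ _ m) //=.
by rewrite [X in _ + X]big_nat_cond [X in _ + X]big1 ?addr0 // => i /andP[/F0].
Qed.

(** A record rather than the type [nat -> R], because functions carry pointwise operations. *)
Record fps (R : Type) := FPS { fcoef :> nat -> R }.
Arguments FPS {R}.

Lemma fpsP (R : Type) (f g : fps R) : (forall n, f n = g n) -> f = g.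
Proof. by case: f => f; case: g => g /= /funext ->. Qed.

HB.instance Definition _ (R : Type) := gen_eqMixin (fps R).
HB.instance Definition _ (R : Type) := gen_choiceMixin (fps R).

Section FpsRing.
Variable R : comNzRingType.
Implicit Types f g h : fps R.

Definition fC (c : R) : fps R := FPS (fun n => if n == 0%N then c else 0).
Definition fX : fps R := FPS (fun n => (n == 1%N)%:R).
Definition fadd f g : fps R := FPS (fun n => f n + g n).
Definition fopp f : fps R := FPS (fun n => - f n).
Definition fmul f g : fps R := FPS (fun n => \sum_(i < n.+1) f i * g (n - i)%N).

(** A coefficient of a product only depends on coefficients up to its degree, so truncation to
    polynomials transfers the ring axioms. *)
Definition ftrunc N f : {poly R} := \poly_(i < N.+1) f i.

Lemma coef_ftrunc N f i : (i <= N)%N -> (ftrunc N f)`_i = f i.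
Proof. by move=> iN; rewrite coef_poly ltnS iN. Qed.

Lemma fmul_ftrunc N f g n : (n <= N)%N ->
  fmul f g n = (ftrunc N f * ftrunc N g)`_n.
Proof.
move=> nN; rewrite coefM; apply: eq_bigr => i _; rewrite !coef_ftrunc //.
  by rewrite (leq_trans (leq_subr _ _)).
by rewrite (leq_trans _ nN) // -ltnS.
Qed.

Fact faddA : associative fadd.
Proof. by move=> f g h; apply: fpsP => n /=; rewrite addrA. Qed.
Fact faddC : commutative fadd.
Proof. by move=> f g; apply: fpsP => n /=; rewrite addrC. Qed.
Fact fadd0 : left_id (fC 0) fadd.
Proof. by move=> f; apply: fpsP => n /=; rewrite if_same add0r. Qed.
Fact faddN : left_inverse (fC 0) fopp fadd.
Proof. by move=> f; apply: fpsP => n /=; rewrite if_same addNr. Qed.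

HB.instance Definition _ := GRing.isZmodule.Build (fps R) faddA faddC fadd0 faddN.

Fact fmulC : commutative fmul.
Proof. by move=> f g; apply: fpsP => n; rewrite !(@fmul_ftrunc n) // mulrC. Qed.
Fact fmulA : associative fmul.
Proof.
move=> f g h; apply: fpsP => n; rewrite !(@fmul_ftrunc n) //.
transitivity (ftrunc n f * (ftrunc n g * ftrunc n h))`_n.
  rewrite !coefM; apply: eq_bigr => i _; congr (_ * _).
  by rewrite coef_ftrunc ?leq_subr // (@fmul_ftrunc n) ?leq_subr.
rewrite mulrA !coefM; apply: eq_bigr => i _; congr (_ * _).
by rewrite coef_ftrunc ?(leq_ord i) // (@fmul_ftrunc n) ?(leq_ord i).
Qed.
Fact fmul1 : left_id (fC 1) fmul.
Proof.
move=> f; apply: fpsP => n /=; rewrite big_ord_recl /= mul1r subn0 big1 ?addr0 //.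
by move=> i _; rewrite mul0r.
Qed.
Fact fmulDl : left_distributive fmul fadd.
Proof.
by move=> f g h; apply: fpsP => n /=; rewrite -big_split /=; apply: eq_bigr => i _; rewrite mulrDl.
Qed.
Fact fC1_neq0 : fC 1 != fC 0.
Proof.
by apply/eqP => /(congr1 (fun f : fps R => f 0%N)) /= /eqP; rewrite oner_eq0.
Qed.

HB.instance Definition _ := GRing.Zmodule_isComNzRing.Build (fps R)
  fmulA fmulC fmul1 fmulDl fC1_neq0.

Lemma fcoefD f g n : (f + g) n = f n + g n. Proof. by []. Qed.
Lemma fcoefN f n : (- f) n = - f n. Proof. by []. Qed.
Lemma fcoefM f g n : (f * g) n = \sum_(i < n.+1) f i * g (n - i)%N. Proof. by []. Qed.
Lemma fcoef0 n : (0 : fps R) n = 0. Proof. by rewrite /= if_same. Qed.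
Lemma fcoef1 n : (1 : fps R) n = (n == 0%N)%:R. Proof. by rewrite /=; case: eqP. Qed.
Lemma fcoefM0 f g : (f * g) 0%N = f 0%N * g 0%N.
Proof. by rewrite fcoefM big_ord_recl big_ord0 addr0. Qed.
Lemma fcoef_sum (I : Type) (r : seq I) (F : I -> fps R) n :
  (\sum_(i <- r) F i) n = \sum_(i <- r) F i n.
Proof.
elim: r => [|i r IH]; first by rewrite !big_nil fcoef0.
by rewrite !big_cons fcoefD IH.
Qed.

Fact fC_is_additive : additive fC.
Proof. by move=> a b; apply: fpsP => n /=; case: eqP => // _; rewrite subrr. Qed.
HB.instance Definition _ := GRing.isAdditive.Build R (fps R) fC fC_is_additive.
Lemma fcoefCM a f n : (fC a * f) n = a * f n.
Proof.
rewrite fcoefM big_ord_recl /= subn0 big1 ?addr0 // => i _; by rewrite mul0r.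
Qed.
Fact fC_is_multiplicative : multiplicative fC.
Proof.
split=> // a b; apply: fpsP => n; rewrite fcoefCM /=; case: eqP => //.
by rewrite mulr0.
Qed.
HB.instance Definition _ := GRing.isMultiplicative.Build R (fps R) fC fC_is_multiplicative.

Lemma fcoefXM f n : (fX * f) n = if n is m.+1 then f m else 0.
Proof.
case: n => [|n]; first by rewrite fcoefM0 mul0r.
rewrite fcoefM big_ord_recl mul0r add0r big_ord_recl /= mul1r subn1 /=.
by rewrite big1 ?addr0 // => i _; rewrite mul0r.
Qed.

Lemma fcoefXnM k f n : (fX ^+ k * f) n = if (k <= n)%N then f (n - k)%N else 0.
Proof.
elim: k n => [|k IH] n; first by rewrite expr0 mul1r subn0.
by rewrite exprS -mulrA fcoefXM; case: n => // n; rewrite IH ltnS subSS.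
Qed.

Lemma fcoef1DXn m i : ((1 + fX) ^+ m) i = 'C(m, i)%:R.
Proof.
elim: m i => [|m IH] i; first by rewrite expr0 fcoef1 bin0n.
rewrite exprS mulrDl mul1r fcoefD fcoefXM IH.
by case: i => [|i]; rewrite ?addr0 ?bin0 // binS natrD IH.
Qed.

(** Congruence modulo the [n]-th power of the variable. *)
Definition fagree n f g := forall i, (i < n)%N -> f i = g i.

Lemma fagreeD n f f' g g' : fagree n f f' -> fagree n g g' -> fagree n (f + g) (f' + g').
Proof. by move=> H1 H2 i ni; rewrite !fcoefD H1 ?H2. Qed.

Lemma fagreeM n f f' g g' : fagree n f f' -> fagree n g g' -> fagree n (f * g) (f' * g').
Proof.
move=> H1 H2 i ni; rewrite !fcoefM; apply: eq_bigr => k _.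
by rewrite H1 ?H2 //; [rewrite (leq_ltn_trans (leq_subr _ _)) | rewrite (leq_trans (ltn_ord k))].
Qed.

Lemma fagree_refl n f : fagree n f f. Proof. by []. Qed.

(** A factor without constant term gains one degree of agreement. Every contraction below comes from
    this. *)
Lemma fagreeMS n f f' g : g 0%N = 0 -> fagree n f f' -> fagree n.+1 (f * g) (f' * g).
Proof.
move=> g0 H i; rewrite ltnS => ni; rewrite !fcoefM; apply: eq_bigr => k _.
case: (ltnP k n) => kn; first by rewrite H.
have -> : (i - k = 0)%N by apply/eqP; rewrite subn_eq0 (leq_trans ni).
by rewrite g0 !mulr0.
Qed.

Lemma fagreeP f g : (forall n, fagree n f g) -> f = g.
Proof. by move=> H; apply: fpsP => n; apply: (H n.+1). Qed.

(** Banach's fixed point theorem for the X-adic distance. *)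
Lemma fps_fixpoint (Phi : fps R -> fps R) :
  (forall n f g, fagree n f g -> fagree n.+1 (Phi f) (Phi g)) ->
  exists f, Phi f = f.
Proof.
move=> ctr.
have H m k : fagree m (iter m Phi 0) (iter (m + k) Phi 0).
  by elim: m k => // m IH k; rewrite addSn /=; apply: ctr.
(* The coefficient of index [n] no longer changes from the iterate [n.+1] on. *)
pose f := FPS (fun n => iter n.+1 Phi 0 n).
have fE n : fagree n f (iter n Phi 0).
  move=> i ni; change (f i) with (iter i.+1 Phi 0 i).
  by rewrite (H i.+1 (n - i.+1)%N i (ltnSn i)) subnKC.
exists f; apply: fagreeP => n i ni.
by rewrite (ctr _ _ _ (fE n) i (ltnW ni)) (fE n.+1 i (ltnW ni)).
Qed.

Lemma fps_fixpoint_unique (Phi : fps R -> fps R) f g :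
  (forall n f g, fagree n f g -> fagree n.+1 (Phi f) (Phi g)) ->
  Phi f = f -> Phi g = g -> f = g.
Proof.
move=> ctr ff gg; apply: fagreeP; elim=> [|n IH]; first by move=> i.
by rewrite -ff -gg; apply: ctr.
Qed.

Lemma fps_inv_exists f : f 0%N = 1 -> exists g, f * g = 1.
Proof.
move=> f0.
have [|g gg] := @fps_fixpoint (fun g => 1 + g * (1 - f)).
  move=> n g h H; apply: fagreeD => //; apply: fagreeMS => //.
  by rewrite fcoefD fcoefN fcoef1 f0 subrr.
exists g; rewrite -[X in _ = X](_ : 1 + g * (1 - f) - g * (1 - f) = 1); last by ring.
rewrite gg; ring.
Qed.

(** The default value 0 is taken when there is no inverse; it is applied to series of constant term
    1. *)
Definition finv f : fps R := xget 0 [set g | f * g = 1].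

Lemma fmulV f : f 0%N = 1 -> f * finv f = 1.
Proof. by move=> /fps_inv_exists [g fg]; exact: (@xgetPex _ 0 [set g | f * g = 1] (ex_intro _ g fg)). Qed.

Lemma fmulI f g h : f 0%N = 1 -> f * g = f * h -> g = h.
Proof.
move=> f0 fgh; rewrite -[g]mul1r -[h]mul1r -(fmulV f0).
by rewrite mulrAC fgh mulrAC.
Qed.

Section Composition.
Variable tau : fps R.
Hypothesis tau0 : tau 0%N = 0.

Lemma fcoefX_lt k n : (n < k)%N -> (tau ^+ k) n = 0.
Proof.
elim: k n => // k IH n nk; rewrite exprS fcoefM big1 // => i _.
case: (posnP i) => [->|i0]; first by rewrite tau0 mul0r.
by rewrite IH ?mulr0 //; move: (ltn_ord i) i0 nk; lia.
Qed.

Definition fcomp f : fps R := FPS (fun n => \sum_(k < n.+1) f k * (tau ^+ k) n).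

(** Substitution in a polynomial is a ring morphism, and [fcomp] coincides with it up to any given
    degree. *)
Let phi (p : {poly R}) : fps R := (map_poly fC p).[tau].

Let phiM p q : phi (p * q) = phi p * phi q.
Proof. by rewrite /phi rmorphM hornerM. Qed.

Let phiE p n : phi p n = \sum_(k < n.+1) p`_k * (tau ^+ k) n.
Proof.
have mapE i : (map_poly fC p)`_i = fC p`_i by rewrite coef_map.
rewrite /phi (@horner_coef_wide _ (maxn (size p) n.+1)); last first.
  by rewrite (leq_trans (size_poly _ _)) // leq_maxl.
rewrite fcoef_sum (@sum_ord_vanish _ (fun i => ((map_poly fC p)`_i * tau ^+ i) n) n.+1).
- by apply: eq_bigr => i _; rewrite mapE fcoefCM.
- by rewrite leq_maxr.
- by move=> i /andP[ni _]; rewrite mapE fcoefCM fcoefX_lt ?mulr0.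
Qed.

Let fcomp_phi N f n : (n <= N)%N -> fcomp f n = phi (ftrunc N f) n.
Proof.
move=> nN; rewrite phiE /=; apply: eq_bigr => i _.
by rewrite coef_ftrunc // (leq_trans _ nN) // -ltnS.
Qed.

Lemma fcompM f g : fcomp (f * g) = fcomp f * fcomp g.
Proof.
apply: fpsP => n; transitivity (phi (ftrunc n f * ftrunc n g) n).
  rewrite phiE /=; apply: eq_bigr => i _.
  by rewrite -(fmul_ftrunc f g) // -ltnS.
rewrite phiM; apply: (@fagreeM n.+1) => // i; rewrite ltnS => ni; exact/esym/fcomp_phi.
Qed.

Lemma fcompD f g : fcomp (f + g) = fcomp f + fcomp g.
Proof.
by apply: fpsP => n /=; rewrite -big_split /=; apply: eq_bigr => i _; rewrite mulrDl.
Qed.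

Lemma fcompC c : fcomp (fC c) = fC c.
Proof.
apply: fpsP => n; transitivity (c * (1 : fps R) n); last first.
  by rewrite fcoef1 /=; case: eqP; rewrite ?mulr1 ?mulr0.
transitivity (\sum_(k < n.+1) fC c k * (tau ^+ k) n) => //.
rewrite big_ord_recl big1 ?addr0 // => i _; exact: mul0r.
Qed.

Lemma fcompX : fcomp fX = tau.
Proof.
apply: fpsP => n; transitivity (\sum_(k < n.+1) @fX k * (tau ^+ k) n) => //.
case: n => [|n].
  by rewrite big_ord_recl big_ord0 addr0 tau0; exact: mul0r.
rewrite big_ord_recl (_ : _ * _ = 0); last exact: mul0r.
rewrite add0r big_ord_recl (_ : _ * _ = tau n.+1); last exact: mul1r.
rewrite big1 ?addr0 // => i _; exact: mul0r.
Qed.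

Lemma fcomp_expand f n : fagree n.+1 (fcomp f) (\sum_(k < n.+1) fC (f k) * tau ^+ k).
Proof.
move=> i; rewrite ltnS => ni; rewrite fcoef_sum (fcomp_phi _ ni) phiE.
rewrite (@sum_ord_vanish _ (fun k => (fC (f k) * tau ^+ k) i) i.+1) //; last first.
  by move=> k /andP[ik _]; rewrite fcoefCM fcoefX_lt ?mulr0.
apply: eq_bigr => k _.
by rewrite fcoefCM coef_ftrunc // (leq_trans _ ni) // -ltnS.
Qed.

End Composition.
End FpsRing.
Arguments fX {R}.

(** * Generating functions of labelled trees *)

Definition lstep (b : bool) (l : int) : int := if b then l + 1 else l - 1.

(** The forests that can hang from a node labelled [l]. The edge above each root is counted, so that
    [n] is the number of edges of the tree formed with that node. *)
Definition is_forest (l : int) (n : nat) (f : seq ltree) : bool :=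
  [&& all (fun c => (label c == l + 1) || (label c == l - 1)) f, all wf_labels f
    & sumn (map (fun c => (nedges c).+1) f) == n].

(** The choices for the first tree of a forest: label step up or down, and number of edges. *)
Definition sprouts (n : nat) : seq (bool * nat) :=
  [seq (b, i) | b <- [:: true; false], i <- iota 0 n.+1].

Lemma mem_sprouts n b i : ((b, i) \in sprouts n) = (i <= n)%N.
Proof.
apply/allpairsP/idP => [[[b' i'] [_ ii [_ ->]]]|ii].
  by rewrite mem_iota add0n ltnS in ii.
by exists (b, i); split=> //; [case: (b)|rewrite mem_iota add0n ltnS].
Qed.

Lemma uniq_sprouts n : uniq (sprouts n).
Proof. by apply: allpairs_uniq; rewrite ?iota_uniq // => -[? ?] [? ?]. Qed.

Lemma sum_sprouts (V : nmodType) n (F : bool * nat -> V) :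
  \sum_(p <- sprouts n) F p = \sum_(i < n.+1) (F (true, i : nat) + F (false, i : nat)).
Proof.
have iE : iota 0 n.+1 = index_iota 0 n.+1 by rewrite /index_iota subn0.
have -> : \sum_(p <- sprouts n) F p =
    \sum_(b <- [:: true; false]) \sum_(i <- iota 0 n.+1) F (b, i).
  by rewrite /sprouts big_allpairs_dep.
by rewrite iE 2!big_cons big_nil addr0 !big_mkord big_split.
Qed.

Section Enumeration.
Variable forests : int -> nat -> seq (seq ltree).

Definition children (l : int) (n : nat) : seq ltree :=
  [seq LNode (lstep p.1 l) g | p <- sprouts n,
                               g <- forests (lstep p.1 l) p.2].

(** Removal of the first tree. The edge above it accounts for the shift by one between [n] here and
    the size of the forest. *)
Definition forests_step (l : int) (n : nat) : seq (seq ltree) :=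
  [seq c :: f | c <- children l n, f <- forests l (n - nedges c)].
End Enumeration.

(* The fuel [k] only has to bound the number of edges [n]. *)
Fixpoint forests (k : nat) (l : int) (n : nat) {struct k} : seq (seq ltree) :=
  match n, k with
  | 0%N, _ => [:: [::]]
  | n'.+1, k'.+1 => forests_step (forests k') l n'
  | _, _ => [::]
  end.

Section EnumerationSpec.
Variables (k : nat).
Hypothesis memF : forall l n f, (n <= k)%N -> (f \in forests k l n) = is_forest l n f.
Hypothesis uniqF : forall l n, (n <= k)%N -> uniq (forests k l n).

Lemma nedges_LNode l n g : is_forest l n g -> forall l', nedges (LNode l' g) = n.
Proof. by case/and3P=> _ _ /eqP. Qed.

Lemma mem_children l n c : (n <= k)%N ->
  (c \in children (forests k) l n) =
  [&& (label c == l + 1) || (label c == l - 1), wf_labels c & (nedges c <= n)%N].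
Proof.
move=> nk; apply/allpairsPdep/and3P => [[[b i] [g []]]|].
  rewrite mem_sprouts [_.1]/= [_.2]/= => ii; rewrite memF ?(leq_trans ii) // => gF ->.
  have e := nedges_LNode gF; case/and3P: gF => g1 g2 g3; split.
  - by case: (b); rewrite /= eqxx ?orbT.
  - by rewrite /= g1 g2.
  - by rewrite (e (lstep b l)).
case: c => l' g [/= l'l /andP[g1 g2] gn].
have gF : is_forest l' (nedges (LNode l' g)) g by rewrite /is_forest g1 g2 /= eqxx.
have [b l'E] : exists b, l' = lstep b l.
  by case/orP: l'l => /eqP ->; [exists true|exists false].
exists (b, nedges (LNode l' g)), g; split.
- by rewrite mem_sprouts.
- by rewrite /= -l'E memF // (leq_trans gn).
- by rewrite l'E.
Qed.

Lemma uniq_children l n : (n <= k)%N -> uniq (children (forests k) l n).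
Proof.
move=> nk; apply: allpairs_uniq_dep => [||].
- exact: uniq_sprouts.
- by move=> [b i]; rewrite mem_sprouts => ii; apply: uniqF; apply: leq_trans nk.
(* The tree recovers its parameters: its root label gives the direction, its number of edges the
   size. *)
- have Hmem u : u \in [seq existT (fun=> seq ltree) x y | x <- sprouts n,
      y <- forests k (lstep x.1 l) x.2] -> is_forest (lstep (tag u).1 l) (tag u).2 (tagged u).
    case/allpairsPdep=> [[b i] [g []]]; rewrite mem_sprouts => ii gF ->.
    by move: gF; rewrite [_.1]/= [_.2]/= memF ?(leq_trans ii nk).
  move=> [[b i] g] [[b' i'] g'] /Hmem /= H /Hmem /= H' [E1 E2].
  rewrite -{}E2 in H' *; have <- : b = b'.
    by move: E1; rewrite /lstep; case: (b) (b') => -[] //; lia.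
  by rewrite -(nedges_LNode H l) (nedges_LNode H' l).
Qed.

Lemma mem_forests_step l n f : (n <= k)%N ->
  (f \in forests_step (forests k) l n) = is_forest l n.+1 f.
Proof.
move=> nk; apply/allpairsPdep/idP => [[c [g [cC gF ->]]]|].
  rewrite memF ?(leq_trans (leq_subr _ _)) // in gF.
  move: cC; rewrite mem_children // => /and3P[c1 c2 c3].
  case/and3P: gF => g1 g2 /eqP g3; rewrite /is_forest /= c1 c2 g1 g2 g3 /=.
  by rewrite addSn eqSS subnKC.
case: f => [|c g]; first by rewrite /is_forest.
case/and3P=> /= /andP[c1 g1] /andP[c2 g2]; rewrite addSn eqSS => /eqP g3.
exists c, g; split=> //; first by rewrite mem_children // c1 c2 -g3 leq_addr.
by rewrite memF ?(leq_trans (leq_subr _ _)) // /is_forest g1 g2 -g3 addKn eqxx.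
Qed.

Lemma uniq_forests_step l n : (n <= k)%N -> uniq (forests_step (forests k) l n).
Proof.
move=> nk; apply: allpairs_uniq_dep => [||].
- exact: uniq_children.
- by move=> c _; apply: uniqF; rewrite (leq_trans (leq_subr _ _)).
- by move=> [c g] [c' g'] _ _ /= [-> ->].
Qed.

End EnumerationSpec.

Lemma forestsP k : (forall l n f, (n <= k)%N -> (f \in forests k l n) = is_forest l n f) /\
  (forall l n, (n <= k)%N -> uniq (forests k l n)).
Proof.
have F0 l f : is_forest l 0 f = (f == [::]) by case: f => [|c f] //; rewrite /is_forest /= addSn !andbF.
elim: k => [|k [IH1 IH2]].
  by split=> l [|n] // f _; rewrite F0 inE.
split=> l [|n]; rewrite ?ltnS //=; first by move=> f _; rewrite F0 inE.
  by move=> f nk; apply: mem_forests_step.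
by move=> nk; apply: uniq_forests_step.
Qed.

Section Weights.
Variables (R : comNzRingType) (u : R) (j : int).

Definition fweight (f : seq ltree) : R := \prod_(c <- f) u ^+ nlabel j c.

Lemma weight_LNode l f : u ^+ nlabel j (LNode l f) = u ^+ (l == j) * fweight f.
Proof.
rewrite /= exprD; congr (_ * _); rewrite /fweight.
by elim: f => [|c f IH]; rewrite ?big_nil //= big_cons exprD IH.
Qed.

(** The weight of the node labelled [l] above the forest is left out; this is why the factors
    [u ^+ (l + 1 == j)] and [u ^+ (l - 1 == j)] appear in the recursion. *)
Definition forest_sum (l : int) (n : nat) : R := \sum_(f <- forests n l n) fweight f.

Lemma forest_sumE k l n : (n <= k)%N ->
  \sum_(f <- forests k l n) fweight f = forest_sum l n.
Proof.
move=> nk; have [m1 u1] := forestsP k; have [m2 u2] := forestsP n.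
by apply: perm_big; apply: uniq_perm; rewrite ?u1 ?u2 // => f; rewrite m1 ?m2.
Qed.

Lemma forest_sum0 l : forest_sum l 0 = 1.
Proof. by rewrite /forest_sum big_seq1 /fweight big_nil. Qed.

Lemma forest_sumS l n : forest_sum l n.+1 = \sum_(i < n.+1)
  (u ^+ (l + 1 == j) * forest_sum (l + 1) i + u ^+ (l - 1 == j) * forest_sum (l - 1) i)
    * forest_sum l (n - i).
Proof.
have [memF uniqF] := forestsP n.
rewrite /forest_sum [forests n.+1 _ _]/(forests_step (forests n) l n) big_allpairs_dep.
under eq_bigr => c _.
  under eq_bigr => f _ do rewrite /fweight big_cons.
  rewrite -big_distrr /= forest_sumE ?leq_subr //; over.
rewrite /children big_allpairs_dep sum_sprouts.
apply: eq_bigr => i _; rewrite mulrDl.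
have E b : \sum_(g <- forests n (lstep b l) i)
   u ^+ nlabel j (LNode (lstep b l) g) * forest_sum l (n - nedges (LNode (lstep b l) g))
   = u ^+ (lstep b l == j) * forest_sum (lstep b l) i * forest_sum l (n - i).
  rewrite big_seq; under eq_bigr => g.
    rewrite memF ?leq_ord // => gF.
    rewrite weight_LNode (nedges_LNode gF); over.
  rewrite -big_seq /= -big_distrl -big_distrr /= forest_sumE ?leq_ord //.
by congr (_ + _); [exact: (E true)|exact: (E false)].
Qed.

End Weights.

Lemma labelled_treesE n : labelled_trees n = [set` [seq LNode 0 f | f <- forests n 0 n]].
Proof.
have [memF _] := forestsP n.
apply/seteqP; split=> [[l f] [/= -> [/andP[f1 f2] f3]]|t /mapP[f fF ->]].
  apply/mapP; exists f => //; rewrite memF // /is_forest f1 f2 /=; exact/eqP.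
by move: fF; rewrite memF // => /and3P[f1 f2 /eqP f3]; split=> //; split=> //=; rewrite f1 f2.
Qed.

Lemma sum_labelled_trees (R : realType) n (F : ltree -> R) :
  \sum_(t \in labelled_trees n) F t = \sum_(f <- forests n 0 n) F (LNode 0 f).
Proof.
have [_ uniqF] := forestsP n.
rewrite labelled_treesE -fsbig_seq; first exact: big_map.
by rewrite map_inj_uniq ?uniqF // => f g [].
Qed.

(** * Explicit solution of the system and Lagrange inversion *)

Section Explicit.
Variable R : realFieldType.
Local Notation X := (@fX R).

Lemma half_fps : 2 * fC (1 / 2) = 1 :> fps R.
Proof.
have -> : (2 : fps R) = fC 2 by rewrite rmorph_nat.
by rewrite -rmorphM (_ : 2 * (1 / 2) = 1) ?rmorph1 //; field.
Qed.

(** With [X] for [w], this is [Z + 1/Z = 2/w]. Writing [S_l = (1 + w) (1 + d_l)] and keeping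
    first-order terms gives [d_l = (w/2) (d_(l+1) + d_(l-1))], which [Z ^ l] solves; the branch
    vanishing at 0 is the decaying one. *)
Lemma Z_exists : exists Z : fps R, 2 * Z = X * (1 + Z ^+ 2) /\ Z 0%N = 0.
Proof.
pose Phi (Z : fps R) := (1 + Z ^+ 2) * (fC (1 / 2) * X).
have half := half_fps.
have [n f g fg|Z ZE] := @fps_fixpoint _ Phi.
  apply: fagreeMS; first by rewrite fcoefM0 mulr0.
  by apply: fagreeD => //; rewrite !expr2; apply: fagreeM.
exists Z; split.
- transitivity ((2 * fC (1 / 2)) * (X * (1 + Z ^+ 2))); last by rewrite half mul1r.
  by rewrite -{1}ZE /Phi; move: (fC (1 / 2)) => h; ring.
- by rewrite -ZE fcoefM0 fcoefM0 !mulr0.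
Qed.

Definition Zs : fps R := sval (cid Z_exists).
Local Notation Z := Zs.
Lemma Zs_eq : 2 * Z = X * (1 + Z ^+ 2). Proof. by rewrite /Zs; case: cid => ? []. Qed.

Lemma Zs0 : Z 0%N = 0. Proof. by rewrite /Zs; case: cid => ? []. Qed.
Lemma ZsX0 k : (0 < k)%N -> (Z ^+ k) 0%N = 0.
Proof. by move=> k0; apply: fcoefX_lt => //; exact: Zs0. Qed.

Definition Ks : fps R := (1 + Z ^+ 2) * (finv (1 - Z ^+ 2) * (finv (1 - Z) * finv (1 - Z ^+ 3))).
Local Notation K := Ks.

Lemma Ks_eq : (1 - Z ^+ 2) * (1 - Z) * (1 - Z ^+ 3) * K = 1 + Z ^+ 2.
Proof.
have H k : (0 < k)%N -> (1 - Z ^+ k) * finv (1 - Z ^+ k) = 1.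
  by move=> k0; apply: fmulV; rewrite fcoefD fcoefN fcoef1 ZsX0 // subr0.
have H1 := H 1%N isT; have H2 := H 2 isT; have H3 := H 3 isT; rewrite expr1 in H1.
rewrite /K; move: H3 H2 H1.
move: (finv (1 - Z ^+ 2)) (finv (1 - Z)) (finv (1 - Z ^+ 3)) => a b c Hc Ha Hb.
transitivity ((1 + Z ^+ 2) * ((1 - Z ^+ 2) * a) * ((1 - Z) * b) * ((1 - Z ^+ 3) * c)).
  ring.
by rewrite Ha Hb Hc; ring.
Qed.

(** The recurrence away from [j] holds for any [m]; the equation at [j], with its weight [1 + x],
    selects [m]. It is written here solved for its linear term, which makes it a contraction. *)
Definition muPhi (x : R) (m : fps R) : fps R :=
  m ^+ 2 * Z ^+ 2 + fC x * K * ((1 + m * Z) * (1 + m * Z ^+ 2) * (1 + m * Z ^+ 3)).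

Lemma muPhi_contract x n f g : fagree n f g -> fagree n.+1 (muPhi x f) (muPhi x g).
Proof.
move=> fg.
have H k : (0 < k)%N -> fagree n.+1 (1 + f * Z ^+ k) (1 + g * Z ^+ k).
  by move=> k0; apply: fagreeD => //; apply: fagreeMS => //; exact: ZsX0.
apply: fagreeD; first by apply: fagreeMS; [exact: ZsX0|rewrite !expr2; exact: fagreeM].
apply: fagreeM => //; apply: fagreeM (H 3 isT); exact: fagreeM (H 1%N isT) (H 2 isT).
Qed.

Lemma mu_exists x : exists m : fps R, muPhi x m = m.
Proof. by apply: fps_fixpoint => n f g; exact: muPhi_contract. Qed.

Definition mus x : fps R := sval (cid (mu_exists x)).

Lemma mus_fix x : muPhi x (mus x) = mus x.
Proof. by rewrite /mus; case: cid. Qed.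

Lemma mus0 : mus 0 = 0.
Proof.
apply: (fps_fixpoint_unique (@muPhi_contract 0)); first exact: mus_fix.
by rewrite /muPhi rmorph0 !mul0r addr0 expr2 !mul0r.
Qed.

Section Fixed_x.
Variable x : R.
Local Notation m := (mus x).

Definition as_ k : fps R := 1 + m * Z ^+ k.

Lemma as_0 k : (0 < k)%N -> as_ k 0%N = 1.
Proof. by move=> k0; rewrite /as_ fcoefD fcoefM0 ZsX0 // mulr0 addr0. Qed.

(** The quotient [a_i a_(i+4) / (a_(i+1) a_(i+3))] minus 1. The factored numerator displays a double
    zero at [Z = 1], on which the bounds on the circle rely. *)
Definition Ds i : fps R :=
  m * Z ^+ i * (1 - Z) * (1 - Z ^+ 3) * finv (as_ i.+1 * as_ i.+3).

Lemma Ds_eq i : as_ i.+1 * as_ i.+3 * Ds i = m * Z ^+ i * (1 - Z) * (1 - Z ^+ 3).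
Proof.
have H : (as_ i.+1 * as_ i.+3) * finv (as_ i.+1 * as_ i.+3) = 1.
  by apply: fmulV; rewrite fcoefM0 !as_0 // mulr1.
by rewrite /Ds mulrCA H mulr1.
Qed.

Definition Ps i : fps R := (1 + X) * (1 + Ds i).

Lemma Ps_eq i : as_ i.+1 * as_ i.+3 * Ps i = (1 + X) * (as_ i * as_ (i + 4)).
Proof.
rewrite /Ps mulrCA mulrDr mulr1 Ds_eq /as_ exprD !exprS; congr (_ * _).
by move: (Z ^+ i) => y; ring.
Qed.

Definition taus : fps R := fC (1 / 2) * X * finv (1 + X) ^+ 2.

Lemma taus0 : taus 0%N = 0.
Proof. by rewrite /taus fcoefM0 fcoefM0 mulr0 mul0r. Qed.

Lemma taus_eq : taus * (1 + X) ^+ 2 = fC (1 / 2) * X.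
Proof.
have H : (1 + X) * finv (1 + X) = 1 by apply: fmulV; rewrite fcoefD addr0.
transitivity (fC (1 / 2) * X * ((1 + X) * finv (1 + X)) ^+ 2); first by rewrite /taus; ring.
by rewrite H expr1n mulr1.
Qed.

Lemma halfX_Zs : fC (1 / 2) * X * (1 + Z ^+ 2) = Z.
Proof. by rewrite -mulrA -Zs_eq mulrCA mulrA half_fps mul1r. Qed.

Lemma X_Zs : (1 + Z ^+ 2) * (1 + X) = (1 + Z) ^+ 2.
Proof. by rewrite mulrDr mulr1 [X in _ + X]mulrC -Zs_eq; ring. Qed.

Lemma mus_eq : m * (1 - m * Z ^+ 2) * ((1 - Z ^+ 2) * (1 - Z) * (1 - Z ^+ 3)) =
  fC x * (1 + Z ^+ 2) * (as_ 1 * as_ 2 * as_ 3).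
Proof.
have E := mus_fix x.
rewrite -Ks_eq /as_ expr1.
have -> : m * (1 - m * Z ^+ 2) = m - m ^+ 2 * Z ^+ 2 by ring.
rewrite -{1}E /muPhi; ring.
Qed.

(** After multiplication by the invertible series [1 + Z^2] and [a_(i+1) ... a_(i+5)], the claim is
    a polynomial identity in [m], [Z] and [Z ^ i]. The series [a_i], which need not have constant
    term 1 at [i = 0], only occurs in numerators. *)
Lemma Ps_rec i : Ps i.+1 = 1 + taus * (Ps i.+2 + Ps i) * Ps i.+1.
Proof.
have E0 := Ps_eq i; have E1 := Ps_eq i.+1; have E2 := Ps_eq i.+2.
rewrite !addnS !addn0 in E0 E1 E2.
pose A5 := as_ i.+1 * as_ i.+2 * as_ i.+3 * as_ i.+4 * as_ i.+4.+1.
have u1 : ((1 + Z ^+ 2) * A5) 0%N = 1.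
  by rewrite /A5 !fcoefM0 !as_0 // fcoefD ZsX0 // fcoef1 addr0 !mulr1.
apply: (fmulI u1).
transitivity (as_ i.+1 * as_ i.+3 * as_ i.+4.+1 * (as_ i.+1 * as_ i.+4.+1) * (1 + Z) ^+ 2).
  transitivity (as_ i.+1 * as_ i.+3 * as_ i.+4.+1 * (1 + Z ^+ 2) * (as_ i.+2 * as_ i.+4 * Ps i.+1)).
    by rewrite /A5; ring.
  by rewrite E1 -X_Zs; ring.
transitivity ((1 + Z ^+ 2) * A5 + (1 + Z ^+ 2) * (
  taus * (as_ i.+1 * (as_ i.+3 * as_ i.+4.+1 * Ps i.+2) * (as_ i.+2 * as_ i.+4 * Ps i.+1)
     + as_ i.+4.+1 * (as_ i.+1 * as_ i.+3 * Ps i) * (as_ i.+2 * as_ i.+4 * Ps i.+1)))); last first.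
  by rewrite /A5; ring.
rewrite E0 E1 E2.
transitivity ((1 + Z ^+ 2) * A5 + (taus * (1 + X) ^+ 2) * (1 + Z ^+ 2) * (
  as_ i.+1 * (as_ i.+2 * as_ i.+4.+2) * (as_ i.+1 * as_ i.+4.+1) +
  as_ i.+4.+1 * (as_ i * as_ i.+4) * (as_ i.+1 * as_ i.+4.+1))); last by ring.
rewrite taus_eq halfX_Zs /A5 /as_ !exprS.
by move: (Z ^+ i) => y; ring.
Qed.

(** Both neighbours of [j] are at distance 1, hence [Ps 1 + Ps 1]. The defining equation of [m]
    supplies the term in [x]. *)
Lemma Ps_rec0 : Ps 0 = fC (1 + x) + taus * (Ps 1 + Ps 1) * Ps 0.
Proof.
have E0 := Ps_eq 0; have E1 := Ps_eq 1; rewrite !addnS !addn0 in E0 E1.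
have M := mus_eq.
pose A5 := as_ 1 * as_ 2 * as_ 3 * as_ 4.
have u1 : ((1 + Z ^+ 2) * A5) 0%N = 1.
  by rewrite /A5 !fcoefM0 !as_0 // fcoefD ZsX0 // fcoef1 addr0 !mulr1.
apply: (fmulI u1).
transitivity (as_ 2 * as_ 4 * (as_ 0 * as_ 4) * (1 + Z) ^+ 2).
  transitivity (as_ 2 * as_ 4 * (1 + Z ^+ 2) * (as_ 1 * as_ 3 * Ps 0)).
    by rewrite /A5; ring.
  by rewrite E0 -X_Zs; ring.
transitivity ((1 + Z ^+ 2) * A5 + as_ 4 * (fC x * (1 + Z ^+ 2) * (as_ 1 * as_ 2 * as_ 3))
  + (1 + Z ^+ 2) * (2 * taus * ((as_ 2 * as_ 4 * Ps 1) * (as_ 1 * as_ 3 * Ps 0)))); last first.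
  by rewrite /A5 rmorphD rmorph1; ring.
rewrite E0 E1 -M.
transitivity ((1 + Z ^+ 2) * A5 +
   as_ 4 * (m * (1 - m * Z ^+ 2) * ((1 - Z ^+ 2) * (1 - Z) * (1 - Z ^+ 3))) +
  2 * ((taus * (1 + X) ^+ 2) * (1 + Z ^+ 2)) * (as_ 1 * as_ 5 * (as_ 0 * as_ 4))); last by ring.
rewrite taus_eq halfX_Zs /A5 /as_ expr0 expr1; ring.
Qed.

(** Lagrange inversion on a power of [taus]: with [p = n - k > 0] the coefficient is
    [C(2p-1, p) - C(2p-1, p-1)], zero by symmetry of the binomial coefficients. *)
Lemma lagrange_taus k n : (k <= n)%N ->
  2 ^+ n * ((1 + X) ^+ n.*2 * (1 - X) * finv (1 + X) * taus ^+ k) n = (k == n)%:R.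
Proof.
move=> kn; set I := finv (1 + X).
have HI : (1 + X) * I = 1 by apply: fmulV; rewrite fcoefD addr0.
have -> : (1 + X) ^+ n.*2 * (1 - X) * I * taus ^+ k =
  fC ((1 / 2) ^+ k) * (X ^+ k * ((1 + X) ^+ (n - k).*2 * ((1 - X) * I))).
  rewrite /taus -/I 2!exprMn -exprM mul2n rmorphXn -{1}(subnK kn) doubleD exprD.
  have E : (1 + X) ^+ k.*2 * I ^+ k.*2 = 1 by rewrite -exprMn HI expr1n.
  transitivity (fC (1 / 2) ^+ k * (X ^+ k * ((1 + X) ^+ (n - k).*2 * ((1 - X) * I))) *
    ((1 + X) ^+ k.*2 * I ^+ k.*2)); first by ring.
  by rewrite E mulr1.
rewrite fcoefCM fcoefXnM kn.
have [->|neq] := eqVneq k n.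
  have I0 : I 0%N = 1.
    have := congr1 (fun f : fps R => f 0%N) HI; rewrite fcoefM0 fcoefD fcoef1.
    by rewrite (_ : X 0%N = 0) // addr0 mul1r.
  have -> : ((1 + X) ^+ (n - n).*2 * ((1 - X) * I)) (n - n)%N = 1.
    by rewrite subnn double0 expr0 mul1r fcoefM0 I0 fcoefD fcoefN (_ : X 0%N = 0) // subr0 mulr1.
  by rewrite !mulr1 -exprMn (_ : 2 * (1 / 2) = 1) ?expr1n //; field.
have -> : (n - k = (n - k).-1.+1)%N by lia.
move: (n - k).-1 => m'.
have -> : (1 + X) ^+ m'.+1.*2 * ((1 - X) * I) = (1 + X) ^+ m'.*2.+1 - X * (1 + X) ^+ m'.*2.+1.
  rewrite doubleS exprS; move: ((1 + X) ^+ m'.*2.+1) => y.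
  transitivity (((1 + X) * I) * (y - X * y)); first by ring.
  by rewrite HI mul1r.
rewrite fcoefD fcoefN fcoefXM !fcoef1DXn.
have -> : 'C(m'.*2.+1, m'.+1) = 'C(m'.*2.+1, m').
  by rewrite -bin_sub; [congr 'C(_, _); lia|lia].
by rewrite subrr !mulr0.
Qed.

(** The factor [(1 - X) / (1 + X)] is [X] times the logarithmic derivative of [taus], and
    [2^n (1 + X)^(2n)] comes from its [n]-th negative power. *)
Lemma lagrange (f : fps R) n :
  f n = 2 ^+ n * ((1 + X) ^+ n.*2 * (1 - X) * finv (1 + X) * fcomp taus f) n.
Proof.
set G := _ * finv _.
have H := fagreeM (fagree_refl (n := n.+1) G) (fcomp_expand taus0 f (n := n)).
rewrite (H n (ltnSn n)).
have -> : (G * \sum_(k < n.+1) fC (f k) * taus ^+ k) n =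
    \sum_(k < n.+1) (G * (fC (f k) * taus ^+ k)) n.
  by rewrite -fcoef_sum -mulr_sumr.
rewrite mulr_sumr (bigD1 (@ord_max n)) //.
have LE k : (k <= n)%N -> 2 ^+ n * (G * taus ^+ k) n = (k == n)%:R by exact: lagrange_taus.
have E k : 2 ^+ n * (G * (fC (f k) * taus ^+ k)) n = f k * (2 ^+ n * (G * taus ^+ k) n).
  by rewrite [G * _]mulrCA fcoefCM mulrCA.
rewrite E LE // eqxx mulr1 big1; first by rewrite [RHS]addr0.
move=> i ni; rewrite E LE ?leq_ord // (_ : (i == n :> nat) = false) ?mulr0 //.
by apply/negbTE.
Qed.

Lemma tree_fps (j : int) n l :
  (1 + x) ^+ (l == j) * forest_sum (1 + x) j l n =
  2 ^+ n * ((1 + X) ^+ n.*2 * (1 - X) * (1 + Ds `|l - j|)) n.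
Proof.
pose S (l : int) : fps R := FPS (fun n => (1 + x) ^+ (l == j) * forest_sum (1 + x) j l n).
have SE l' : S l' = fC ((1 + x) ^+ (l' == j)) + X * ((S (l' + 1) + S (l' - 1)) * S l').
  apply: fpsP => -[|n']; rewrite fcoefD fcoefXM.
    by rewrite /= forest_sum0 mulr1 addr0.
  rewrite add0r [LHS]/= forest_sumS mulr_sumr fcoefM; apply: eq_bigr => i _.
  by rewrite mulrCA fcoefD.
pose G l := fcomp taus (S l).
have GE l' : G l' = fC ((1 + x) ^+ (l' == j)) + taus * ((G (l' + 1) + G (l' - 1)) * G l').
  rewrite /G {1}SE fcompD !(fcompM taus0) (fcompX taus0) fcompC fcompD //.
pose H l := Ps `|l - j|.
have HE l' : H l' = fC ((1 + x) ^+ (l' == j)) + taus * ((H (l' + 1) + H (l' - 1)) * H l').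
  rewrite /H; have [->|nej] := eqVneq l' j.
    have -> : `|(j + 1 - j)%R|%N = 1%N by lia.
    have -> : `|(j - 1 - j)%R|%N = 1%N by lia.
    by rewrite subrr expr1 mulrA -Ps_rec0.
  rewrite expr0 rmorph1 mulrA.
  have [i [Ei [[E1 E2]|[E1 E2]]]] : exists i : nat, `|(l' - j)%R|%N = i.+1 /\
      ((`|(l' + 1 - j)%R|%N = i.+2 /\ `|(l' - 1 - j)%R|%N = i) \/
       (`|(l' + 1 - j)%R|%N = i /\ `|(l' - 1 - j)%R|%N = i.+2)).
    exists (`|(l' - j)%R|%N.-1); case: (ltrP l' j) => lj; lia.
  - by rewrite Ei E1 E2 -Ps_rec.
  - by rewrite Ei E1 E2 [Ps i + _]addrC -Ps_rec.
(* Both families solve the same infinite system. As [taus] has no constant term, agreement at order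
   [k] for all labels together yields order [k.+1]. *)
have GH k : forall l, fagree k (G l) (H l).
  elim: k => [|k IH] l'; first by move=> i.
  rewrite GE HE; apply: fagreeD => //; rewrite ![taus * _]mulrC.
  by apply: fagreeMS; [exact: taus0|apply: fagreeM => //; apply: fagreeD].
have GHl : G l = H l by apply: fagreeP => k; exact: GH.
have -> : (1 + x) ^+ (l == j) * forest_sum (1 + x) j l n = S l n by [].
rewrite (lagrange (S l)) -/(G l) GHl /H /Ps; congr (_ * _).
have HI : (1 + X) * finv (1 + X) = 1 by apply: fmulV; rewrite fcoefD addr0.
congr (fcoef _ n).
transitivity ((1 + X) ^+ n.*2 * (1 - X) * (1 + Ds `|l - j|) * ((1 + X) * finv (1 + X))); first by ring.
by rewrite HI mulr1.
Qed.

End Fixed_x.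
End Explicit.

Lemma coef_catalan (R : realFieldType) n :
  ((1 + fX) ^+ n.*2 * (1 - fX) : fps R) n = 'C(n.*2, n)%:R / n.+1%:R.
Proof.
rewrite mulrBr mulr1 fcoefD fcoefN [_ * fX]mulrC fcoefXM !fcoef1DXn.
case: n => [|n]; first by rewrite bin0 subr0 divr1.
rewrite fcoef1DXn.
have E : ('C(n.+1.*2, n.+1) * n.+1 = 'C(n.+1.*2, n) * n.+2)%N.
  have := mul_bin_left n.+1.*2 n; rewrite (_ : n.+1.*2 - n = n.+2)%N; last lia.
  lia.
apply: (mulIf (_ : n.+2%:R != 0)); first by rewrite pnatr_eq0.
rewrite mulfVK ?pnatr_eq0 // mulrBl -!natrM -E -natrB; last by rewrite leq_mul2l ltnW ?orbT.
by rewrite -mulnBr subSn // subnn muln1.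
Qed.

Lemma expect_pow (R : realType) (n j : nat) (x : R) :
  unif_expect n (fun t => (1 + x) ^+ nlabel j t) =
  1 + n.+1%:R / 'C(n.*2, n)%:R * ((1 + fX) ^+ n.*2 * (1 - fX) * Ds x j) n.
Proof.
have H (y : R) : \sum_(t \in labelled_trees n) (1 + y) ^+ nlabel j t =
  2 ^+ n * ((1 + fX) ^+ n.*2 * (1 - fX) * (1 + Ds y j)) n.
  rewrite sum_labelled_trees.
  under eq_bigr do rewrite weight_LNode.
  rewrite -big_distrr /= -/(forest_sum (1 + y) j 0 n) tree_fps.
  by rewrite sub0r abszN.
(* At [x = 0] nothing is marked: this case counts the trees and gives the denominator. *)
have D0 : Ds (0 : R) j = 0 by rewrite /Ds mus0 !mul0r.
have C0 : ('C(n.*2, n)%:R : R) != 0 by rewrite pnatr_eq0 -lt0n bin_gt0 -addnn leq_addr.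
rewrite /unif_expect H; have := H 0.
under eq_fsbigr do rewrite addr0 expr1n.
move=> ->; rewrite D0 addr0.
set A : fps R := _ * (1 - fX).
have -> : A * (1 + Ds x j) = A + A * Ds x j by rewrite mulrDr mulr1.
rewrite mulr1 fcoefD coef_catalan.
move: (fcoef (A * _) n) => a; field.
by rewrite C0 expf_neq0 ?pnatr_eq0 // nat1r pnatr_eq0.
Qed.

(** * Complex numbers and limits *)

Local Open Scope complex_scope.
Local Notation Re := (@complex.Re _).
Local Notation Im := (@complex.Im _).

Section ComplexBasics.
Variable R : realType.
Implicit Types z w : R[i].

(** The norm of [R[i]] takes its values in [R[i]]; this is its real-valued version. *)
Definition cabs z : R := Normc.normc z.

Lemma cabsE z : `|z| = (cabs z)%:C. Proof. by []. Qed.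

Lemma cabs_ge0 z : 0 <= cabs z.
Proof. by rewrite -ler0c -cabsE normr_ge0. Qed.

Lemma cabsM z w : cabs (z * w) = cabs z * cabs w. Proof. exact: Normc.normcM. Qed.
Lemma cabsV z : cabs z^-1 = (cabs z)^-1. Proof. exact: Normc.normcV. Qed.
Lemma cabs0 : cabs 0 = 0. Proof. exact: Normc.normc0. Qed.
Lemma cabs1 : cabs 1 = 1. Proof. exact: Normc.normc1. Qed.
Lemma cabsN z : cabs (- z) = cabs z.
Proof. by apply: complexI; rewrite -!cabsE normrN. Qed.
Lemma cabsB z w : cabs (z - w) = cabs (w - z). Proof. by rewrite -cabsN opprB. Qed.
Lemma cabsX z n : cabs (z ^+ n) = cabs z ^+ n.
Proof. by elim: n => [|n IH]; rewrite ?cabs1 // !exprS cabsM IH. Qed.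
Lemma cabsD z w : cabs (z + w) <= cabs z + cabs w.
Proof. by rewrite -lecR rmorphD /= -!cabsE ler_normD. Qed.
Lemma cabs_le_sub z w : cabs (z - w) <= cabs z + cabs w.
Proof. by rewrite -(cabsN w) cabsD. Qed.
Lemma cabs_sub_le z w : cabs z - cabs w <= cabs (z - w).
Proof. by rewrite lerBlDr -{1}(subrK w z) cabsD. Qed.
Lemma cabs_eq0 z : (cabs z == 0) = (z == 0).
Proof. by apply/eqP/eqP => [/Normc.eq0_normc //|->]; exact: cabs0. Qed.
Lemma cabs_gt0 z : (0 < cabs z) = (z != 0).
Proof. by rewrite lt_def cabs_ge0 andbT cabs_eq0. Qed.
Lemma cabs_sqr z : cabs z ^+ 2 = Re z ^+ 2 + Im z ^+ 2.
Proof. by case: z => a b /=; rewrite sqr_sqrtr // addr_ge0 // sqr_ge0. Qed.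
Lemma cabs_real (r : R) : cabs r%:C = `|r|.
Proof. by rewrite /cabs /= expr0n addr0 sqrtr_sqr. Qed.
Lemma cabs_nat n : cabs (n%:R : R[i]) = n%:R.
Proof. by rewrite -(rmorph_nat (real_complex R)) cabs_real ger0_norm. Qed.
Lemma Re_le_cabs z : `|Re z| <= cabs z.
Proof. by rewrite -lecR -cabsE normc_ge_Re. Qed.
Lemma Im_le_cabs z : `|Im z| <= cabs z.
Proof.
by case: z => a b; rewrite /cabs /= -sqrtr_sqr ler_wsqrtr // lerDr sqr_ge0.
Qed.
Lemma cabs_le_ReIm z : cabs z <= `|Re z| + `|Im z|.
Proof.
rewrite -(@ler_pXn2r _ 2) ?nnegrE ?cabs_ge0 ?addr_ge0 //.
rewrite cabs_sqr sqrrD -!normrX !(ger0_norm (sqr_ge0 _)) addrAC lerDl.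
by rewrite mulrn_wge0 // mulr_ge0.
Qed.
Lemma cabs_sum (I : Type) (r : seq I) (F : I -> R[i]) :
  cabs (\sum_(i <- r) F i) <= \sum_(i <- r) cabs (F i).
Proof.
elim: r => [|i r IH]; first by rewrite !big_nil cabs0.
by rewrite !big_cons (le_trans (cabsD _ _)) // lerD2l.
Qed.
Lemma cabs_conj z : cabs z^* = cabs z.
Proof. by case: z => a b; rewrite /cabs /= sqrrN. Qed.

Lemma ReM z w : Re (z * w) = Re z * Re w - Im z * Im w.
Proof. by case: z w => a b [c d]. Qed.
Lemma ImM z w : Im (z * w) = Re z * Im w + Im z * Re w.
Proof. by case: z w => a b [c d]. Qed.
Lemma ReD z w : Re (z + w) = Re z + Re w. Proof. by case: z w => a b [c d]. Qed.
Lemma ImD z w : Im (z + w) = Im z + Im w. Proof. by case: z w => a b [c d]. Qed.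
Lemma ReN z : Re (- z) = - Re z. Proof. by case: z. Qed.
Lemma ImN z : Im (- z) = - Im z. Proof. by case: z. Qed.
Lemma ReB z w : Re (z - w) = Re z - Re w. Proof. by rewrite ReD ReN. Qed.
Lemma ImB z w : Im (z - w) = Im z - Im w. Proof. by rewrite ImD ImN. Qed.
Lemma Re_sum (I : Type) (r : seq I) (F : I -> R[i]) :
  Re (\sum_(i <- r) F i) = \sum_(i <- r) Re (F i).
Proof. by elim: r => [|i r IH]; rewrite ?big_nil // !big_cons ReD IH. Qed.
Lemma Im_sum (I : Type) (r : seq I) (F : I -> R[i]) :
  Im (\sum_(i <- r) F i) = \sum_(i <- r) Im (F i).
Proof. by elim: r => [|i r IH]; rewrite ?big_nil // !big_cons ImD IH. Qed.
Lemma ReCM (r : R) z : Re (r%:C * z) = r * Re z. Proof. by rewrite ReM /= mul0r subr0. Qed.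
Lemma ImCM (r : R) z : Im (r%:C * z) = r * Im z. Proof. by rewrite ImM /= mul0r addr0. Qed.
Lemma ReV z : Re z^-1 = Re z / (cabs z ^+ 2).
Proof. by case: z => a b; rewrite cabs_sqr /=. Qed.
Lemma ImV z : Im z^-1 = - Im z / (cabs z ^+ 2).
Proof. by case: z => a b; rewrite cabs_sqr /= mulNr. Qed.
Lemma complex_ext z w : Re z = Re w -> Im z = Im w -> z = w.
Proof. by case: z w => a b [c d] /= -> ->. Qed.

End ComplexBasics.

Section ComplexLimits.
Variables (R : realType) (T : Type) (F : set_system T).
Context {FF : Filter F}.
Implicit Types (f g : T -> R[i]) (l k : R[i]).

(** Componentwise, like the series [Aval] and the contour integrals of the statement. *)
Definition ccvg f l := (Re (f x) @[x --> F] --> Re l) /\ (Im (f x) @[x --> F] --> Im l).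

Lemma ccvg_abs f l : ccvg f l <-> cabs (f x - l) @[x --> F] --> (0 : R).
Proof.
split=> [[fr fi]|H].
  apply: (@squeeze_cvgr _ _ _ _ (fun=> 0) (fun x => `|Re (f x) - Re l| + `|Im (f x) - Im l|)).
  - by near=> x; rewrite cabs_ge0 (le_trans (cabs_le_ReIm _)) // ReB ImB.
  - exact: cvg_cst.
  - rewrite -[X in _ --> X](_ : `|Re l - Re l| + `|Im l - Im l| = 0); last by rewrite !subrr normr0 addr0.
    by apply: cvgD; apply: cvg_norm; apply: cvgB => //; exact: cvg_cst.
have P (h : R[i] -> R) : (forall z w, `|h z - h w| <= cabs (z - w)) -> h (f x) @[x --> F] --> h l.
  move=> hh; apply/cvgrPdist_lt => e e0; near=> x; apply: (@le_lt_trans _ _ `|cabs (f x - l)|).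
    by rewrite distrC (ger0_norm (cabs_ge0 _)).
  by near: x; exact: (cvgr0_norm_lt _ H _ e0).
by split; apply: P => z w; rewrite -?ReB -?ImB ?Re_le_cabs ?Im_le_cabs.
Unshelve. all: by end_near. Qed.

Lemma ccvg_cst l : ccvg (fun=> l) l. Proof. by split; exact: cvg_cst. Qed.

Lemma ccvgD f g l k : ccvg f l -> ccvg g k -> ccvg (fun x => f x + g x) (l + k).
Proof.
move=> [fr fi] [gr gi]; split.
  by rewrite ReD; under eq_fun do rewrite ReD; exact: cvgD.
by rewrite ImD; under eq_fun do rewrite ImD; exact: cvgD.
Qed.

Lemma ccvgN f l : ccvg f l -> ccvg (fun x => - f x) (- l).
Proof.
move=> [fr fi]; split.
  by rewrite ReN; under eq_fun do rewrite ReN; exact: cvgN.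
by rewrite ImN; under eq_fun do rewrite ImN; exact: cvgN.
Qed.

Lemma ccvgB f g l k : ccvg f l -> ccvg g k -> ccvg (fun x => f x - g x) (l - k).
Proof. by move=> fl gk; apply: ccvgD => //; exact: ccvgN. Qed.

Lemma ccvgM f g l k : ccvg f l -> ccvg g k -> ccvg (fun x => f x * g x) (l * k).
Proof.
move=> [fr fi] [gr gi]; split.
  by rewrite ReM; under eq_fun do rewrite ReM; apply: cvgB; exact: cvgM.
by rewrite ImM; under eq_fun do rewrite ImM; apply: cvgD; exact: cvgM.
Qed.

Lemma ccvgX f l n : ccvg f l -> ccvg (fun x => f x ^+ n) (l ^+ n).
Proof.
move=> fl; elim: n => [|n IH]; first exact: ccvg_cst.
by rewrite exprS; under eq_fun do rewrite exprS; exact: ccvgM.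
Qed.

Lemma ccvg_real (f : T -> R) (l : R) : f x @[x --> F] --> l -> ccvg (fun x => (f x)%:C) l%:C.
Proof. by move=> fl; split=> //; exact: cvg_cst. Qed.

Lemma cvg_cabs f l : ccvg f l -> cabs (f x) @[x --> F] --> cabs l.
Proof.
move/ccvg_abs => H; apply/cvgrPdist_lt => e e0; near=> x; apply: (@le_lt_trans _ _ `|cabs (f x - l)|); last first.
  by near: x; exact: (cvgr0_norm_lt _ H _ e0).
rewrite (ger0_norm (cabs_ge0 _)) distrC ler_norml cabs_sub_le andbT lerNl opprB cabsB.
exact: cabs_sub_le.
Unshelve. all: by end_near. Qed.

Lemma ccvgV f l : l != 0 -> ccvg f l -> ccvg (fun x => (f x)^-1) l^-1.
Proof.
move=> l0 fl; have [fr fi] := fl; have H := cvg_cabs fl.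
have L0 : cabs l ^+ 2 != 0 by rewrite expf_neq0 // cabs_eq0.
have H2 : (cabs (f x) ^+ 2)^-1 @[x --> F] --> (cabs l ^+ 2)^-1.
  by apply: cvgV => //; rewrite expr2; under eq_fun do rewrite expr2; exact: cvgM.
split.
  by rewrite ReV; under eq_fun do rewrite ReV; exact: cvgM.
by rewrite ImV; under eq_fun do rewrite ImV; apply: cvgM => //; exact: cvgN.
Qed.

Lemma ccvg_squeeze f (g : T -> R) l : (\forall x \near F, cabs (f x - l) <= g x) ->
  g x @[x --> F] --> (0 : R) -> ccvg f l.
Proof.
move=> fg g0; apply/ccvg_abs; apply: (@squeeze_cvgr _ _ _ _ (fun=> 0) g) => //; last exact: cvg_cst.
by near=> x; rewrite cabs_ge0 /=; near: x.
Unshelve. all: by end_near. Qed.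

Lemma near_ccvg f g l : (\forall x \near F, f x = g x) -> ccvg f l -> ccvg g l.
Proof.
move=> fg [fr fi]; split; [apply: cvg_trans fr|apply: cvg_trans fi];
  by apply: near_eq_cvg; near=> x; rewrite (near fg x).
Unshelve. all: by end_near. Qed.

End ComplexLimits.

Lemma ccvg_unique (R : realType) T (F : set_system T) {FF : ProperFilter F}
    (f : T -> R[i]) (l k : R[i]) : ccvg F f l -> ccvg F f k -> l = k.
Proof.
move=> [a b] [c d]; apply: complex_ext.
  exact: (cvg_unique _ a c).
exact: (cvg_unique _ b d).
Qed.

Section MVTbounds.
Variable R : realType.

Lemma mvt_bound (f df : R -> R) (x M : R) : (forall t : R, is_derive t (1 : R) f (df t)) ->
  (forall t, `|t| <= `|x| -> `|df t| <= M) -> `|f x - f 0| <= M * `|x|.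
Proof.
move=> fd dM.
have cf (a b : R) : {within `[a, b], continuous f}.
  by apply: derivable_within_continuous => t _; have [] := fd t.
have [x0|x0] := lerP 0 x.
  have [c] := MVT_segment x0 (fun t _ => fd t) (cf 0 x).
  rewrite in_itv /= => /andP[c0 cx] ->; rewrite subr0 normrM ler_wpM2r //.
  by apply: dM; rewrite !ger0_norm.
have [c] := MVT_segment (ltW x0) (fun t _ => fd t) (cf x 0).
rewrite in_itv /= => /andP[c0 cx] E; rewrite distrC E sub0r normrM normrN ler_wpM2r //.
by apply: dM; rewrite !ler0_norm ?lerN2 // ltW.
Qed.

Lemma sin_le_id (x : R) : `|sin x| <= `|x|.
Proof.
have := @mvt_bound sin cos x 1 (@is_derive_sin _) (fun t _ => cos_max t).
by rewrite sin0 subr0 mul1r.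
Qed.

Lemma cos_ge_quad (x : R) : 1 - cos x <= x ^+ 2 / 2.
Proof.
have E : cos x = 1 - 2 * sin (x / 2) ^+ 2.
  have -> : cos x = cos ((x / 2) *+ 2) by congr (cos _); rewrite -mulr_natr; field.
  by rewrite cos_mulr2n cos2sin2; ring.
have : sin (x / 2) ^+ 2 <= (x / 2) ^+ 2.
  by rewrite -[leLHS]real_normK ?num_real // -[leRHS]real_normK ?num_real // ler_pXn2r ?nnegrE // sin_le_id.
rewrite E exprMn (_ : 2^-1 ^+ 2 = 1 / 4 :> R); last by field.
by move: (sin _ ^+ 2) (x ^+ 2) => s t; lra.
Qed.

Lemma sin_sub_quad (x : R) : `|x| <= 1 -> `|sin x - x| <= x ^+ 2.
Proof.
move=> x1.
have D (t : R) : is_derive t (1 : R) (fun t : R => sin t - t) (cos t - 1) by exact: is_derive_eq.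
have := @mvt_bound _ _ x (`|x|) D.
rewrite /= sin0 !subr0 -expr2 real_normK ?num_real // => H; apply: H => t tx.
have := cos_ge_quad t; have := cos_le1 t => c1 c2; rewrite ler0_norm; last lra.
have t2 : t ^+ 2 <= `|x| * `|x|.
  by rewrite -[t ^+ 2]real_normK ?num_real // expr2 ler_pM.
have x2 : `|x| * `|x| <= `|x| by rewrite ler_piMr.
have := normr_ge0 x; lra.
Qed.

Lemma expR_le4 (t : R) : t <= 1 -> expR t <= 4.
Proof.
move=> t1; apply: (@le_trans _ _ (expR 1)); first by rewrite ler_expR.
have H : expR (- (1/2)) >= 1/2 :> R by apply: le_trans (expR_ge1Dx _); lra.
have E : expR 1 * (expR (- (1/2)) * expR (- (1/2))) = 1 :> R.
  by rewrite -!expRD (_ : 1 + _ = 0) ?expR0 //; field.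
have hh : 1/4 <= expR (- (1/2)) * expR (- (1/2)) :> R.
  by rewrite (_ : 1/4 = (1/2) * (1/2)); [apply: ler_pM => //; lra|field].
have : expR 1 * (1/4) <= expR 1 * (expR (- (1/2)) * expR (- (1/2))) :> R.
  by rewrite ler_wpM2l ?expR_ge0.
rewrite E; lra.
Qed.

Lemma expR_sub1_le (x : R) : `|x| <= 1 -> `|expR x - 1| <= 4 * `|x|.
Proof.
move=> x1; rewrite -{1}(@expR0 R); apply: (@mvt_bound expR expR) => t tx.
by rewrite ger0_norm ?expR_ge0 // expR_le4 // (le_trans (ler_norm _)) // (le_trans tx).
Qed.

Lemma expR_sub_quad (x : R) : `|x| <= 1 -> `|expR x - 1 - x| <= 4 * x ^+ 2.
Proof.
move=> x1.
have D (t : R) : is_derive t (1 : R) (fun t : R => expR t - 1 - t) (expR t - 1).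
  by apply: is_derive_eq; rewrite subr0.
have := @mvt_bound _ _ x (4 * `|x|) D.
rewrite /= expR0 !subrr subr0 -mulrA -expr2 real_normK ?num_real // => H; apply: H => t tx.
by rewrite (le_trans (expR_sub1_le _)) ?(le_trans tx) // ler_wpM2l.
Qed.

End MVTbounds.

Section ComplexExp.
Variable R : realType.
Implicit Types z w : R[i].

Lemma cexp0 : cexp 0 = 1 :> R[i].
Proof. by rewrite /cexp /= expR0 cos0 sin0 mul1r. Qed.

Lemma cexpD z w : cexp (z + w) = cexp z * cexp w.
Proof.
by rewrite /cexp ReD ImD expRD cosD sinD; apply: complex_ext;
  rewrite !(ReM, ImM) /=; ring.
Qed.

Lemma cabs_cexp z : cabs (cexp z) = expR (Re z).
Proof.
rewrite /cexp cabsM cabs_real ger0_norm ?expR_ge0 //.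
by rewrite /cabs /= cos2Dsin2 sqrtr1 mulr1.
Qed.

Lemma cexp_neq0 z : cexp z != 0.
Proof. by rewrite -cabs_eq0 cabs_cexp gt_eqF // expR_gt0. Qed.

Lemma cexpN z : cexp (- z) = (cexp z)^-1.
Proof. by apply: (mulfI (cexp_neq0 z)); rewrite -cexpD subrr cexp0 mulfV // cexp_neq0. Qed.

Lemma cexpMn z n : cexp (z *+ n) = cexp z ^+ n.
Proof. by elim: n => [|n IH]; rewrite ?mulr0n ?cexp0 // mulrS exprS cexpD IH. Qed.

Lemma cexp_conj z : cexp z^* = (cexp z)^*.
Proof.
case: z => a b; rewrite /cexp /= cosN sinN; apply: complex_ext;
  by rewrite !(ReM, ImM) /=; ring.
Qed.

Lemma ReImcexp z : Re (cexp z) = expR (Re z) * cos (Im z) /\ Im (cexp z) = expR (Re z) * sin (Im z).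
Proof. by rewrite /cexp ReCM ImCM. Qed.

Lemma ccvg_cexp T (F : set_system T) {FF : Filter F} (f : T -> R[i]) l :
  ccvg F f l -> ccvg F (fun x => cexp (f x)) (cexp l).
Proof.
move=> [fr fi]; have [E1 E2] := ReImcexp l.
have c1 : expR (Re (f x)) @[x --> F] --> expR (Re l).
  by apply: (cvg_comp _ _ fr); exact: continuous_expR.
have c2 : cos (Im (f x)) @[x --> F] --> cos (Im l).
  by apply: (cvg_comp _ _ fi); exact: continuous_cos.
have c3 : sin (Im (f x)) @[x --> F] --> sin (Im l).
  by apply: (cvg_comp _ _ fi); exact: continuous_sin.
split.
  by rewrite E1; under eq_fun do rewrite (ReImcexp _).1; exact: cvgM.
by rewrite E2; under eq_fun do rewrite (ReImcexp _).2; exact: cvgM.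
Qed.

Lemma cexp_sub_quad z : cabs z <= 1 -> cabs (cexp z - 1 - z) <= 8 * cabs z ^+ 2.
Proof.
move=> z1; rewrite (le_trans (cabs_le_ReIm _)) // cabs_sqr.
have := Re_le_cabs z; have := Im_le_cabs z.
have [E1 E2] := ReImcexp z.
rewrite !ReB !ImB E1 E2 [Re 1]/= [Im 1]/=; move: (Re z) (Im z) => x y {E1 E2} yz xz.
have x1 : `|x| <= 1 := le_trans xz z1.
have y1 : `|y| <= 1 := le_trans yz z1.
have H1 := expR_sub_quad x1; have H2 := expR_sub1_le x1; have H3 := sin_sub_quad y1.
have H4 := cos_ge_quad y; have H5 := cos_le1 y.
have e4 : expR x <= 4 by apply: expR_le4; apply: le_trans x1; exact: ler_norm.
have e0 := expR_ge0 x.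
have HR : `|expR x * cos y - 1 - x| <= 4 * x ^+ 2 + 2 * y ^+ 2.
  have -> : expR x * cos y - 1 - x = (expR x - 1 - x) - expR x * (1 - cos y) by ring.
  rewrite (le_trans (ler_normB _ _)) // lerD // normrM !ger0_norm //; nra.
have HI : `|expR x * sin y - 0 - y| <= 4 * y ^+ 2 + 2 * x ^+ 2 + 2 * y ^+ 2.
  have -> : expR x * sin y - 0 - y = expR x * (sin y - y) + (expR x - 1) * y by ring.
  rewrite (le_trans (ler_normD _ _)) // -addrA lerD //.
    by rewrite normrM ger0_norm // ler_pM.
  rewrite normrM (@le_trans _ _ (4 * `|x| * `|y|)) ?ler_wpM2r //.
  rewrite -[x ^+ 2]real_normK ?num_real // -[y ^+ 2]real_normK ?num_real //.
  have := sqr_ge0 (`|x| - `|y|); nra.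
have y2 := sqr_ge0 y; have x2 := sqr_ge0 x; lra.
Qed.

Lemma cabs_subX (a b : R[i]) (M : R) n : cabs a <= M -> cabs b <= M ->
  cabs (a ^+ n - b ^+ n) <= n%:R * M ^+ n.-1 * cabs (a - b).
Proof.
move=> aM bM; rewrite subrXX cabsM mulrC ler_wpM2r ?cabs_ge0 //.
rewrite (le_trans (cabs_sum _ _)) //.
have M0 : 0 <= M := le_trans (cabs_ge0 _) aM.
have -> : n%:R * M ^+ n.-1 = \sum_(i < n) M ^+ n.-1 by rewrite sumr_const card_ord mulr_natl.
apply: ler_sum => i _; rewrite cabsM !cabsX.
have -> : M ^+ n.-1 = M ^+ (n.-1 - i) * M ^+ i.
  by rewrite -exprD; congr (_ ^+ _); case: n i => [[]|n i] //; have := ltn_ord i; lia.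
by apply: ler_pM; rewrite ?exprn_ge0 ?cabs_ge0 //; apply: lerXn2r; rewrite ?nnegrE ?cabs_ge0.
Qed.

(* The complex version of [(1 + e_n) ^ k_n --> exp z]. *)
Lemma ccvg_powexp (k : nat -> nat) (e : nat -> R[i]) (z : R[i]) :
  ccvg \oo e 0 -> ccvg \oo (fun n => (k n)%:R * e n) z ->
  ccvg \oo (fun n => (1 + e n) ^+ k n) (cexp z).
Proof.
move=> e0 kez.
have H1 : ccvg \oo (fun n => cexp ((k n)%:R * e n)) (cexp z) by exact: ccvg_cexp.
have E n : cexp ((k n)%:R * e n) = cexp (e n) ^+ k n by rewrite mulr_natl cexpMn.
have H2 : ccvg \oo (fun n => (1 + e n) ^+ k n - cexp (e n) ^+ k n) 0; last first.
  have H3 : ccvg \oo (fun n => (1 + e n) ^+ k n - cexp (e n) ^+ k n +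
    cexp ((k n)%:R * e n)) (0 + cexp z) by exact: ccvgD.
  rewrite add0r in H3; apply: near_ccvg H3.
  by near=> n; rewrite E subrK.
have A : cabs ((k n)%:R * e n) @[n --> \oo] --> cabs z by exact: cvg_cabs.
have e0' : cabs (e n) @[n --> \oo] --> (0 : R) by rewrite -(@cabs0 R); exact: cvg_cabs.
(* Both bases have modulus at most [exp |e|], so the [k]-th powers differ by at most
   [k exp (k |e|) |1 + e - exp e|], where [k |e|] stays bounded. *)
apply: (@ccvg_squeeze _ _ _ _ _ (fun n => expR (cabs z + 1) * (8 * (cabs ((k n)%:R * e n)) * cabs (e n)))).
  near=> n; rewrite subr0.
  have en1 : cabs (e n) <= 1.
    by near: n; apply: (cvgr_le _ e0'); rewrite ltr01.
  have kn : (k n)%:R * cabs (e n) <= cabs z + 1.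
    have : cabs ((k n)%:R * e n) <= cabs z + 1 by near: n; apply: (cvgr_le _ A); rewrite ltrDl ltr01.
    by rewrite cabsM cabs_nat.
  have b1 : cabs (1 + e n) <= expR (cabs (e n)).
    by rewrite (le_trans (cabsD _ _)) // cabs1 expR_ge1Dx.
  have b2 : cabs (cexp (e n)) <= expR (cabs (e n)).
    by rewrite cabs_cexp ler_expR (le_trans (ler_norm _)) // Re_le_cabs.
  rewrite (le_trans (cabs_subX _ b1 b2)) //.
  have q : cabs (1 + e n - cexp (e n)) <= 8 * cabs (e n) ^+ 2.
    by rewrite cabsB (_ : _ - _ = cexp (e n) - 1 - e n) ?cexp_sub_quad //; ring.
  have M1 : 1 <= expR (cabs (e n)) by rewrite -expR0 ler_expR cabs_ge0.
  have MK : expR (cabs (e n)) ^+ (k n).-1 <= expR (cabs z + 1).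
    apply: (@le_trans _ _ (expR (cabs (e n)) ^+ k n)); last first.
      by rewrite -expRM_natl ler_expR.
    by rewrite ler_weXn2l // leq_pred.
  rewrite cabsM cabs_nat (@le_trans _ _ ((k n)%:R * expR (cabs z + 1) * (8 * cabs (e n) ^+ 2))) //.
    by rewrite ler_pM ?cabs_ge0 ?mulr_ge0 ?exprn_ge0 ?expR_ge0 // ler_wpM2l.
  by rewrite le_eqVlt; apply/orP; left; apply/eqP; ring.
rewrite -[X in _ --> X](_ : expR (cabs z + 1) * (8 * cabs z * 0) = 0); last by rewrite !mulr0.
apply: cvgM; first exact: cvg_cst.
by apply: cvgM => //; apply: cvgM => //; exact: cvg_cst.
Unshelve. all: by end_near. Qed.

End ComplexExp.

(** * Evaluation of power series *)

Lemma Rdominated_convergence (d : measure_display) (T : measurableType d) (R : realType)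
    (mu : {measure set T -> \bar R}) (D : set T) (f_ : nat -> T -> R) (f g : T -> R) :
  measurable D -> (forall n, measurable_fun D (f_ n)) ->
  (forall x, D x -> f_ n x @[n --> \oo] --> f x) ->
  mu.-integrable D (EFin \o g) ->
  (forall n x, D x -> `|f_ n x| <= g x) ->
  mu.-integrable D (EFin \o f) /\
  Rintegral mu D (f_ n) @[n --> \oo] --> Rintegral mu D f.
Proof.
move=> mD mf cf ig fg.
have mf' : measurable_fun D f by exact: (measurable_fun_cvg mf cf).
have mF n : measurable_fun D (EFin \o f_ n) by exact/measurable_EFinP.
have mF' : measurable_fun D (EFin \o f) by exact/measurable_EFinP.
have cF : {ae mu, forall x, D x -> (EFin \o f_ n) x @[n --> \oo] --> (EFin \o f) x}.
  by apply: aeW => x Dx; apply: cvg_EFin; [near=> n|exact: cf].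
have bF : {ae mu, forall x n, D x -> (`|(EFin \o f_ n) x| <= (EFin \o g) x)%E}.
  by apply: aeW => x n Dx; rewrite /= lee_fin fg.
have [i1 _ i3] := dominated_convergence mD mF mF' cF ig bF.
split=> //; apply: fine_cvg.
by rewrite fineK //; exact: (integrable_fin_num mD i1).
Unshelve. all: by end_near. Qed.

Section Evaluation.
Variable R : realType.
Implicit Types (f g : fps R) (w : R[i]).

Definition fpartial f w N : R[i] := \sum_(n < N) (f n)%:C * w ^+ n.

Definition feval f w : R[i] :=
  limn (series (fun k => Re ((f k)%:C * w ^+ k)))
  +i* limn (series (fun k => Im ((f k)%:C * w ^+ k))).

(** A bound on the weighted sum of the absolute values of the coefficients, a norm for which
    convergent series form a Banach algebra. Partial sums make it provable by induction on the
    degree. *)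
Definition fnorm_le (r : R) f (M : R) := forall N, \sum_(n < N) `|f n| * r ^+ n <= M.

Variable r : R.
Hypothesis r0 : 0 <= r.

Let ser (u : nat -> R) N : series u N = \sum_(n < N) u n.
Proof. by rewrite /series /= big_mkord. Qed.

Lemma fnorm_le_ge0 f M : fnorm_le r f M -> 0 <= M.
Proof. by move=> /(_ 0%N); rewrite big_ord0. Qed.

Lemma fnorm_le_cvg f M : fnorm_le r f M -> cvgn (series (fun n => `|f n| * r ^+ n)).
Proof.
move=> fM; apply: nondecreasing_is_cvgn.
  by apply: nondecreasing_series => n _ _; rewrite mulr_ge0 ?exprn_ge0.
by exists M => _ [n _ <-]; rewrite ser.
Qed.

Lemma feval_cvg f M w : fnorm_le r f M -> cabs w <= r ->
  ccvg \oo (fpartial f w) (feval f w).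
Proof.
move=> fM wr; have C := fnorm_le_cvg fM.
have B n : cabs ((f n)%:C * w ^+ n) <= `|f n| * r ^+ n.
  rewrite cabsM cabs_real cabsX ler_wpM2l //.
  by apply: lerXn2r; rewrite ?nnegrE ?cabs_ge0.
have G (h : R[i] -> R) : (forall z, `|h z| <= cabs z) -> cvgn (series (fun k => h ((f k)%:C * w ^+ k))).
  move=> hh; apply: normed_cvg; apply: series_le_cvg C => n //=; last exact: le_trans (B n).
  by rewrite mulr_ge0 // exprn_ge0.
have E1 : (fun N => Re (fpartial f w N)) = series (fun k => Re ((f k)%:C * w ^+ k)).
  by apply/funext => N; rewrite ser /fpartial Re_sum.
have E2 : (fun N => Im (fpartial f w N)) = series (fun k => Im ((f k)%:C * w ^+ k)).
  by apply/funext => N; rewrite ser /fpartial Im_sum.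
by split; [rewrite E1; exact: G (@Re_le_cabs R)|rewrite E2; exact: G (@Im_le_cabs R)].
Qed.

Lemma feval_bound f M w : fnorm_le r f M -> cabs w <= r -> cabs (feval f w) <= M.
Proof.
move=> fM wr; have H : cabs (fpartial f w N) @[N --> \oo] --> cabs (feval f w).
  exact: cvg_cabs (feval_cvg fM wr).
rewrite -(cvg_lim _ H) //; apply: limr_le; first by apply/cvg_ex; eexists; exact: H.
near=> N; rewrite (le_trans (cabs_sum _ _)) // (le_trans _ (fM N)) //.
apply: ler_sum => n _; rewrite cabsM cabs_real cabsX ler_wpM2l //.
by apply: lerXn2r; rewrite ?nnegrE ?cabs_ge0.
Unshelve. all: by end_near. Qed.

Lemma feval_eq f M w l : fnorm_le r f M -> cabs w <= r ->
  ccvg \oo (fpartial f w) l -> feval f w = l.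
Proof. by move=> fM wr; apply: ccvg_unique; exact: feval_cvg fM wr. Qed.

Lemma fnorm_leD f g M M' : fnorm_le r f M -> fnorm_le r g M' -> fnorm_le r (f + g) (M + M').
Proof.
move=> fM gM N; rewrite (le_trans _ (lerD (fM N) (gM N))) // -big_split /=.
apply: ler_sum => n _; rewrite -mulrDl ler_wpM2r ?exprn_ge0 //; exact: ler_normD.
Qed.

Lemma fnorm_leN f M : fnorm_le r f M -> fnorm_le r (- f) M.
Proof. by move=> fM N; under eq_bigr do rewrite fcoefN normrN. Qed.

Lemma fnorm_leC c : fnorm_le r (fC c) `|c|.
Proof.
case=> [|N]; first by rewrite big_ord0.
rewrite big_ord_recl big1 ?addr0 ?expr0 ?mulr1 // => i _.
by rewrite (_ : fC c _ = 0) // normr0 mul0r.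
Qed.

Lemma fnorm_le1 : fnorm_le r 1 1.
Proof. by have := @fnorm_leC 1; rewrite normr1. Qed.

Lemma fnorm_leX : fnorm_le r fX r.
Proof.
case=> [|[|N]]; first by rewrite big_ord0.
  by rewrite big_ord1 (_ : fX _ = 0) // normr0 mul0r.
rewrite big_ord_recl (_ : fX _ = 0) // normr0 mul0r add0r big_ord_recl big1 ?addr0.
  by rewrite (_ : fX _ = 1) // normr1 mul1r expr1.
by move=> i _; rewrite (_ : fX _ = 0) // normr0 mul0r.
Qed.

Lemma fnorm_leW f M M' : M <= M' -> fnorm_le r f M -> fnorm_le r f M'.
Proof. by move=> MM fM N; exact: le_trans (fM N) MM. Qed.

Lemma cauchy_partial (K : comNzRingType) (u v : nat -> K) N :
  \sum_(n < N) \sum_(k < n.+1) u k * v (n - k)%N = \sum_(k < N) u k * \sum_(j < N - k) v j.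
Proof.
elim: N => [|N IH]; first by rewrite !big_ord0.
rewrite big_ord_recr IH /= [RHS]big_ord_recr /= subSn // subnn big_ord1.
rewrite [in LHS]big_ord_recr /= subnn addrA; congr (_ + _).
rewrite -big_split /=; apply: eq_bigr => i _.
by rewrite subSn 1?ltnW // big_ord_recr mulrDr.
Qed.

Let au f n : R := `|f n| * r ^+ n.
Let au_ge0 f n : 0 <= au f n.
Proof. by rewrite mulr_ge0 // exprn_ge0. Qed.

Let pau_ge0 f N : 0 <= \sum_(n < N) au f n.
Proof. by apply: sumr_ge0 => i _; exact: au_ge0. Qed.

Let pau_mono f m n : (m <= n)%N -> \sum_(i < m) au f i <= \sum_(i < n) au f i.
Proof.
move=> mn; rewrite -!ser; apply: nondecreasing_series => // k _ _; exact: au_ge0.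
Qed.

Lemma fnorm_leM f g M M' : fnorm_le r f M -> fnorm_le r g M' -> fnorm_le r (f * g) (M * M').
Proof.
move=> fM gM N.
apply: (@le_trans _ _ (\sum_(n < N) \sum_(k < n.+1) au f k * au g (n - k)%N)).
  apply: ler_sum => n _; rewrite fcoefM.
  rewrite (@le_trans _ _ ((\sum_(i < n.+1) `|f i * g (n - i)%N|) * r ^+ n)) //.
    by rewrite ler_wpM2r ?exprn_ge0 // ler_norm_sum.
  rewrite mulr_suml; apply: ler_sum => i _; rewrite normrM /au mulrACA -exprD subnKC //.
  by rewrite -ltnS.
rewrite cauchy_partial (@le_trans _ _ (\sum_(k < N) au f k * M')) //.
  by apply: ler_sum => k _; rewrite ler_wpM2l ?au_ge0 //; exact: gM.
by rewrite -mulr_suml ler_wpM2r ?(fnorm_le_ge0 gM) //; exact: fM.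
Qed.

Lemma fevalD f g M M' w : fnorm_le r f M -> fnorm_le r g M' -> cabs w <= r ->
  feval (f + g) w = feval f w + feval g w.
Proof.
move=> fM gM wr; apply: (feval_eq (fnorm_leD fM gM) wr).
apply: near_ccvg (ccvgD (feval_cvg fM wr) (feval_cvg gM wr)); near=> N.
by rewrite /fpartial -big_split /=; apply: eq_bigr => i _; rewrite -mulrDl -rmorphD.
Unshelve. all: by end_near. Qed.

Lemma fevalN f M w : fnorm_le r f M -> cabs w <= r -> feval (- f) w = - feval f w.
Proof.
move=> fM wr; apply: (feval_eq (fnorm_leN fM) wr).
apply: near_ccvg (ccvgN (feval_cvg fM wr)); near=> N.
by rewrite /fpartial -sumrN; apply: eq_bigr => i _; rewrite -mulNr -rmorphN.
Unshelve. all: by end_near. Qed.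

Lemma fevalC c w : cabs w <= r -> feval (fC c) w = c%:C.
Proof.
move=> wr; apply: (feval_eq (fnorm_leC c) wr).
apply: near_ccvg (@ccvg_cst R nat \oo _ c%:C); near=> N.
have -> : N = N.-1.+1 by rewrite prednK //; near: N; exact: nbhs_infty_gt.
rewrite /fpartial big_ord_recl big1 ?addr0 ?expr0 ?mulr1 // => i _.
by rewrite (_ : fC c _ = 0) // mul0r.
Unshelve. all: by end_near. Qed.

Lemma feval1 w : cabs w <= r -> feval 1 w = 1. Proof. exact: fevalC. Qed.

Lemma fevalX w : cabs w <= r -> feval fX w = w.
Proof.
move=> wr; apply: (feval_eq fnorm_leX wr).
apply: near_ccvg (@ccvg_cst R nat \oo _ w); near=> N.
have -> : N = N.-2.+2.
  have : (1 < N)%N by near: N; exact: nbhs_infty_gt.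
  by move: (N) => [|[]].
rewrite /fpartial big_ord_recl (_ : fX _ = 0) // mul0r add0r big_ord_recl big1 ?addr0.
  by rewrite (_ : fX _ = 1) // mul1r expr1.
by move=> i _; rewrite (_ : fX _ = 0) // mul0r.
Unshelve. all: by end_near. Qed.

(** The terms missing from the Cauchy product lie in the square of side [N] outside the triangle
    [k + l < N]. The triangle contains the square of side [N/2], so they are dominated by a
    difference that tends to 0. *)
Lemma fevalM f g M M' w : fnorm_le r f M -> fnorm_le r g M' -> cabs w <= r ->
  feval (f * g) w = feval f w * feval g w.
Proof.
move=> fM gM wr; apply: (feval_eq (fnorm_leM fM gM) wr).
pose S (h : fps R) (N : nat) : R := \sum_(n < N) au h n.
have S_cvg h K : fnorm_le r h K -> exists l : R, S h N @[N --> \oo] --> l.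
  move=> hK; have := fnorm_le_cvg hK => /cvg_ex[l hl]; exists l.
  by rewrite (_ : S h = series (fun n => `|h n| * r ^+ n)) //; apply/funext => N; rewrite ser.
have [a Sa] := S_cvg _ _ fM; have [b Sb] := S_cvg _ _ gM.
have half_cvg : (N./2 @[N --> \oo] --> \oo).
  by apply/cvgnyPge => A; exists A.*2 => // N /= AN; rewrite -(doubleK A) half_leq.
have dist m n : (m <= n)%N -> cabs (fpartial g w n - fpartial g w m) <= S g n - S g m.
  elim: n => [|n IH]; first by rewrite leqn0 => /eqP ->; rewrite !subrr cabs0.
  rewrite leq_eqVlt => /predU1P[->|]; first by rewrite !subrr cabs0.
  rewrite ltnS => /IH {}IH; rewrite /fpartial /S !big_ord_recr /=.
  rewrite addrAC (le_trans (cabsD _ _)) // addrAC lerD // cabsM cabs_real cabsX ler_wpM2l //.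
  by apply: lerXn2r; rewrite ?nnegrE ?cabs_ge0.
have E N : fpartial (f * g) w N = \sum_(k < N) (f k)%:C * w ^+ k * fpartial g w (N - k).
  rewrite /fpartial -(cauchy_partial (fun k => (f k)%:C * w ^+ k) (fun j => (g j)%:C * w ^+ j)).
  apply: eq_bigr => n _.
  rewrite fcoefM rmorph_sum mulr_suml; apply: eq_bigr => k _ /=.
  by rewrite rmorphM mulrACA -exprD subnKC // -ltnS.
have H0 : ccvg \oo (fun N => fpartial f w N * fpartial g w N - fpartial (f * g) w N) 0.
  apply: (@ccvg_squeeze _ _ _ _ _ (fun N => S f N * S g N - S f N./2 * S g N./2)); last first.
    rewrite -[X in _ --> X](_ : a * b - a * b = 0); last by rewrite subrr.
    by apply: cvgB; apply: cvgM => //; apply: (cvg_comp _ _ half_cvg).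
  near=> N; rewrite subr0 E {1}/fpartial mulr_suml -sumrB.
  rewrite (le_trans (cabs_sum _ _)) //.
  apply: (@le_trans _ _ (\sum_(k < N) au f k * (S g N - S g (N - k)%N))).
    apply: ler_sum => k _; rewrite -mulrBr cabsM.
    apply: ler_pM; rewrite ?cabs_ge0 //; last by apply: dist; exact: leq_subr.
    rewrite cabsM cabs_real cabsX ler_wpM2l //.
    by apply: lerXn2r; rewrite ?nnegrE ?cabs_ge0.
  under eq_bigr do rewrite mulrBr.
  rewrite sumrB -mulr_suml lerD2l lerN2 /S.
  apply: (@le_trans _ _ (\sum_(k < N./2) au f k * S g (N - k)%N)).
    rewrite mulr_suml; apply: ler_sum => k _; rewrite ler_wpM2l ?au_ge0 //.
    by apply: pau_mono; have := ltn_ord k; lia.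
  rewrite -!(big_mkord xpredT (fun k => au f k * S g (N - k)%N)).
  have hN : (N./2 <= N)%N by lia.
  rewrite [leRHS](@big_cat_nat _ _ _ N./2) //= lerDl.
  by rewrite sumr_ge0 // => k _; rewrite mulr_ge0 ?au_ge0 ?pau_ge0.
have H1 : ccvg \oo (fun N => fpartial f w N * fpartial g w N -
    (fpartial f w N * fpartial g w N - fpartial (f * g) w N)) (feval f w * feval g w - 0).
  by apply: ccvgB => //; apply: ccvgM; [exact: feval_cvg fM wr|exact: feval_cvg gM wr].
rewrite subr0 in H1; apply: near_ccvg H1; near=> N; ring.
Unshelve. all: by end_near. Qed.

Lemma fnorm_leXn f M n : fnorm_le r f M -> fnorm_le r (f ^+ n) (M ^+ n).
Proof.
move=> fM; elim: n => [|n IH]; first exact: fnorm_le1.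
by rewrite !exprS; exact: fnorm_leM.
Qed.

Lemma fevalXn f M n w : fnorm_le r f M -> cabs w <= r -> feval (f ^+ n) w = feval f w ^+ n.
Proof.
move=> fM wr; elim: n => [|n IH]; first exact: feval1.
by rewrite !exprS (fevalM fM (fnorm_leXn n fM)) // IH.
Qed.

(* Ring operations preserve [fps_at f w v]: absolute convergence at radius [r], with value [v] at [w]. *)
Definition fps_at w f (v : R[i]) := (exists M, fnorm_le r f M) /\ feval f w = v.

Section FpsAt.
Variable w : R[i].
Hypothesis wr : cabs w <= r.

Lemma fps_atD f g v v' : fps_at w f v -> fps_at w g v' -> fps_at w (f + g) (v + v').
Proof.
move=> [[M fM] <-] [[M' gM] <-]; split; first by exists (M + M'); exact: fnorm_leD.
exact: fevalD fM gM wr.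
Qed.
Lemma fps_atN f v : fps_at w f v -> fps_at w (- f) (- v).
Proof. by move=> [[M fM] <-]; split; [exists M; exact: fnorm_leN|exact: fevalN fM wr]. Qed.
Lemma fps_atB f g v v' : fps_at w f v -> fps_at w g v' -> fps_at w (f - g) (v - v').
Proof. by move=> H1 H2; apply: fps_atD => //; exact: fps_atN. Qed.
Lemma fps_atM f g v v' : fps_at w f v -> fps_at w g v' -> fps_at w (f * g) (v * v').
Proof.
move=> [[M fM] <-] [[M' gM] <-]; split; first by exists (M * M'); exact: fnorm_leM.
exact: fevalM fM gM wr.
Qed.
Lemma fps_atXn f v n : fps_at w f v -> fps_at w (f ^+ n) (v ^+ n).
Proof. by move=> [[M fM] <-]; split; [exists (M ^+ n); exact: fnorm_leXn|exact: fevalXn fM wr]. Qed.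
Lemma fps_atC c : fps_at w (fC c) c%:C.
Proof. by split; [exists `|c|; exact: fnorm_leC|exact: fevalC]. Qed.
Lemma fps_at1 : fps_at w 1 1. Proof. exact: fps_atC. Qed.
Lemma fps_atX : fps_at w fX w.
Proof. by split; [exists r; exact: fnorm_leX|exact: fevalX]. Qed.
Lemma fps_atE f v v' : fps_at w f v -> fps_at w f v' -> v = v'.
Proof. by move=> [_ <-] [_ <-]. Qed.
End FpsAt.

End Evaluation.

(** * Cauchy's formula for real coefficients *)

Section CircleIntegral.
Variable R : realType.
Local Notation leb := (@lebesgue_measure R).

Lemma is_derive_continuous (F f : R -> R) :
  (forall x : R, is_derive x (1 : R) F (f x)) -> continuous F.
Proof.
move=> Fd x; apply: differentiable_continuous; apply/derivable1_diffP.
by have [] := Fd x.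
Qed.

Lemma FTC_Rintegral (F f : R -> R) (a b : R) : a < b ->
  (forall x : R, is_derive x (1 : R) F (f x)) -> continuous f ->
  Rintegral leb `[a, b] f = F b - F a.
Proof.
move=> ab Fd cf; have cF := is_derive_continuous Fd.
rewrite /Rintegral (@continuous_FTC2 _ f F) //.
- exact: continuous_subspaceT.
- split; [by move=> x _; have [] := Fd x| |]; [apply: cvg_at_right_filter|apply: cvg_at_left_filter];
    exact: cF.
- by move=> x _; rewrite derive1E; have [] := Fd x.
Qed.

Lemma sin_natpi n : sin (n%:R * pi) = 0 :> R.
Proof.
elim: n => [|n IH]; first by rewrite mul0r sin0.
by rewrite -natr1 mulrDl mul1r sinDpi IH oppr0.
Qed.

Definition wcirc (al c y : R) : R[i] := cexp (- (al +i* (c * y))).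

Lemma cabs_wcirc al c y : cabs (wcirc al c y) = expR (- al).
Proof. by rewrite cabs_cexp. Qed.

Lemma wcircX al c y k : wcirc al c y ^+ k = cexp (- (k%:R * (al +i* (c * y)))).
Proof. by rewrite /wcirc -cexpMn mulNrn mulr_natl. Qed.

Lemma wcirc_neq0 al c y : wcirc al c y != 0. Proof. exact: cexp_neq0. Qed.

(** The coefficients are real, so half of the circle and the real part suffice. Partial sums are
    integrated termwise and passed to the limit by domination; measurability, obtained on the way,
    is recorded for later limits. *)
Lemma coef_circle (f : fps R) (M al c : R) n : 0 < c -> fnorm_le (expR (- al)) f M ->
  measurable_fun setT (fun y => Re (feval f (wcirc al c y) / wcirc al c y ^+ n)) /\
  f n = c / pi * Rintegral leb `[0, pi / c] (fun y => Re (feval f (wcirc al c y) / wcirc al c y ^+ n)).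
Proof.
move=> c0 fM.
have pc0 : 0 < pi / c by rewrite divr_gt0 // pi_gt0.
pose CEXP (y : R) : R[i] := (wcirc al c y ^+ n)^-1.
have CE y : CEXP y = cexp (n%:R * (al +i* (c * y))) by rewrite /CEXP wcircX cexpN invrK.
pose d (k : nat) : R := c * (n%:R - k%:R).
pose e (k : nat) : R := al * (n%:R - k%:R).
have d0 k : k != n -> d k != 0.
  by move=> kn; apply: mulf_neq0; rewrite ?(gt_eqF c0) // subr_eq0 eqr_nat eq_sym.
pose P N (y : R) : R := \sum_(k < N) f k * expR (e k) * cos (d k * y).
have PE N y : Re (fpartial f (wcirc al c y) N * CEXP y) = P N y.
  rewrite /fpartial mulr_suml Re_sum; apply: eq_bigr => k _.
  rewrite CE wcircX -mulrA -cexpD ReCM -mulrA; congr (_ * _).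
  have -> : - (k%:R * (al +i* (c * y))) + n%:R * (al +i* (c * y)) = (e k) +i* (d k * y).
    rewrite -!(rmorph_nat (real_complex R)); apply: complex_ext.
      by rewrite ReD ReN !ReCM /e /=; ring.
    by rewrite ImD ImN !ImCM /d /=; ring.
  by rewrite (ReImcexp _).1.
(* A primitive of [cos (d k * y)]; the frequency vanishes at [k = n], the only term with a nonzero
   integral over the half circle. *)
pose g (k : nat) (y : R) : R := if k == n then y else (d k)^-1 * sin (d k * y).
have gD k (y : R) : is_derive y (1 : R) (g k) (cos (d k * y)).
  rewrite /g; case: eqVneq => [->|kn].
    by rewrite /d subrr mulr0 mul0r cos0; exact: is_derive_id.
  have D1 : is_derive y (1 : R) (fun y : R => d k * y) (d k).
    by apply: is_derive_eq; exact: mulr1.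
  have D2 : is_derive y (1 : R) (fun y : R => sin (d k * y)) (cos (d k * y) * d k).
    exact: (@is_derive1_comp R sin (fun y => d k * y)).
  apply: (is_derive_eq (is_deriveZ (d k)^-1 D2)).
  by rewrite -[_ *: _]/(_ * _) mulrCA mulVf ?mulr1 // d0.
pose G N (y : R) : R := \sum_(k < N) f k * expR (e k) * g k y.
have GD N (y : R) : is_derive y (1 : R) (G N) (P N y).
  have -> : G N = \sum_(k < N) (fun y => f k * expR (e k) * g k y).
    by apply/funext => t; rewrite fct_sumE.
  apply: is_derive_sum => k; exact: is_deriveZ.
have cP N : continuous (P N).
  apply: (@is_derive_continuous (P N) (fun y => \sum_(k < N) f k * expR (e k) * (- sin (d k * y) * d k))) => y.
  have -> : P N = \sum_(k < N) (fun y => f k * expR (e k) * cos (d k * y)).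
    by apply/funext => t; rewrite fct_sumE.
  apply: is_derive_sum => k; apply: is_deriveZ.
  have D1 : is_derive y (1 : R) (fun y : R => d k * y) (d k) by apply: is_derive_eq; exact: mulr1.
  exact: (@is_derive1_comp R cos (fun y => d k * y)).
have gpi k : g k (pi / c) = if k == n then pi / c else 0.
  rewrite /g; case: eqVneq => // kn.
  have -> : d k * (pi / c) = n%:R * pi - k%:R * pi by rewrite /d; field; rewrite gt_eqF.
  by rewrite sinB !sin_natpi mul0r mulr0 subrr mulr0.
have g00 k : g k 0 = 0 by rewrite /g; case: eqP; rewrite ?mulr0 ?sin0 ?mulr0.
have IP N : (n < N)%N -> Rintegral leb `[0, pi / c] (P N) = f n * (pi / c).
  move=> nN; rewrite (FTC_Rintegral pc0 (GD N) (cP N)) /G.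
  rewrite [X in _ - X]big1 ?subr0; last by move=> k _; rewrite g00 mulr0.
  rewrite (bigD1 (Ordinal nN)) //= gpi eqxx /e subrr mulr0 expR0 mulr1 big1 ?addr0 // => k kn.
  by rewrite gpi ifN ?mulr0.
have cvgP y : P N y @[N --> \oo] --> Re (feval f (wcirc al c y) * CEXP y).
  have H : ccvg \oo (fun N => fpartial f (wcirc al c y) N * CEXP y)
     (feval f (wcirc al c y) * CEXP y).
    apply: ccvgM; last exact: ccvg_cst.
    by apply: feval_cvg fM _; rewrite ?expR_ge0 // cabs_wcirc.
  by have [H1 _] := H; move: H1; under eq_fun do rewrite PE.
split.
  apply: (@measurable_fun_cvg _ _ R setT P) => [N|y _]; last exact: cvgP.
  exact: continuous_measurable_fun.
have bP N y : `|P N y| <= M * expR (n%:R * al).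
  rewrite -PE (le_trans (Re_le_cabs _)) // cabsM CE cabs_cexp -(rmorph_nat (real_complex R)) ReCM ler_wpM2r ?expR_ge0 //.
  rewrite (le_trans (cabs_sum _ _)) // (le_trans _ (fM N)) //.
  by apply: ler_sum => k _; rewrite cabsM cabs_real cabsX cabs_wcirc.
have [|N|y _|||_ H] := @Rdominated_convergence _ _ R leb `[0, pi / c] P
  (fun y => Re (feval f (wcirc al c y) / wcirc al c y ^+ n)) (fun=> M * expR (n%:R * al)).
- exact: measurable_itv.
- by apply: measurable_funTS; exact: continuous_measurable_fun.
- exact: cvgP.
- apply: continuous_compact_integrable; first exact: segment_compact.
  by apply: continuous_subspaceT => y; exact: cvg_cst.
- by [].
have H2 : Rintegral leb `[0, pi / c] (P N) @[N --> \oo] --> f n * (pi / c).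
  apply: cvg_near_cst.
  near=> N; apply: IP; near: N; exact: nbhs_infty_gt.
rewrite (cvg_unique _ H H2) //.
have p0 : pi != 0 :> R by rewrite gt_eqF // pi_gt0.
by rewrite mulrCA -[c / pi]invf_div mulVf ?mulr1 // gt_eqF.
Unshelve. all: by end_near. Qed.

End CircleIntegral.

(** * Majorants for the explicit series *)

Section NormBounds.
Variables (R : realType) (r : R).
Hypothesis r0 : 0 <= r.
Implicit Types f g h : fps R.

Definition apart f N : R := \sum_(n < N) `|f n| * r ^+ n.

Lemma apart_ge0 f N : 0 <= apart f N.
Proof. by apply: sumr_ge0 => n _; rewrite mulr_ge0 ?exprn_ge0. Qed.

Lemma apart_mono f m n : (m <= n)%N -> apart f m <= apart f n.
Proof.
move=> mn; rewrite /apart -!(big_mkord xpredT (fun k => `|f k| * r ^+ k)).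
rewrite [leRHS](@big_cat_nat _ _ _ m) //= lerDl sumr_ge0 // => k _.
by rewrite mulr_ge0 ?exprn_ge0.
Qed.

Lemma apart_agree f g N : fagree N f g -> apart f N = apart g N.
Proof. by move=> fg; apply: eq_bigr => n _; rewrite fg. Qed.

Lemma apartD f g N : apart (f + g) N <= apart f N + apart g N.
Proof.
rewrite -big_split; apply: ler_sum => n _ /=.
by rewrite -mulrDl ler_wpM2r ?exprn_ge0 //; exact: ler_normD.
Qed.

Lemma apartM f g N : apart (f * g) N <= apart f N * apart g N.
Proof.
pose u h k : R := `|h k| * r ^+ k.
apply: (@le_trans _ _ (\sum_(n < N) \sum_(k < n.+1) u f k * u g (n - k)%N)).
  apply: ler_sum => n _; rewrite fcoefM.
  rewrite (@le_trans _ _ ((\sum_(i < n.+1) `|f i * g (n - i)%N|) * r ^+ n)) //.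
    by rewrite ler_wpM2r ?exprn_ge0 // ler_norm_sum.
  rewrite mulr_suml; apply: ler_sum => i _; rewrite normrM /u mulrACA -exprD subnKC //.
  by rewrite -ltnS.
rewrite cauchy_partial mulr_suml; apply: ler_sum => k _.
rewrite ler_wpM2l ?mulr_ge0 ?exprn_ge0 //; exact: (apart_mono g (leq_subr k N)).
Qed.

Lemma apart_fnorm f M : fnorm_le r f M <-> forall N, apart f N <= M.
Proof. by []. Qed.

Definition ftail_cut f N : fps R := FPS (fun n => if (n < N)%N then f n else 0).

Lemma fagree_cut f N : fagree N f (ftail_cut f N).
Proof. by move=> i iN /=; rewrite iN. Qed.

Lemma apart_cutS f N : apart (ftail_cut f N) N.+1 = apart f N.
Proof.
rewrite /apart big_ord_recr /= ltnn normr0 mul0r addr0.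
by apply: eq_bigr => i _; rewrite /= ltn_ord.
Qed.

(** As [g] has no constant term, the first [N.+1] coefficients of the product only involve the first
    [N] of [f]. *)
Lemma apartMS f g N : g 0%N = 0 -> apart (f * g) N.+1 <= apart f N * apart g N.+1.
Proof.
move=> g0; rewrite (apart_agree (fagreeMS g0 (@fagree_cut f N))) -(apart_cutS f).
exact: apartM.
Qed.

Lemma apartMSS f g N : f 0%N = 0 -> g 0%N = 0 -> apart (f * g) N.+1 <= apart f N * apart g N.
Proof.
move=> f0 g0; rewrite (apart_agree (fagreeMS g0 (@fagree_cut f N))).
have cf0 : ftail_cut f N 0%N = 0 by rewrite /= f0; case: ifP.
rewrite mulrC (apart_agree (fagreeMS cf0 (@fagree_cut g N))) mulrC.
by rewrite (le_trans (apartM _ _ _)) // !apart_cutS.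
Qed.

Lemma apartXM f N : apart (fX * f) N.+1 = r * apart f N.
Proof.
rewrite /apart big_ord_recl fcoefXM normr0 mul0r add0r mulr_sumr; apply: eq_bigr => i _.
by rewrite fcoefXM /= exprS mulrCA.
Qed.

(** The majorant method: a contraction bounds the first [N.+1] terms through the first [N], so any
    [M] that the majorant [Phi] does not exceed on [[0, M]] bounds the whole norm. *)
Lemma apart_le_rec f (Phi : R -> R) M :
  (forall N, apart f N.+1 <= Phi (apart f N)) ->
  (forall s, 0 <= s <= M -> Phi s <= M) -> 0 <= M -> fnorm_le r f M.
Proof.
move=> H PhiM M0; apply/apart_fnorm; elim=> [|N IH]; first by rewrite /apart big_ord0.
by rewrite (le_trans (H N)) // PhiM // apart_ge0 IH.
Qed.

(** The inverse solves [g = 1 + g h], and [(1 - phi)^-1] is the fixed point of the majorant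
    [s |-> 1 + s phi]. *)
Lemma fnorm_le_finv h phi : h 0%N = 0 -> fnorm_le r h phi -> phi < 1 ->
  fnorm_le r (finv (1 - h)) (1 - phi)^-1.
Proof.
move=> h0 hphi phi1; set g := finv _.
have gE : g = 1 + g * h.
  have : (1 - h) * g = 1 by apply: fmulV; rewrite fcoefD fcoefN fcoef1 h0 subr0.
  by move=> H; rewrite -{1}H; ring.
have p0 := fnorm_le_ge0 hphi.
have p1 : 0 < 1 - phi by lra.
apply: (@apart_le_rec _ (fun s => 1 + s * phi)) => [N|s /andP[s0 sM]|].
- rewrite {1}gE (le_trans (apartD _ _ _)) // lerD //; first exact: fnorm_le1.
  by rewrite (le_trans (apartMS _ _ h0)) // ler_wpM2l ?apart_ge0 //; exact: hphi.
- have -> : (1 - phi)^-1 = 1 + (1 - phi)^-1 * phi by field; lra.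
  by rewrite lerD2l ler_wpM2r.
- by rewrite invr_ge0 ltW.
Qed.

Variable z : R.
Hypothesis z0 : 0 <= z.
Hypothesis z1 : z < 1.
Hypothesis zE : 2 * z = r * (1 + z ^+ 2).

(** The real number [z] solves at [r] the equation of [Z], hence is a fixed point of its
    majorant. *)
Lemma fnorm_Zs : fnorm_le r (Zs R) z.
Proof.
apply: (@apart_le_rec _ (fun s => r / 2 * (1 + s ^+ 2))) => [N|s /andP[s0 sz]|//]; last first.
  have -> : z = r / 2 * (1 + z ^+ 2) by rewrite mulrAC -zE; field.
  rewrite ler_wpM2l ?divr_ge0 // lerD2l; apply: lerXn2r; rewrite ?nnegrE //.
rewrite -{1}(halfX_Zs R) -mulrA mulrCA apartXM -mulrA ler_wpM2l //.
rewrite (le_trans (apartM _ _ _)) //; apply: ler_pM; rewrite ?apart_ge0 //.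
  have := @fnorm_leC _ r (1 / 2) N; rewrite mul1r ger0_norm ?invr_ge0 //.
rewrite (le_trans (apartD _ _ _)) // lerD //; first exact: fnorm_le1.
rewrite expr2 (le_trans (apartM _ _ _)) // -expr2 //.
Qed.

Lemma fnorm_ZsX k : fnorm_le r (Zs R ^+ k) (z ^+ k).
Proof. by apply: fnorm_leXn => //; exact: fnorm_Zs. Qed.

(** The expression of [Ks] with [z] in place of [Z]. *)
Definition kappa : R := (1 + z ^+ 2) * ((1 - z ^+ 2)^-1 * ((1 - z)^-1 * (1 - z ^+ 3)^-1)).

Lemma fnorm_Ks : fnorm_le r (Ks R) kappa.
Proof.
have H k : (0 < k)%N -> fnorm_le r (finv (1 - Zs R ^+ k)) (1 - z ^+ k)^-1.
  move=> k0; apply: fnorm_le_finv; [exact: ZsX0|exact: fnorm_ZsX|].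
  by rewrite exprn_ilt1 // -lt0n.
apply: fnorm_leM => //; last by apply: (fnorm_leM r0 (H 2 isT)); exact: (fnorm_leM r0 (H 1%N isT) (H 3 isT)).
by apply: fnorm_leD => //; [exact: fnorm_le1|exact: fnorm_ZsX].
Qed.

Variables (x A0 : R).
Hypothesis A00 : 0 <= A0.
Hypothesis xK : A0 ^+ 2 + `|x| * kappa * (1 + A0) ^+ 3 <= A0.

Lemma kappa_ge0 : 0 <= kappa.
Proof. exact: fnorm_le_ge0 fnorm_Ks. Qed.

(** With the powers of [Z] bounded by 1, the equation of [m] has majorant
    [s^2 + |x| kappa (1 + s)^3]; the hypothesis [xK] says that [A0] is a supersolution of it. *)
Lemma fnorm_mus : fnorm_le r (mus x) A0.
Proof.
apply: (@apart_le_rec _ (fun s => s ^+ 2 + `|x| * kappa * (1 + s) ^+ 3)) => [N|s /andP[s0 sA]|//]; last first.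
  apply: le_trans xK; apply: lerD; first by apply: lerXn2r; rewrite ?nnegrE.
  apply: ler_wpM2l; first by rewrite mulr_ge0 ?kappa_ge0.
  by apply: lerXn2r; rewrite ?nnegrE ?addr_ge0 // lerD2l.
set m := mus x.
have zk k : (0 < k)%N -> apart (Zs R ^+ k) N.+1 <= 1.
  by move=> k0; rewrite (le_trans (@fnorm_ZsX k N.+1)) // exprn_ile1 // ltW.
have mz k : (0 < k)%N -> apart (1 + m * Zs R ^+ k) N.+1 <= 1 + apart m N.
  move=> k0; rewrite (le_trans (apartD _ _ _)) // lerD //; first exact: fnorm_le1.
  rewrite (le_trans (apartMS _ _ (ZsX0 _ k0))) // ler_piMr ?apart_ge0 // zk //.
rewrite {1}/m -mus_fix -/m /muPhi (le_trans (apartD _ _ _)) // lerD //.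
  rewrite (le_trans (apartMS _ _ (ZsX0 _ (isT : (0 < 2)%N)))) //.
  rewrite (@le_trans _ _ (apart (m ^+ 2) N)) ?ler_piMr ?apart_ge0 ?zk //.
  by rewrite expr2 (le_trans (apartM _ _ _)).
rewrite (le_trans (apartM _ _ _)) //; apply: ler_pM; rewrite ?apart_ge0 //.
  rewrite (le_trans (apartM _ _ _)) //; apply: ler_pM; rewrite ?apart_ge0 //.
    exact: fnorm_leC.
  exact: fnorm_Ks.
have -> : (1 + apart m N) ^+ 3 = (1 + apart m N) * (1 + apart m N) * (1 + apart m N) by ring.
rewrite (le_trans (apartM _ _ _)) //; apply: ler_pM; rewrite ?apart_ge0 ?mz //.
rewrite (le_trans (apartM _ _ _)) //; apply: ler_pM; rewrite ?apart_ge0 ?mz //.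
exact: (mz 1%N).
Qed.

Hypothesis A01 : 2 * A0 + A0 ^+ 2 < 1.

(** The denominator is [1 - h] with [h] of norm at most [2 A0 + A0^2]; the assumption that this is
    below 1 makes it invertible. *)
Lemma fnorm_Ds i : exists M, fnorm_le r (Ds x i) M.
Proof.
have zk k : fnorm_le r (mus x * Zs R ^+ k) A0.
  have : fnorm_le r (mus x * Zs R ^+ k) (A0 * z ^+ k) by exact: (fnorm_leM r0 fnorm_mus (fnorm_ZsX k)).
  by apply: fnorm_leW; rewrite ler_piMr // exprn_ile1 // ltW.
pose h := - (mus x * Zs R ^+ i.+1 + mus x * Zs R ^+ i.+3 +
   mus x * Zs R ^+ i.+1 * (mus x * Zs R ^+ i.+3)).
have hE : as_ x i.+1 * as_ x i.+3 = 1 - h by rewrite /as_ /h; ring.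
have h0 : h 0%N = 0.
  by rewrite /h fcoefN !fcoefD !fcoefM0 !ZsX0 // !mulr0 !addr0 oppr0.
have hn : fnorm_le r h (A0 + A0 + A0 * A0).
  by apply: fnorm_leN; apply: fnorm_leD => //; [apply: fnorm_leD|apply: fnorm_leM].
have hi : fnorm_le r (finv (1 - h)) (1 - (A0 + A0 + A0 * A0))^-1.
  by apply: fnorm_le_finv => //; move: A01; rewrite expr2; lra.
rewrite /Ds hE; eexists.
apply: (fnorm_leM r0 _ hi); apply: (fnorm_leM r0 (fnorm_leM r0 (zk i) _) _).
  by apply: (fnorm_leD r0 (@fnorm_le1 R r) (fnorm_leN fnorm_Zs)).
by apply: (fnorm_leD r0 (@fnorm_le1 R r) (fnorm_leN (fnorm_ZsX 3))).
Qed.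

End NormBounds.

(** * The algebraic series A on its disc *)

Section Afun.
Variable R : realType.

(* The function [A] inverts [A0 |-> 24 * beta A0], whose maximum over [0 <= A0 <= 1]
   is [4 / sqrt 3], attained at [2 - sqrt 3], the smallest root of [1 - 4 A0 + A0^2]. *)
Definition beta (A0 : R) : R := A0 * (1 - A0) / (1 + A0) ^+ 3.

Lemma beta_fix A0 : 0 <= A0 -> A0 ^+ 2 + beta A0 * (1 + A0) ^+ 3 = A0.
Proof. by move=> A00; rewrite /beta mulfVK; [ring|rewrite expf_neq0 // gt_eqF //; lra]. Qed.

Lemma exists_A0 (a : R) : `|a| < 4 / Num.sqrt 3 ->
  exists A0 : R, [/\ 0 < A0, 0 < 1 - 4 * A0 + A0 ^+ 2, 2 * A0 + A0 ^+ 2 < 1 & `|a| / 24 < beta A0].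
Proof.
move=> a3; set s := Num.sqrt 3 in a3.
have s2 : s ^+ 2 = 3 by rewrite sqr_sqrtr.
have s0 : 0 <= s by exact: sqrtr_ge0.
have s17 : 17 / 10 < s by nra.
have s18 : s < 18 / 10 by nra.
have bs : beta (2 - s) = 4 / s / 24.
  have -> : 4 / s = 4 * s / 3 by rewrite -s2; field; rewrite gt_eqF //; lra.
  have den : (1 + (2 - s)) ^+ 3 != 0 by rewrite expf_neq0 // gt_eqF //; lra.
  rewrite /beta; apply: (mulIf den); rewrite mulfVK //.
  have -> : (1 + (2 - s)) ^+ 3 = 54 - 30 * s.
    transitivity (27 - 27 * s + 9 * s ^+ 2 - s * s ^+ 2); [ring|rewrite s2; ring].
  transitivity (- 2 + 3 * s - s ^+ 2); [ring|rewrite s2].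
  transitivity (3 * s - 5 / 3 * s ^+ 2); [by rewrite s2; field|by field].
have cb : {for 2 - s, continuous beta}.
  apply: cvgM; first by apply: cvgM; [exact: cvg_id|apply: cvgB; [exact: cvg_cst|exact: cvg_id]].
  apply: cvgV; first by rewrite expf_neq0 // gt_eqF //; lra.
  rewrite -/(_ ^+ 3).
  apply: (@cvg_comp _ _ _ (fun t : R => 1 + t) (fun t => t ^+ 3)); last exact: exprn_continuous.
  by apply: cvgD; [exact: cvg_cst|exact: cvg_id].
have lt : `|a| / 24 < beta (2 - s) by rewrite bs ltr_pM2r.
have N1 : \forall t \near (2 - s), `|a| / 24 < beta t by exact: (cvgr_gt _ cb).
(* Just to the left of the maximiser [2 - sqrt 3], continuity keeps [beta] above [|a| / 24], while
   [1 - 4 t + t^2] becomes positive. *)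
have N2 : \forall t \near (2 - s)^'-, `|a| / 24 < beta t /\ (0 < t /\ t < 2 - s).
  near=> t; split; [|split].
  - by near: t; apply: cvg_within; exact: N1.
  - by near: t; apply: nbhs_left_gt; lra.
  - by near: t; exact: nbhs_left_lt.
have [t [t1 [t2 t3]]] : exists t, `|a| / 24 < beta t /\ (0 < t /\ t < 2 - s) by apply: (@filter_ex _ _ (at_left_proper_filter _)); exact: N2.
exists t; split=> //; last nra.
have : 0 < (2 - s - t) * (2 + s - t) by rewrite mulr_gt0 //; lra.
have -> : (2 - s - t) * (2 + s - t) = 4 - s ^+ 2 - 4 * t + t ^+ 2 by ring.
rewrite s2; lra.
Unshelve. all: by end_near. Qed.

Variable c : nat -> R.
Hypothesis Ac : is_A_coef c.
Let C : fps R := FPS c.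

Lemma A_fps : 24 * (C - C * C) = fX * ((1 + C) * ((1 + C) * (1 + C))).
Proof.
case: Ac => c0 cE.
have oE : FPS (onep c) = 1 + C by apply: fpsP => n; rewrite fcoefD fcoef1.
have -> : (24 : fps R) = fC 24 by rewrite rmorph_nat.
apply: fpsP => n; rewrite fcoefCM fcoefXM.
have -> : (C - C * C) n = c n - Defs.conv c c n by [].
rewrite cE; case: n => // n; rewrite -oE; apply: eq_bigr => i _; congr (_ * _).
Qed.

Variables (A0 rho : R).
Hypothesis A00 : 0 <= A0.
Hypothesis rho0 : 0 <= rho.
Hypothesis rhoA : A0 ^+ 2 + rho / 24 * (1 + A0) ^+ 3 <= A0.

(** The equation solved for its linear term, [A = A^2 + x (1 + A)^3 / 24], has the same majorant as
    [m], with [rho / 24] in place of [|x| kappa]. *)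
Lemma fnorm_A : fnorm_le rho C A0.
Proof.
have C0 : C 0%N = 0 by case: Ac.
have i24 : fC (1 / 24) * 24 = 1 :> fps R.
  have -> : (24 : fps R) = fC 24 by rewrite rmorph_nat.
  by rewrite -rmorphM (_ : 1 / 24 * 24 = 1) ?rmorph1 //; field.
have CE : C = C * C + fX * (fC (1 / 24) * ((1 + C) * ((1 + C) * (1 + C)))).
  transitivity (C * C + (fC (1 / 24) * 24) * (C - C * C)); first by rewrite i24; ring.
  by rewrite -mulrA A_fps; congr (_ + _); rewrite mulrCA.
apply: (@apart_le_rec _ _ rho0 _ (fun s => s ^+ 2 + rho / 24 * (1 + s) ^+ 3)) => [N|s /andP[s0 sA]|//]; last first.
  apply: le_trans rhoA; apply: lerD; first by apply: lerXn2r; rewrite ?nnegrE.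
  apply: ler_wpM2l; first by rewrite divr_ge0.
  by apply: lerXn2r; rewrite ?nnegrE ?addr_ge0 // lerD2l.
rewrite {1}CE (le_trans (apartD _ _ _ _)) // lerD //.
  by rewrite expr2; exact: apartMSS.
rewrite apartXM -mulrA ler_wpM2l //.
have aC : apart rho (1 + C) N <= 1 + apart rho C N.
  by rewrite (le_trans (apartD _ _ _ _)) // lerD //; exact: fnorm_le1.
rewrite (le_trans (apartM _ _ _ _)) //; apply: ler_pM; rewrite ?apart_ge0 //.
  by have := @fnorm_leC _ rho (1 / 24) N; rewrite mul1r ger0_norm ?invr_ge0.
have -> : (1 + apart rho C N) ^+ 3 = (1 + apart rho C N) * ((1 + apart rho C N) * (1 + apart rho C N)) by ring.
rewrite (le_trans (apartM _ _ _ _)) //; apply: ler_pM; rewrite ?apart_ge0 //.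
by rewrite (le_trans (apartM _ _ _ _)) //; apply: ler_pM; rewrite ?apart_ge0.
Qed.

Lemma AvalE z : Aval c z = feval C z. Proof. by []. Qed.

Lemma Aval_bound z : cabs z <= rho -> cabs (Aval c z) <= A0.
Proof. by move=> zr; rewrite AvalE; exact: feval_bound fnorm_A zr. Qed.

Lemma Aval_eq z : cabs z <= rho ->
  Aval c z = Aval c z ^+ 2 + z / 24 * (1 + Aval c z) ^+ 3.
Proof.
move=> zr; rewrite AvalE; set a := feval C z.
have aC : fps_at rho z C a by split=> //; exists A0; exact: fnorm_A.
have a1 : fps_at rho z (1 + C) (1 + a) by apply: fps_atD => //; exact: fps_at1.
have R1 : fps_at rho z (fX * ((1 + C) * ((1 + C) * (1 + C)))) (z * ((1 + a) * ((1 + a) * (1 + a)))).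
  by do !apply: fps_atM => //; exact: fps_atX.
have L1 : fps_at rho z (24 * (C - C * C)) (24 * (a - a * a)).
  apply: fps_atM => //; last by apply: fps_atB => //; exact: fps_atM.
  rewrite -[X in fps_at _ _ X](rmorph_nat (@fC R)) -[X in fps_at _ _ _ X](rmorph_nat (real_complex R)).
  exact: fps_atC.
rewrite A_fps in L1; have E := fps_atE L1 R1.
have n24 : (24 : R[i]) != 0 by rewrite pnatr_eq0.
move: E n24; move: (24 : R[i]) => k E n24.
have E2 : a - a * a = z * ((1 + a) * ((1 + a) * (1 + a))) / k by rewrite -E mulrAC mulfV // mul1r.
transitivity (a * a + (a - a * a)); first by ring.
by rewrite E2; ring.
Qed.

Lemma Aval_conj z : cabs z <= rho -> Aval c z^* = (Aval c z)^*.
Proof.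
move=> zr; rewrite !AvalE.
have zr' : cabs z^* <= rho by rewrite cabs_conj.
apply: (feval_eq rho0 fnorm_A zr').
have [H1 H2] := feval_cvg rho0 fnorm_A zr.
have E N : fpartial C z^* N = (fpartial C z N)^*.
  by rewrite /fpartial rmorph_sum; apply: eq_bigr => i _; rewrite rmorphM rmorphXn /= oppr0.
have RJ (u : R[i]) : Re u^* = Re u by case: u.
have IJ (u : R[i]) : Im u^* = - Im u by case: u.
split.
  have -> : (fun N => Re (fpartial C z^* N)) = (fun N => Re (fpartial C z N)).
    by apply/funext => N; rewrite E RJ.
  by rewrite RJ.
have -> : (fun N => Im (fpartial C z^* N)) = (fun N => - Im (fpartial C z N)).
  by apply/funext => N; rewrite E IJ.
rewrite IJ; exact: cvgN.
Qed.

End Afun.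

(* Quantitative inverse function theorem for [24 A (1 - A) / (1 + A)^3] on the disc [|A| <= A0]. *)
Section Inverse.
Variables (R : realType) (A0 : R).
Hypothesis A00 : 0 <= A0.
Hypothesis A0k : 0 < 1 - 4 * A0 + A0 ^+ 2.
Implicit Types (a b y : R[i]).

(** The divided difference between [a] and [b] of [A |-> A - A^2 - y (1 + A)^3]. *)
Definition Qdiff a b y : R[i] :=
  1 - (a + b) - y * ((1 + a) ^+ 2 + (1 + a) * (1 + b) + (1 + b) ^+ 2).

(** The value of [Qdiff] at [a = b = A0] and [y = beta A0], the worst case on the disc. It is
    positive to the left of [2 - sqrt 3]. *)
Definition kapQ : R := (1 - 4 * A0 + A0 ^+ 2) / (1 + A0).

Lemma kapQ_gt0 : 0 < kapQ.
Proof. by apply: divr_gt0 => //; have := A00; lra. Qed.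

Lemma Qdiff_bound a b y : cabs a <= A0 -> cabs b <= A0 -> cabs y <= beta A0 ->
  kapQ <= cabs (Qdiff a b y).
Proof.
move=> aA bA yb.
have a1 : cabs (1 + a) <= 1 + A0 by rewrite (le_trans (cabsD _ _)) // cabs1 lerD2l.
have b1 : cabs (1 + b) <= 1 + A0 by rewrite (le_trans (cabsD _ _)) // cabs1 lerD2l.
have H1 : cabs (a + b) <= 2 * A0 by rewrite (le_trans (cabsD _ _)) //; lra.
have H2 : cabs ((1 + a) ^+ 2 + (1 + a) * (1 + b) + (1 + b) ^+ 2) <= 3 * (1 + A0) ^+ 2.
  have -> : 3 * (1 + A0) ^+ 2 = (1 + A0) * (1 + A0) + (1 + A0) * (1 + A0) + (1 + A0) * (1 + A0) by ring.
  rewrite (le_trans (cabsD _ _)) // lerD //.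
    rewrite (le_trans (cabsD _ _)) // lerD // ?expr2 cabsM ler_pM ?cabs_ge0 //.
  by rewrite expr2 cabsM ler_pM ?cabs_ge0.
have H3 : cabs (y * ((1 + a) ^+ 2 + (1 + a) * (1 + b) + (1 + b) ^+ 2)) <= beta A0 * (3 * (1 + A0) ^+ 2).
  by rewrite cabsM ler_pM ?cabs_ge0.
have -> : kapQ = 1 - (2 * A0 + beta A0 * (3 * (1 + A0) ^+ 2)).
  by rewrite /kapQ /beta; field; rewrite gt_eqF //; have := A00; lra.
have H4 := cabs_sub_le 1 ((a + b) + y * ((1 + a) ^+ 2 + (1 + a) * (1 + b) + (1 + b) ^+ 2)).
rewrite cabs1 opprD addrA in H4; apply: le_trans H4.
by rewrite lerD2l lerN2 (le_trans (cabsD _ _)) // lerD.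
Qed.

Lemma Qdiff_eq a b y (da db : R[i]) :
  a = a ^+ 2 + y * (1 + a) ^+ 3 + da -> b = b ^+ 2 + y * (1 + b) ^+ 3 + db ->
  (a - b) * Qdiff a b y = da - db.
Proof.
move=> ea eb; transitivity ((a - (a ^+ 2 + y * (1 + a) ^+ 3)) - (b - (b ^+ 2 + y * (1 + b) ^+ 3))).
  by rewrite /Qdiff; ring.
by rewrite {1}ea {1}eb; ring.
Qed.

End Inverse.

(** * Scaling limits *)

Section LocalLimits.
Variables (R : realType) (nu : nat -> R) (w zeta : nat -> R[i]) (q v : R[i]).
Hypothesis nu_inv : (nu n)^-1 @[n --> \oo] --> (0 : R).
Hypothesis nu_gt0 : \forall n \near \oo, 0 < nu n.
Hypothesis hw : ccvg \oo (fun n => (nu n ^+ 2)%:C * (1 - w n)) (2 * q).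
Hypothesis hz : \forall n \near \oo, 2 * zeta n = w n * (1 + zeta n ^+ 2) /\ cabs (zeta n) <= 1.
Hypothesis vq : v ^+ 2 = q.
Hypothesis v0 : 0 < Re v.

Let cnu_inv : ccvg \oo (fun n => ((nu n)^-1)%:C) 0.
Proof. exact: ccvg_real. Qed.

Lemma lim_1w : ccvg \oo (fun n => 1 - w n) 0.
Proof.
have H : ccvg \oo (fun n => ((nu n)^-1)%:C ^+ 2 * ((nu n ^+ 2)%:C * (1 - w n))) (0 ^+ 2 * (2 * q)).
  by apply: ccvgM => //; exact: ccvgX.
rewrite expr2 !mul0r in H; apply: near_ccvg H; near=> n.
have n0 : 0 < nu n by near: n.
rewrite mulrA -rmorphXn -rmorphM -exprMn mulVf ?expr1n ?rmorph1 ?mul1r //.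
by rewrite gt_eqF.
Unshelve. all: by end_near. Qed.

Lemma lim_w : ccvg \oo w 1.
Proof.
have H : ccvg \oo (fun n => 1 - (1 - w n)) (1 - 0) by apply: ccvgB; [exact: ccvg_cst|exact: lim_1w].
by rewrite subr0 in H; apply: near_ccvg H; near=> n; ring.
Unshelve. all: by end_near. Qed.

(** The square-root singularity at [w = 1]: [1 - w] of order [nu^-2] makes [1 - zeta] of order
    [nu^-1]. *)
Let hz2 : \forall n \near \oo, (1 - zeta n) ^+ 2 = (1 - w n) * (1 + zeta n ^+ 2).
Proof.
near=> n; have [E _] : 2 * zeta n = w n * (1 + zeta n ^+ 2) /\ cabs (zeta n) <= 1 by near: n.
by rewrite mulrBl mul1r -E; ring.
Unshelve. all: by end_near. Qed.

Lemma lim_zeta : ccvg \oo zeta 1.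
Proof.
have L : cabs (1 - w n) @[n --> \oo] --> (0 : R) by rewrite -(@cabs0 R); exact: (cvg_cabs lim_1w).
have L2 : Num.sqrt (2 * cabs (1 - w n)) @[n --> \oo] --> (0 : R).
  rewrite -[X in _ --> X](_ : Num.sqrt (2 * 0) = 0 :> R); last by rewrite mulr0 sqrtr0.
  apply: (cvg_comp (fun n => 2 * cabs (1 - w n)) Num.sqrt); last exact: sqrt_continuous.
  by apply: cvgM => //; exact: cvg_cst.
apply: ccvg_squeeze L2; near=> n.
have [_ Z1] : 2 * zeta n = w n * (1 + zeta n ^+ 2) /\ cabs (zeta n) <= 1 by near: n.
have E : (1 - zeta n) ^+ 2 = (1 - w n) * (1 + zeta n ^+ 2) by near: n; exact: hz2.
rewrite cabsB -[leLHS]ger0_norm ?cabs_ge0 // -sqrtr_sqr ler_wsqrtr // -cabsX E cabsM mulrC.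
rewrite ler_wpM2r ?cabs_ge0 // (le_trans (cabsD _ _)) // cabs1 cabsX.
by rewrite (_ : 2 = 1 + 1) // lerD2l exprn_ile1 ?cabs_ge0.
Unshelve. all: by end_near. Qed.

(** Only the square [u^2 -> (2 v)^2] is immediate. The sign is settled by [|zeta| <= 1], which gives
    [Re u >= 0], hence [|u + 2 v| >= 2 Re v > 0]. *)
Lemma lim_nu_zeta : ccvg \oo (fun n => (nu n)%:C * (1 - zeta n)) (2 * v).
Proof.
pose u n := (nu n)%:C * (1 - zeta n).
have H : ccvg \oo (fun n => u n ^+ 2 - (2 * v) ^+ 2) 0.
  have H1 : ccvg \oo (fun n => (nu n ^+ 2)%:C * (1 - w n) * (1 + zeta n ^+ 2) - (2 * v) ^+ 2)
      (2 * q * (1 + 1 ^+ 2) - (2 * v) ^+ 2).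
    apply: ccvgB; last exact: ccvg_cst.
    apply: ccvgM => //; apply: ccvgD; first exact: ccvg_cst.
    by apply: ccvgX; exact: lim_zeta.
  have -> : (0 : R[i]) = 2 * q * (1 + 1 ^+ 2) - (2 * v) ^+ 2 by rewrite -vq; ring.
  apply: near_ccvg H1; near=> n.
  have E : (1 - zeta n) ^+ 2 = (1 - w n) * (1 + zeta n ^+ 2) by near: n; exact: hz2.
  by rewrite /u [((nu n)%:C * _) ^+ 2]exprMn E rmorphXn /=; ring.
have L : cabs (u n ^+ 2 - (2 * v) ^+ 2) @[n --> \oo] --> (0 : R) by rewrite -(@cabs0 R); exact: (cvg_cabs H).
apply: (@ccvg_squeeze _ _ _ _ _ (fun n => (2 * Re v)^-1 * cabs (u n ^+ 2 - (2 * v) ^+ 2))); last first.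
  rewrite -[X in _ --> X](mulr0 (2 * Re v)^-1); apply: cvgM => //; exact: cvg_cst.
near=> n; have [_ Z1] : 2 * zeta n = w n * (1 + zeta n ^+ 2) /\ cabs (zeta n) <= 1 by near: n.
have n0 : 0 < nu n by near: n.
rewrite -/(u n) subr_sqr cabsM mulrCA ler_peMr ?cabs_ge0 // mulrC ler_pdivlMr ?mulr_gt0 // mul1r.
rewrite (le_trans _ (Re_le_cabs _)) // (le_trans _ (ler_norm _)) // ReD /u ReCM ReB.
have -> : Re (2 * v) = 2 * Re v by rewrite -(rmorph_nat (real_complex R)) ReCM.
rewrite lerDr mulr_ge0 ?(ltW n0) // subr_ge0.
by rewrite (le_trans (ler_norm _)) // (le_trans (Re_le_cabs _)).
Unshelve. all: by end_near. Qed.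

Lemma lim_pow_zeta (j : nat -> nat) (lam : R) : (j n)%:R / nu n @[n --> \oo] --> lam ->
  ccvg \oo (fun n => zeta n ^+ j n) (cexp (- (2 * lam)%:C * v)).
Proof.
move=> jl.
have e0 : ccvg \oo (fun n => zeta n - 1) 0.
  by rewrite -(subrr (1 : R[i])); apply: ccvgB; [exact: lim_zeta|exact: ccvg_cst].
have H : ccvg \oo (fun n => (j n)%:R * (zeta n - 1)) (- (2 * lam)%:C * v).
  have H1 : ccvg \oo (fun n => - (((j n)%:R / nu n)%:C * ((nu n)%:C * (1 - zeta n)))) (- (lam%:C * (2 * v))).
    by apply: ccvgN; apply: ccvgM; [exact: ccvg_real|exact: lim_nu_zeta].
  have -> : - (2 * lam)%:C * v = - (lam%:C * (2 * v)).
    by rewrite rmorphM rmorph_nat; ring.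
  apply: near_ccvg H1; near=> n; have n0 : 0 < nu n by near: n.
  rewrite mulrA -rmorphM mulfVK ?gt_eqF // rmorph_nat; ring.
have P := ccvg_powexp e0 H.
by apply: near_ccvg P; near=> n; rewrite addrC subrK.
Unshelve. all: by end_near. Qed.

(** Since [(1 + w)^2 / (4 w) = 1 + (1 - w)^2 / (4 w)], this is the exponent in the limit of the
    [n]-th power. *)
Lemma lim_powexp_w : ccvg \oo (fun n => (nu n ^+ 4)%:C * ((1 - w n) ^+ 2 / (4 * w n))) (q ^+ 2).
Proof.
have H : ccvg \oo (fun n => ((nu n ^+ 2)%:C * (1 - w n)) ^+ 2 / (4 * w n)) ((2 * q) ^+ 2 / (4 * 1)).
  apply: ccvgM; first exact: ccvgX.
  apply: ccvgV; first by rewrite mulr1 pnatr_eq0.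
  by apply: ccvgM; [exact: ccvg_cst|exact: lim_w].
have -> : q ^+ 2 = (2 * q) ^+ 2 / (4 * 1).
  have n4 : (4 : R[i]) != 0 by rewrite pnatr_eq0.
  by rewrite mulr1 (_ : (2 * q) ^+ 2 = 4 * q ^+ 2) 1?mulrAC ?mulfV ?mul1r //; ring.
apply: near_ccvg H; near=> n.
have -> : (nu n ^+ 4)%:C = (nu n ^+ 2)%:C ^+ 2 by rewrite -rmorphXn -exprM.
by rewrite mulrA; congr (_ / _); ring.
Unshelve. all: by end_near. Qed.

Lemma v_neq0 : v != 0.
Proof. by apply/eqP => vE; move: v0; rewrite vE ltxx. Qed.

(** The denominator of [K] is equivalent to [1 * 2 * 3 (2 v / nu)^3 = 48 v^3 / nu^3] and the
    numerator to 2: hence the 24 in the equation of [A]. *)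
Lemma lim_xK (x : nat -> R) (a : R) (kv : nat -> R[i]) :
  x n * nu n ^+ 3 @[n --> \oo] --> a ->
  (\forall n \near \oo, (1 - zeta n ^+ 2) * (1 - zeta n) * (1 - zeta n ^+ 3) * kv n = 1 + zeta n ^+ 2) ->
  ccvg \oo (fun n => (x n)%:C * kv n) (a%:C / v ^+ 3 / 24).
Proof.
move=> xa kE.
pose u n := (nu n)%:C * (1 - zeta n).
have u0 : (2 * v) ^+ 3 != 0 by rewrite expf_neq0 // mulf_neq0 ?v_neq0 // pnatr_eq0.
have H6 : (1 + 1) * (1 + 1 + 1 ^+ 2) != 0 :> R[i].
  by rewrite expr1n mulf_neq0 // (_ : 1 + 1 = 2) // ?(_ : 2 + 1 = 3) ?pnatr_eq0 //; ring.
have H : ccvg \oo (fun n => (x n * nu n ^+ 3)%:C * ((1 + zeta n ^+ 2) /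
      (u n ^+ 3 * ((1 + zeta n) * (1 + zeta n + zeta n ^+ 2)))))
    (a%:C * ((1 + 1 ^+ 2) / ((2 * v) ^+ 3 * ((1 + 1) * (1 + 1 + 1 ^+ 2))))).
  apply: ccvgM; first exact: ccvg_real.
  apply: ccvgM; first by apply: ccvgD; [exact: ccvg_cst|apply: ccvgX; exact: lim_zeta].
  apply: ccvgV; first by rewrite mulf_neq0.
  apply: ccvgM; first by apply: ccvgX; exact: lim_nu_zeta.
  apply: ccvgM; first by apply: ccvgD; [exact: ccvg_cst|exact: lim_zeta].
  apply: ccvgD; last by apply: ccvgX; exact: lim_zeta.
  by apply: ccvgD; [exact: ccvg_cst|exact: lim_zeta].
have -> : a%:C / v ^+ 3 / 24 = a%:C * ((1 + 1 ^+ 2) / ((2 * v) ^+ 3 * ((1 + 1) * (1 + 1 + 1 ^+ 2)))).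
  have n24 : (24 : R[i]) != 0 by rewrite pnatr_eq0.
  have n2 : (2 : R[i]) != 0 by rewrite pnatr_eq0.
  have -> : (2 * v) ^+ 3 * ((1 + 1) * (1 + 1 + 1 ^+ 2)) = 2 * (24 * v ^+ 3) by ring.
  have -> : 1 + 1 ^+ 2 = 2 :> R[i] by ring.
  have -> : 2 / (2 * (24 * v ^+ 3)) = (24 * v ^+ 3)^-1 :> R[i] by rewrite invfM mulrA (mulfV n2) mul1r.
  by rewrite (invfM 24) [24^-1 * _]mulrC mulrA.
have Lu : cabs (u n) @[n --> \oo] --> cabs (2 * v) by exact: cvg_cabs lim_nu_zeta.
have Lz : cabs ((1 + zeta n) * (1 + zeta n + zeta n ^+ 2)) @[n --> \oo] -->
      cabs ((1 + 1) * (1 + 1 + 1 ^+ 2) : R[i]).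
    apply: cvg_cabs; apply: ccvgM; first by apply: ccvgD; [exact: ccvg_cst|exact: lim_zeta].
    apply: ccvgD; last by apply: ccvgX; exact: lim_zeta.
    by apply: ccvgD; [exact: ccvg_cst|exact: lim_zeta].
apply: near_ccvg H; near=> n.
have n0 : 0 < nu n by near: n.
have E : (1 - zeta n ^+ 2) * (1 - zeta n) * (1 - zeta n ^+ 3) * kv n = 1 + zeta n ^+ 2 by near: n.
have un : u n != 0.
  have : cabs (u n) != 0; last by rewrite cabs_eq0.
  apply: lt0r_neq0; near: n; apply: (cvgr_gt _ Lu).
  by rewrite cabs_gt0 mulf_neq0 ?v_neq0 // pnatr_eq0.
have z3 : (1 + zeta n) * (1 + zeta n + zeta n ^+ 2) != 0.
  rewrite -cabs_eq0; apply: lt0r_neq0; near: n.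
  by apply: (cvgr_gt _ Lz); rewrite cabs_gt0.
rewrite -E rmorphM rmorphXn /=.
set Z := zeta n in z3 un *; set k := kv n.
have -> : (1 - Z ^+ 2) * (1 - Z) * (1 - Z ^+ 3) * k =
   (1 - Z) ^+ 3 * ((1 + Z) * (1 + Z + Z ^+ 2)) * k by ring.
have -> : (x n)%:C * k = (x n)%:C * k * ((u n ^+ 3 * ((1 + Z) * (1 + Z + Z ^+ 2))) / (u n ^+ 3 * ((1 + Z) * (1 + Z + Z ^+ 2)))).
  by rewrite mulfV ?mulr1 // mulf_neq0 // expf_neq0.
rewrite {2}/u exprMn; move: (_^-1) => I; rewrite -/Z; ring.
Unshelve. all: by end_near. Qed.

End LocalLimits.

Section HalfLine.
Variable R : realType.
Local Notation leb := (@lebesgue_measure R).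

Lemma integrable_expRN : leb.-integrable `[0, +oo[ (EFin \o (fun y : R => expR (- y))).
Proof.
have D (y : R) : is_derive y (1 : R) (fun y : R => - expR (- y)) (expR (- y)).
  have D1 : is_derive y (1 : R) (fun y : R => expR (- y)) (expR (- y) * -1).
    exact: (@is_derive1_comp R expR (fun y : R => - y)).
  by apply: is_derive_eq; rewrite mulrN1 opprK.
have c1 : continuous (fun y : R => expR (- y)).
  move=> y; apply: (@cvg_comp _ _ _ (fun t : R => - t) expR); last exact: continuous_expR.
  by apply: cvgN; exact: cvg_id.
apply/integrableP; split.
  by apply/measurable_EFinP; apply: measurable_funTS; exact: continuous_measurable_fun.
under eq_integral do rewrite /= ger0_norm ?expR_ge0 //.
have h1 (y : R) : 0 <= y -> 0 <= expR (- y) by rewrite expR_ge0.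
have h2 : {within `[0, +oo[, continuous (fun y : R => expR (- y))} by exact: continuous_subspaceT.
have h3 : - expR (- y) @[y --> +oo] --> (0 : R).
  by rewrite -[X in _ --> X]oppr0; apply: cvgN; exact: cvgr_expR.
have h4 (x : R) : 0 < x -> derivable (fun y : R => - expR (- y)) x 1 by move=> _; have [] := D x.
have h5 : - expR (- y) @[y --> 0^'+] --> - expR (- (0 : R)).
  by apply: cvg_at_right_filter; exact: (is_derive_continuous D).
have h6 : {in `]0, +oo[, (fun y : R => - expR (- y))^`()%classic =1 (fun y : R => expR (- y))}.
  by move=> x _; rewrite derive1E; have [] := D x.
by rewrite (ge0_continuous_FTC2y h1 h2 h3 h4 h5 h6) -EFinB ltry.
Qed.

(** Extension by zero reduces the growing intervals to a fixed domain. The bounds are only required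
    from [N] on, since those on the series hold for large [n]. *)
Lemma dct_halfline (h : nat -> R -> R) (b : nat -> R) (H : R -> R) (C : R) N :
  (forall n, (N <= n)%N -> measurable_fun setT (h n)) ->
  b n @[n --> \oo] --> +oo ->
  (forall y, 0 <= y -> h n y @[n --> \oo] --> H y) ->
  (forall n y, (N <= n)%N -> 0 <= y <= b n -> `|h n y| <= C * expR (- y)) ->
  leb.-integrable `[0, +oo[ (EFin \o H) /\
  Rintegral leb `[0, b n] (h n) @[n --> \oo] --> Rintegral leb `[0, +oo[ H.
Proof.
move=> mh binf hH hb.
pose g n : R -> R := h n \_ `[0, b n].
have gE n y : g n y = if (0 <= y <= b n) then h n y else 0.
  by rewrite /g /patch mem_setE in_itv /=.
have E n : Rintegral leb `[0, b n] (h n) = Rintegral leb `[0, +oo[ (g n).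
  rewrite /Rintegral; congr fine.
  have -> : `[0, b n]%classic = `[0, +oo[%classic `&` `[0, b n]%classic.
    apply/seteqP; split=> y /=; rewrite !in_itv /= ?andbT; last by case.
    by move=> /andP[y0 yb]; split=> //; apply/andP.
  by rewrite integral_mkcondr; apply: eq_integral => y _; rewrite restrict_EFin.
have mD : measurable (`[0, +oo[%classic : set R) by exact: measurable_itv.
have mg n : measurable_fun (`[0, +oo[%classic : set R) (g (n + N)%N).
  apply: measurable_funTS; apply/(measurable_restrictT _ (measurable_itv `[0, b (n + N)%N])).
  by move=> _ Y mY; apply: measurableI; [exact: measurable_itv|rewrite -[_ @^-1` _]setTI; exact: (mh _ (leq_addl n N))].
have gH y : `[0, +oo[%classic y -> g (n + N)%N y @[n --> \oo] --> H y.
  rewrite /= in_itv /= andbT => y0; rewrite (cvg_shiftn N (fun n => g n y)).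
  apply: cvg_trans (hH y y0); apply: near_eq_cvg; near=> n.
  rewrite gE y0 /= ifT //; near: n; exact: cvgry_ge.
have ig : leb.-integrable `[0, +oo[ (EFin \o (fun y => `|C| * expR (- y))).
  have I : leb.-integrable `[0, +oo[ (fun y => (`|C|%:E * (EFin \o (fun y : R => expR (- y))) y)%E).
    by apply: integrableZl; [exact: measurable_itv|exact: integrable_expRN].
  exact: I.
have gb n y : `[0, +oo[%classic y -> `|g (n + N)%N y| <= `|C| * expR (- y).
  move=> _; rewrite gE; case: ifP => [yb|_]; last by rewrite normr0 mulr_ge0 // expR_ge0.
  rewrite (le_trans (hb _ _ _ yb)) ?leq_addl // ler_wpM2r ?expR_ge0 // ler_norm //.
have [iH cH] := @Rdominated_convergence _ (measurableTypeR R) R leb `[0, +oo[%classic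
  (fun n => g (n + N)%N) H _ mD mg gH ig gb.
split=> //; have cH' : Rintegral leb `[0, +oo[ (g n) @[n --> \oo] --> Rintegral leb `[0, +oo[ H.
  by rewrite -(cvg_shiftn N).
by apply: cvg_trans cH'; apply: near_eq_cvg; near=> n; rewrite E.
Unshelve. all: by end_near. Qed.
End HalfLine.

Section Scale.
Variable R : realType.

Definition nu (n : nat) : R := n%:R `^ (1 / 4).

Lemma nu_gt0 n : (0 < n)%N -> 0 < nu n.
Proof. by move=> n0; rewrite powR_gt0 // ltr0n. Qed.

Lemma nu_ge0 n : 0 <= nu n. Proof. exact: powR_ge0. Qed.

Lemma nu3 n : n%:R `^ (3 / 4) = nu n ^+ 3.
Proof. by rewrite -powR_mulrn ?nu_ge0 // -powRrM; congr (_ `^ _); field. Qed.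

Lemma nu4 n : nu n ^+ 4 = n%:R.
Proof. by rewrite -powR_mulrn ?nu_ge0 // -powRrM (_ : 1 / 4 * 4 = 1) ?powRr1 //; field. Qed.

Lemma nu_ge1 n : (0 < n)%N -> 1 <= nu n.
Proof.
move=> n0; rewrite leNgt; apply/negP => n1.
have : nu n ^+ 4 < 1 by rewrite exprn_ilt1 ?nu_ge0.
by rewrite nu4 ltNge ler1n n0.
Qed.

Lemma nu_gt0_near : \forall n \near \oo, 0 < nu n.
Proof. by near=> n; apply: nu_gt0; near: n; exact: nbhs_infty_gt. Unshelve. all: by end_near. Qed.

Lemma nu_cvgy : nu n @[n --> \oo] --> +oo.
Proof.
apply/cvgryPge => A; have [A0|A0] := lerP A 0.
  by near=> n; rewrite (le_trans A0) // nu_ge0.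
near=> n; rewrite leNgt; apply/negP => nA.
have : nu n ^+ 4 < A ^+ 4 by rewrite ltr_pXn2r // ?nnegrE ?nu_ge0 // ltW.
rewrite nu4 ltNge => /negP; apply; near: n; exact: nbhs_infty_ger.
Unshelve. all: by end_near. Qed.

Lemma nu_inv : (nu n)^-1 @[n --> \oo] --> (0 : R).
Proof. by apply/gtr0_cvgV0; [exact: nu_gt0_near|exact: nu_cvgy]. Qed.

(** Both minus the logarithm of the radius and the unit of angle, so that
    [w = exp (- alp (1 + i y))]. The constant 2 gives [n alp^2 / 4 = 1]. *)
Definition alp (n : nat) : R := 2 / nu n ^+ 2.

Lemma alp_gt0 n : (0 < n)%N -> 0 < alp n.
Proof. by move=> n0; rewrite divr_gt0 // exprn_gt0 // nu_gt0. Qed.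

Lemma alp_le2 n : (0 < n)%N -> alp n <= 2.
Proof.
move=> n0; rewrite ler_pdivrMr ?exprn_gt0 ?nu_gt0 // ler_peMr // exprn_ege1 // nu_ge1 //.
Qed.

Lemma alp0 : alp n @[n --> \oo] --> (0 : R).
Proof.
rewrite -[X in _ --> X](_ : 2 * (0 * 0) = 0 :> R); last by rewrite !mulr0.
apply: cvgM; first exact: cvg_cst.
under eq_fun do rewrite expr2 invfM; apply: cvgM; exact: nu_inv.
Qed.

Lemma arc_cvgy : pi / alp n @[n --> \oo] --> +oo.
Proof.
apply/cvgryPge => A; near=> n.
have n0 : (0 < n)%N by near: n; exact: nbhs_infty_gt.
have nA : `|A| <= nu n by near: n; exact: (cvgry_ge nu_cvgy).
have p2 := pi_ge2 R; have n1 := nu_ge1 n0.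
rewrite (le_trans (ler_norm _)) // (le_trans nA) // /alp invf_div mulrA.
rewrite ler_pdivlMr // (@le_trans _ _ (2 * nu n ^+ 2)) //.
  by rewrite mulrC ler_wpM2l // expr2 ler_peMr // nu_ge0.
by rewrite ler_wpM2r // exprn_ge0 // nu_ge0.
Unshelve. all: by end_near. Qed.

Lemma lim_nu_1w (q : R[i]) :
  ccvg \oo (fun n => (nu n ^+ 2)%:C * (1 - cexp (- ((alp n)%:C * q)))) (2 * q).
Proof.
have aE n : (0 < n)%N -> (nu n ^+ 2)%:C * (alp n)%:C = 2.
  by move=> n0; rewrite -rmorphM mulrC mulfVK ?rmorph_nat // gt_eqF // exprn_gt0 // nu_gt0.
apply: (@ccvg_squeeze _ _ _ _ _ (fun n => 16 * cabs q ^+ 2 * alp n)); last first.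
  by rewrite -[X in _ --> X](mulr0 (16 * cabs q ^+ 2)); apply: cvgM; [exact: cvg_cst|exact: alp0].
have La : alp n * cabs q @[n --> \oo] --> 0 * cabs q by apply: cvgM; [exact: alp0|exact: cvg_cst].
rewrite mul0r in La.
near=> n; have n0 : (0 < n)%N by near: n; exact: nbhs_infty_gt.
set e := - ((alp n)%:C * q).
have ce : cabs e = alp n * cabs q by rewrite cabsN cabsM cabs_real ger0_norm // ltW // alp_gt0.
have e1 : cabs e <= 1 by rewrite ce; near: n; apply: (cvgr_le _ La); rewrite ltr01.
have -> : (nu n ^+ 2)%:C * (1 - cexp e) - 2 * q = - ((nu n ^+ 2)%:C * (cexp e - 1 - e)).
  by rewrite -{1}(aE n n0) /e; ring.
rewrite cabsN cabsM cabs_real ger0_norm ?exprn_ge0 ?nu_ge0 //.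
rewrite (@le_trans _ _ (nu n ^+ 2 * (8 * cabs e ^+ 2))) //.
  by rewrite ler_wpM2l ?exprn_ge0 ?nu_ge0 // cexp_sub_quad.
rewrite ce le_eqVlt; apply/orP; left; apply/eqP.
transitivity (8 * cabs q ^+ 2 * (nu n ^+ 2 * alp n) * alp n); first by ring.
have -> : nu n ^+ 2 * alp n = 2 by rewrite mulrC mulfVK // gt_eqF // exprn_gt0 // nu_gt0.
by ring.
Unshelve. all: by end_near. Qed.

(** From [sin t >= t - t^3 / 6] and [t^3 <= 4 t] on [[0, 2]]. *)
Lemma sin_ge_third (t : R) : 0 <= t <= 2 -> t / 3 <= sin t.
Proof.
move=> /andP[t0 t2].
have D (x : R) : is_derive x (1 : R) (fun x : R => sin x - x + x ^+ 3 / 6) (cos x - 1 + x ^+ 2 / 2).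
  apply: is_derive_eq; rewrite -[_ *: _]/(_ * _) -?[_ *: _]/(_ * _) /=.
  by rewrite ?scaler0 ?mulr0 ?add0r ?addr0 -?[_ *: _]/(_ * _); field.
have cF := continuous_subspaceT (is_derive_continuous D).
have [c _ E] := MVT_segment t0 (fun x _ => D x) (cF `[0, t]%classic).
have c2 := cos_ge_quad c.
have d0 : 0 <= cos c - 1 + c ^+ 2 / 2 by lra.
move: E; rewrite sin0 subr0 expr0n mul0r addr0 !subr0 => E.
have : 0 <= sin t - t + t ^+ 3 / 6 by rewrite E mulr_ge0.
have : t ^+ 3 <= 4 * t.
  by rewrite exprSr ler_wpM2r // (_ : 4 = 2 ^+ 2) ?lerXn2r ?nnegrE //; ring.
lra.
Qed.

Lemma circ_1w (al c y : R) : 0 <= al -> cabs (1 - wcirc al c y) <= al + `|c * y|.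
Proof.
move=> al0; set th := c * y.
have wE : wcirc al c y = (expR (- al))%:C * (cos th -i* sin th).
  by rewrite /wcirc /cexp /= cosN sinN.
pose u : R[i] := 1 - (cos th -i* sin th).
have uB : cabs u <= `|th|.
  rewrite -(@ler_pXn2r _ 2) ?nnegrE ?cabs_ge0 // cabs_sqr /u ReB ImB /= real_normK ?num_real //.
  have := cos_ge_quad th; have := cos2Dsin2 th; rewrite sub0r opprK; nra.
have -> : 1 - wcirc al c y = (1 - expR (- al))%:C + (expR (- al))%:C * u.
  by rewrite wE /u rmorphB rmorph1; ring.
have r1 : expR (- al) <= 1 by rewrite -expR0 ler_expR oppr_le0.
rewrite (le_trans (cabsD _ _)) // lerD //.
  rewrite cabs_real ger0_norm ?subr_ge0 // lerBlDr -lerBlDl; apply: le_trans (expR_ge1Dx _).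
  by rewrite lerD2l.
by rewrite cabsM cabs_real ger0_norm ?expR_ge0 // (le_trans _ uB) // ler_piMl ?cabs_ge0.
Qed.

(** With [r = |w|] and [th] the angle, the modulus is exactly
    [1 + (1 - r)^2 / (4 r) - sin (th / 2)^2], bounded by [1 + t <= exp t]. *)
Lemma circ_W (al c y : R) : 0 <= al ->
  cabs ((1 + wcirc al c y) ^+ 2 / (4 * wcirc al c y)) <=
  expR (al ^+ 2 * expR al / 4 - sin (c * y / 2) ^+ 2).
Proof.
move=> al0; set th := c * y; set r := expR (- al).
have wE : wcirc al c y = r%:C * (cos th -i* sin th) by rewrite /wcirc /cexp /= cosN sinN.
have r0 : 0 < r by exact: expR_gt0.
rewrite cabsM cabsX cabsV cabsM cabs_nat cabs_wcirc -/r cabs_sqr ReD ImD wE ReCM ImCM /=.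
have c2 : cos th = 1 - 2 * sin (th / 2) ^+ 2.
  have -> : cos th = cos ((th / 2) *+ 2) by congr (cos _); rewrite -mulr_natr; field.
  by rewrite cos_mulr2n cos2sin2; ring.
have -> : ((1 + r * cos th) ^+ 2 + (0 + r * - sin th) ^+ 2) / (4 * r) =
   1 + ((1 - r) ^+ 2 / (4 * r) - sin (th / 2) ^+ 2).
  have -> : (1 + r * cos th) ^+ 2 + (0 + r * - sin th) ^+ 2 =
    1 + 2 * r * cos th + r ^+ 2 * (cos th ^+ 2 + sin th ^+ 2) by ring.
  by rewrite cos2Dsin2 c2; field; rewrite gt_eqF.
apply: (le_trans (expR_ge1Dx _)); rewrite ler_expR lerD2r.
have r1 : r <= 1 by rewrite /r -expR0 ler_expR oppr_le0.
have ra : 1 - r <= al.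
  by rewrite lerBlDr -lerBlDl; apply: le_trans (expR_ge1Dx _); rewrite lerD2l.
have ri : (4 * r)^-1 = expR al / 4 by rewrite /r expRN invfM invrK mulrC.
rewrite ri mulrA ler_wpM2r // ler_wpM2r ?expR_ge0 //.
by apply: lerXn2r; rewrite ?nnegrE ?subr_ge0.
Qed.

(** Stated for [al <= alp n] to cover the unit circle ([al = 0]) and the circle of the main
    integral. With [t = alp y / 2], the Gaussian comes from [n (t / 3)^2 = y^2 / 9]. *)
Lemma circ_Wn n (al y : R) : (0 < n)%N -> 0 <= al <= alp n -> 0 <= y <= pi / alp n ->
  cabs (((1 + wcirc al (alp n) y) ^+ 2 / (4 * wcirc al (alp n) y)) ^+ n) <=
  expR (expR 2) * expR (- (y ^+ 2 / 9)).
Proof.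
move=> n0 /andP[al0 ala] /andP[y0 yp].
have a0 := alp_gt0 n0; have a2 := alp_le2 n0.
have nE : n%:R * alp n ^+ 2 = 4.
  have n20 : nu n ^+ 2 != 0 by rewrite expf_neq0 // gt_eqF // nu_gt0.
  rewrite -nu4 /alp (_ : nu n ^+ 4 = nu n ^+ 2 * nu n ^+ 2); last by rewrite -exprD.
  by move: (nu n ^+ 2) n20 => k k0; field.
rewrite cabsX (@le_trans _ _ (expR (al ^+ 2 * expR al / 4 - sin (alp n * y / 2) ^+ 2) ^+ n)) //.
  by apply: lerXn2r; rewrite ?nnegrE ?cabs_ge0 ?expR_ge0 ?circ_W.
rewrite -expRM_natl -expRD ler_expR mulrBr lerD //.
  apply: (@le_trans _ _ (n%:R * (alp n ^+ 2 * expR 2 / 4))).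
    rewrite ler_wpM2l // ler_wpM2r // ler_pM ?exprn_ge0 ?expR_ge0 //.
      by apply: lerXn2r; rewrite ?nnegrE // ltW.
    by rewrite ler_expR (le_trans ala).
  by rewrite -mulrA mulrA nE mulrC mulfVK.
rewrite lerN2; set t := alp n * y / 2.
have t02 : 0 <= t <= 2.
  rewrite /t; apply/andP; split; first by apply: divr_ge0 => //; apply: mulr_ge0 => //; exact: ltW.
  rewrite ler_pdivrMr //.
  rewrite ler_pdivlMr // mulrC in yp; rewrite (le_trans yp) //.
  by have := pihalf_lt2 R; rewrite ltr_pdivrMr // => /ltW.
have t3 := sin_ge_third t02; have /andP[t0 _] := t02.
have t30 : 0 <= t / 3 by exact: divr_ge0.
have : (t / 3) ^+ 2 <= sin t ^+ 2 by apply: lerXn2r => //; rewrite nnegrE // (le_trans t30).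
move=> H; apply: (@le_trans _ _ (n%:R * (t / 3) ^+ 2)); last by rewrite ler_wpM2l.
rewrite le_eqVlt; apply/orP; left; apply/eqP.
transitivity (n%:R * alp n ^+ 2 * y ^+ 2 / 36); last by rewrite /t; field.
by rewrite nE; field.
Qed.

(** With [1 + y <= exp y], what remains is the square [(y / 3 - 9 / 2)^2 >= 0]. *)
Lemma gauss_dom (y : R) : 0 <= y ->
  (1 + y) ^+ 2 * expR (- (y ^+ 2 / 9)) <= expR (81 / 4) * expR (- y).
Proof.
move=> y0; apply: (@le_trans _ _ (expR y ^+ 2 * expR (- (y ^+ 2 / 9)))).
  rewrite ler_wpM2r ?expR_ge0 //; apply: lerXn2r; rewrite ?nnegrE ?expR_ge0 ?addr_ge0 //.
  exact: expR_ge1Dx.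
rewrite -expRM_natl -!expRD ler_expR.
have := sqr_ge0 (y / 3 - 9 / 2); nra.
Qed.

Lemma W_lim (q : R[i]) (w := fun n => cexp (- ((alp n)%:C * q))) :
  ccvg \oo (fun n => ((1 + w n) ^+ 2 / (4 * w n)) ^+ n) (cexp (q ^+ 2)).
Proof.
have H1 := lim_powexp_w nu_inv nu_gt0_near (lim_nu_1w q).
have e0 : ccvg \oo (fun n => (1 - w n) ^+ 2 / (4 * w n)) 0.
  have -> : (0 : R[i]) = 0 ^+ 2 / (4 * 1) by rewrite expr2 !mul0r.
  apply: ccvgM.
    by apply: ccvgX; exact: lim_1w nu_inv nu_gt0_near (lim_nu_1w q).
  apply: ccvgV; first by rewrite mulr1 pnatr_eq0.
  by apply: ccvgM; [exact: ccvg_cst|exact: lim_w nu_inv nu_gt0_near (lim_nu_1w q)].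
have ke : ccvg \oo (fun n => n%:R * ((1 - w n) ^+ 2 / (4 * w n))) (q ^+ 2).
  by apply: near_ccvg H1; near=> n; rewrite nu4 rmorph_nat.
have P := ccvg_powexp e0 ke.
apply: near_ccvg P; near=> n; congr (_ ^+ _).
have w0 : w n != 0 by exact: cexp_neq0.
have n4 : (4 : R[i]) != 0 by rewrite pnatr_eq0.
have w40 : 4 * w n != 0 by exact: mulf_neq0.
rewrite -[X in X + _](mulfV w40) -mulrDl; congr (_ / _); ring.
Unshelve. all: by end_near. Qed.

End Scale.

Section CentralBinomial.
Variable R : realType.
Local Notation leb := (@lebesgue_measure R).

Lemma wcircE (al c y : R) (x : R) : al = c * x -> wcirc al c y = cexp (- (c%:C * (x +i* y))).
Proof.
move=> ->; rewrite /wcirc; congr (cexp (- _)); apply: complex_ext; rewrite ?ReCM ?ImCM //.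
Qed.

Lemma pow_quot (w : R[i]) n : w != 0 ->
  (1 + w) ^+ n.*2 / w ^+ n = 4 ^+ n * ((1 + w) ^+ 2 / (4 * w)) ^+ n.
Proof.
move=> w0; have n4 : (4 : R[i]) != 0 by rewrite pnatr_eq0.
rewrite -exprMn mulrA [4 * _ ^+ 2]mulrC invfM mulrA mulfK // -mul2n exprM exprMn exprVn //.
Qed.

Lemma RintegralZ_itv (b k M : R) (h : R -> R) : measurable_fun setT h ->
  (forall y, 0 <= y <= b -> `|h y| <= M) ->
  Rintegral leb `[0, b] (fun y => k * h y) = k * Rintegral leb `[0, b] h.
Proof.
move=> mh hM; apply: RintegralZl; first exact: measurable_itv.
have iM : leb.-integrable `[0, b] (EFin \o (fun=> M)).
  apply: continuous_compact_integrable; first exact: segment_compact.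
  by apply: continuous_subspaceT => y; exact: cvg_cst.
apply: le_integrable iM; first exact: measurable_itv.
  by apply/measurable_EFinP; apply: measurable_funS mh.
move=> y /=; rewrite in_itv /= => yb; rewrite lee_fin.
by rewrite (le_trans (hM y yb)) // ler_norm.
Qed.

(** The asymptotics of [C(2n, n)] come from the same circle formula, on the unit circle, where the
    integrand tends to the Gaussian function. *)
Lemma central_binomial_lim :
  'C(n.*2, n)%:R / 4 ^+ n * nu R n ^+ 2 @[n --> \oo] --> (Num.sqrt (pi : R))^-1.
Proof.
pose W n (y : R) := ((1 + wcirc 0 (alp R n) y) ^+ 2 / (4 * wcirc 0 (alp R n) y)) ^+ n.
pose h n (y : R) : R := Re (W n y).
have r1 : 0 <= expR (- 0) :> R by exact: expR_ge0.
have wr n y : cabs (wcirc 0 (alp R n) y) <= expR (- 0) by rewrite cabs_wcirc.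
have F n y : fps_at (expR (- 0)) (wcirc 0 (alp R n) y) ((1 + fX) ^+ n.*2)
    ((1 + wcirc 0 (alp R n) y) ^+ n.*2).
  by apply: fps_atXn => //; apply: fps_atD => //; [exact: fps_at1|exact: fps_atX].
have hb n y : (0 < n)%N -> 0 <= y <= pi / alp R n ->
    `|h n y| <= expR (expR 2) * expR (- (y ^+ 2 / 9)).
  move=> n0 yb; rewrite (le_trans (Re_le_cabs _)) //; apply: circ_Wn => //.
  by rewrite lexx ltW // alp_gt0.
have hb2 n y : (1 <= n)%N -> 0 <= y <= pi / alp R n ->
    `|h n y| <= expR (expR 2) * expR (81 / 4) * expR (- y).
  move=> n0 yb; rewrite (le_trans (hb _ _ n0 yb)) // -mulrA ler_wpM2l ?expR_ge0 //.
  case/andP: yb => y0 _; apply: le_trans (gauss_dom y0).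
  by rewrite ler_peMl ?expR_ge0 // exprn_ege1 // lerDl.
have E n : (0 < n)%N -> measurable_fun setT (h n) /\
    'C(n.*2, n)%:R / 4 ^+ n * nu R n ^+ 2 = 2 / pi * Rintegral leb `[0, pi / alp R n] (h n).
  move=> n0; have [[M fM] _] := F n 0.
  have [m1 m2] := coef_circle n (alp_gt0 R n0) fM.
  have hE : (fun y => Re (feval ((1 + fX) ^+ n.*2) (wcirc 0 (alp R n) y) / wcirc 0 (alp R n) y ^+ n)) =
      (fun y => 4 ^+ n * h n y).
    apply/funext => y; have [_ ->] := F n y; rewrite pow_quot ?wcirc_neq0 //.
    have -> : (4 : R[i]) ^+ n = (4 ^+ n)%:C by rewrite rmorphXn rmorph_nat.
    by rewrite ReCM.
  have p4 : 4 ^+ n != 0 :> R by rewrite expf_neq0.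
  have mh : measurable_fun setT (h n).
    rewrite hE in m1.
    have -> : h n = (fun y => (4 ^+ n)^-1 * (4 ^+ n * h n y)).
      by apply/funext => y; rewrite mulrA mulVf // mul1r.
    by apply: measurable_funM.
  split=> //; rewrite -(@fcoef1DXn R) m2 hE (@RintegralZ_itv _ _ (expR (expR 2))) //; last first.
    move=> y yb; rewrite (le_trans (hb _ _ n0 yb)) // ler_piMr ?expR_ge0 //.
    by rewrite -expR0 ler_expR oppr_le0 divr_ge0 // sqr_ge0.
  have n2 : nu R n ^+ 2 != 0 by rewrite expf_neq0 // gt_eqF // nu_gt0.
  have G (I p P v : R) : p != 0 -> v != 0 -> P != 0 -> 2 / v / P * (p * I) / p * v = 2 / P * I.
    by move=> H1 H2 H3; field; rewrite H1 H2 H3.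
  by apply: G => //; rewrite gt_eqF // pi_gt0.
have lim y : h n y @[n --> \oo] --> gauss_fun y.
  have [L _] := @W_lim R (0 +i* y).
  have gE : Re (cexp ((0 +i* y) ^+ 2)) = gauss_fun y.
    rewrite (ReImcexp _).1 expr2 ReM ImM /= !mul0r mulr0 addr0 cos0 mulr1 sub0r -expr2 //.
  rewrite gE in L; apply: cvg_trans L; apply: near_eq_cvg; near=> n.
  by rewrite /h /W (@wcircE _ _ _ 0) // mulr0.
have [_ C] := @dct_halfline R h (fun n => pi / alp R n) gauss_fun (expR (expR 2) * expR (81 / 4)) 1%N
  (fun n n1 => (E n n1).1) (@arc_cvgy R) (fun y _ => lim y) hb2.
have IG : Rintegral leb `[0, +oo[ gauss_fun = Num.sqrt pi / 2 by rewrite /Rintegral integral0y_gauss.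
rewrite IG in C.
have C2 : 2 / pi * Rintegral leb `[0, pi / alp R n] (h n) @[n --> \oo] --> 2 / pi * (Num.sqrt pi / 2).
  by apply: cvgM => //; exact: cvg_cst.
have <- : 2 / pi * (Num.sqrt pi / 2) = (Num.sqrt (pi : R))^-1.
  have s0 : 0 < Num.sqrt (pi : R) by rewrite sqrtr_gt0 pi_gt0.
  have s2 : Num.sqrt (pi : R) ^+ 2 = pi by rewrite sqr_sqrtr // pi_ge0.
  rewrite -{1}s2; move: (Num.sqrt _) s0 => t t0; field; by rewrite gt_eqF.
apply: cvg_trans C2; apply: near_eq_cvg; near=> n.
have n0 : (0 < n)%N by near: n; exact: nbhs_infty_gt.
by have [_ ->] := E n n0.
Unshelve. all: by end_near. Qed.

End CentralBinomial.

(** * Values of the series at a point of the disc *)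

Section Values.
Variables (R : realType) (r z x A0 : R).
Hypotheses (r0 : 0 <= r) (z0 : 0 <= z) (z1 : z < 1) (zE : 2 * z = r * (1 + z ^+ 2)).
Hypotheses (A00 : 0 <= A0) (xK : A0 ^+ 2 + `|x| * kappa z * (1 + A0) ^+ 3 <= A0).
Hypothesis A01 : 2 * A0 + A0 ^+ 2 < 1.
Variables (w : R[i]) (j : nat).
Hypothesis wr : cabs w <= r.

Let zeta := feval (Zs R) w.
Let kv := feval (Ks R) w.
Let m := feval (mus x) w.
Let D := feval (Ds x j) w.

Let aZ : fps_at r w (Zs R) zeta.
Proof. by split=> //; exists z; apply: fnorm_Zs. Qed.
Let aK : fps_at r w (Ks R) kv.
Proof. by split=> //; exists (kappa z); apply: fnorm_Ks. Qed.
Let am : fps_at r w (mus x) m.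
Proof. by split=> //; exists A0; apply: (@fnorm_mus _ r r0 z). Qed.
Let aD : fps_at r w (Ds x j) D.
Proof. by split=> //; apply: (@fnorm_Ds _ r r0 z z0 z1 zE x A0). Qed.
Let a1 : fps_at r w 1 1. Proof. exact: fps_at1. Qed.

Lemma zeta_eq : 2 * zeta = w * (1 + zeta ^+ 2).
Proof.
have H1 : fps_at r w (2 * Zs R) (2 * zeta).
  apply: fps_atM => //; rewrite (_ : 2 = 1 + 1 :> fps R) // (_ : 2 = 1 + 1 :> R[i]) //.
  exact: fps_atD.
rewrite Zs_eq in H1; apply: fps_atE H1 _; apply: fps_atM => //; first exact: fps_atX.
by apply: fps_atD => //; exact: fps_atXn.
Qed.

Lemma zeta_le : cabs zeta <= z.
Proof. by apply: (@feval_bound _ r) => //; exact: fnorm_Zs. Qed.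

Lemma kv_eq : (1 - zeta ^+ 2) * (1 - zeta) * (1 - zeta ^+ 3) * kv = 1 + zeta ^+ 2.
Proof.
have H1 : fps_at r w (1 + Zs R ^+ 2) (1 + zeta ^+ 2) by apply: fps_atD => //; exact: fps_atXn.
rewrite -Ks_eq in H1; apply: fps_atE H1.
have B k : fps_at r w (1 - Zs R ^+ k) (1 - zeta ^+ k) by apply: fps_atB => //; exact: fps_atXn.
apply: fps_atM => //; apply: fps_atM => //; apply: fps_atM => //; exact: (B 1%N).
Qed.

Lemma m_le : cabs m <= A0.
Proof. by apply: (@feval_bound _ r) => //; apply: (@fnorm_mus _ r r0 z). Qed.

Let am_k k : fps_at r w (1 + mus x * Zs R ^+ k) (1 + m * zeta ^+ k).
Proof. by apply: fps_atD => //; apply: fps_atM => //; exact: fps_atXn. Qed.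

Lemma m_eq : m = m ^+ 2 * zeta ^+ 2 +
  x%:C * kv * ((1 + m * zeta) * (1 + m * zeta ^+ 2) * (1 + m * zeta ^+ 3)).
Proof.
have H1 := am; rewrite -mus_fix in H1; apply: fps_atE H1 _.
apply: fps_atD => //; first by apply: fps_atM => //; exact: fps_atXn.
apply: fps_atM => //; first by apply: fps_atM => //; exact: fps_atC.
apply: fps_atM => //; apply: fps_atM => //; exact: (am_k 1%N).
Qed.

Lemma D_eq : (1 + m * zeta ^+ j.+1) * (1 + m * zeta ^+ j.+3) * D =
  m * zeta ^+ j * (1 - zeta) * (1 - zeta ^+ 3).
Proof.
have B k : fps_at r w (1 - Zs R ^+ k) (1 - zeta ^+ k) by apply: fps_atB => //; exact: fps_atXn.
have H1 : fps_at r w (mus x * Zs R ^+ j * (1 - Zs R) * (1 - Zs R ^+ 3))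
    (m * zeta ^+ j * (1 - zeta) * (1 - zeta ^+ 3)).
  apply: fps_atM => //; apply: fps_atM => //; last exact: (B 1%N).
  by apply: fps_atM => //; exact: fps_atXn.
rewrite -Ds_eq in H1; apply: fps_atE H1.
by apply: fps_atM => //; apply: fps_atM => //; exact: am_k.
Qed.

(** The double zero of the numerator at [zeta = 1] becomes a factor [1 - w] through
    [(1 - zeta)^2 = (1 - w) (1 + zeta^2)]; the two factors of the denominator have modulus at least
    [1 - A0]. *)
Lemma D_bound : cabs D <= 6 / (1 - A0) ^+ 2 * cabs (1 - w).
Proof.
have Z1 : cabs zeta <= 1 by rewrite (le_trans zeta_le) // ltW.
have A1 : A0 < 1 by have := A00; have := A01; nra.
have ak k : 1 - A0 <= cabs (1 + m * zeta ^+ k).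
  have := cabs_sub_le 1 (- (m * zeta ^+ k)); rewrite cabs1 cabsN opprK; apply: le_trans.
  rewrite lerD2l lerN2 cabsM cabsX (le_trans _ m_le) // ler_piMr ?cabs_ge0 //.
  by rewrite exprn_ile1 ?cabs_ge0.
have zw : cabs (1 - zeta) ^+ 2 <= 2 * cabs (1 - w).
  have E : (1 - zeta) ^+ 2 = (1 - w) * (1 + zeta ^+ 2) by rewrite mulrBl mul1r -zeta_eq; ring.
  rewrite -cabsX E cabsM mulrC ler_wpM2r ?cabs_ge0 // (le_trans (cabsD _ _)) // cabs1 cabsX.
  by rewrite (_ : 2 = 1 + 1) // lerD2l exprn_ile1 ?cabs_ge0.
have N : cabs (m * zeta ^+ j * (1 - zeta) * (1 - zeta ^+ 3)) <= 6 * cabs (1 - w).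
  have -> : m * zeta ^+ j * (1 - zeta) * (1 - zeta ^+ 3) =
    m * zeta ^+ j * (1 + zeta + zeta ^+ 2) * (1 - zeta) ^+ 2 by ring.
  have -> : 6 * cabs (1 - w) = 3 * (2 * cabs (1 - w)) by ring.
  rewrite cabsM [cabs (_ ^+ 2)]cabsX ler_pM ?cabs_ge0 ?exprn_ge0 ?cabs_ge0 //.
  rewrite cabsM -[3]mul1r ler_pM ?cabs_ge0 //.
    rewrite cabsM cabsX -[1]mulr1 ler_pM ?exprn_ge0 ?cabs_ge0 //; last by rewrite exprn_ile1 ?cabs_ge0.
    by rewrite (le_trans m_le) // ltW.
  rewrite (_ : 3 = 1 + 1 + 1); last by ring.
  rewrite (le_trans (cabsD _ _)) // lerD //; last by rewrite cabsX exprn_ile1 ?cabs_ge0.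
  by rewrite (le_trans (cabsD _ _)) // cabs1 lerD2l.
rewrite mulrAC ler_pdivlMr ?exprn_gt0 ?subr_gt0 // (le_trans _ N) // -D_eq cabsM mulrC.
rewrite ler_wpM2r ?cabs_ge0 // expr2 cabsM ler_pM ?subr_ge0 ?(ltW A1) //.
Qed.

Lemma D_value : 1 + m * zeta ^+ j.+1 != 0 /\ 1 + m * zeta ^+ j.+3 != 0.
Proof.
have Z1 : cabs zeta <= 1 by rewrite (le_trans zeta_le) // ltW.
have A1 : A0 < 1 by have := A00; have := A01; nra.
have ak k : 1 - A0 <= cabs (1 + m * zeta ^+ k).
  have := cabs_sub_le 1 (- (m * zeta ^+ k)); rewrite cabs1 cabsN opprK; apply: le_trans.
  rewrite lerD2l lerN2 cabsM cabsX (le_trans _ m_le) // ler_piMr ?cabs_ge0 //.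
  by rewrite exprn_ile1 ?cabs_ge0.
by split; rewrite -cabs_gt0 (lt_le_trans _ (ak _)) // subr_gt0.
Qed.

Lemma fps_integrand n : fps_at r w ((1 + fX) ^+ n.*2 * (1 - fX) * Ds x j)
  ((1 + w) ^+ n.*2 * (1 - w) * D).
Proof.
have aX : fps_at r w fX w by exact: fps_atX.
apply: fps_atM => //; apply: fps_atM => //; last exact: fps_atB.
by apply: fps_atXn => //; exact: fps_atD.
Qed.

End Values.

Section MainLimit.
Variable R : realType.
Local Notation leb := (@lebesgue_measure R).

Lemma ccvg_bd0 (f g : nat -> R[i]) (M : R) :
  (\forall n \near \oo, cabs (f n) <= M) -> ccvg \oo g 0 -> ccvg \oo (fun n => f n * g n) 0.
Proof.
move=> fM g0.
apply: (@ccvg_squeeze _ _ _ _ _ (fun n => M * cabs (g n))); last first.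
  rewrite -[X in _ --> X](mulr0 M); apply: cvgM; first exact: cvg_cst.
  by rewrite -(@cabs0 R); exact: cvg_cabs.
by near=> n; rewrite subr0 cabsM ler_wpM2r ?cabs_ge0 //; near: n.
Unshelve. all: by end_near. Qed.

(** [m n] solves the limit equation up to an error [d n] tending to 0. The divided difference being
    at least [kapQ A0], the distance to [A] is at most [|d n| / kapQ A0]. *)
Lemma m_limit (A0 : R) (m zeta k : nat -> R[i]) (y A : R[i]) :
  0 <= A0 -> 0 < 1 - 4 * A0 + A0 ^+ 2 ->
  (\forall n \near \oo, cabs (m n) <= A0) ->
  (\forall n \near \oo, cabs (zeta n) <= 1) ->
  (\forall n \near \oo, m n = m n ^+ 2 * zeta n ^+ 2 +
    k n * ((1 + m n * zeta n) * (1 + m n * zeta n ^+ 2) * (1 + m n * zeta n ^+ 3))) ->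
  ccvg \oo zeta 1 -> ccvg \oo k y ->
  A = A ^+ 2 + y * (1 + A) ^+ 3 -> cabs A <= A0 -> cabs y <= beta A0 ->
  ccvg \oo m A.
Proof.
move=> A00 A0k mA z1 mE zl kl AE AA yA.
pose P n := (1 + m n * zeta n) * (1 + m n * zeta n ^+ 2) * (1 + m n * zeta n ^+ 3).
(* The difference of the two equations, telescoped so that each term is a bounded factor times a
   null sequence. *)
pose d n := m n ^+ 2 * (zeta n ^+ 2 - 1) + (P n * (k n - y) +
  y * (m n * (1 + m n * zeta n ^+ 2) * (1 + m n * zeta n ^+ 3) * (zeta n - 1) +
       ((1 + m n) * m n * (1 + m n * zeta n ^+ 3) * (zeta n ^+ 2 - 1) +
        (1 + m n) ^+ 2 * m n * (zeta n ^+ 3 - 1)))).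
have zX i : ccvg \oo (fun n => zeta n ^+ i - 1) 0.
  rewrite -(subrr (1 : R[i])) -[X in X - _](expr1n _ i).
  by apply: ccvgB; [exact: ccvgX|exact: ccvg_cst].
have z0 : ccvg \oo (fun n => zeta n - 1) 0 := zX 1%N.
have bk i : \forall n \near \oo, cabs (1 + m n * zeta n ^+ i) <= 1 + A0.
  near=> n; rewrite (le_trans (cabsD _ _)) // cabs1 lerD2l cabsM cabsX.
  have h1 : cabs (m n) <= A0 by near: n.
  have h2 : cabs (zeta n) <= 1 by near: n.
  by rewrite (le_trans _ h1) // ler_piMr ?cabs_ge0 // exprn_ile1 ?cabs_ge0.
have bm : \forall n \near \oo, cabs (1 + m n) <= 1 + A0.
  by near=> n; rewrite (le_trans (cabsD _ _)) // cabs1 lerD2l; near: n.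
have d0 : ccvg \oo d 0.
  have -> : (0 : R[i]) = 0 + (0 + y * (0 + (0 + 0))) by rewrite !addr0 mulr0 !addr0.
  apply: ccvgD.
    apply: (@ccvg_bd0 _ _ (A0 ^+ 2)) => //; near=> n; rewrite cabsX.
    by apply: lerXn2r; rewrite ?nnegrE ?cabs_ge0 //; near: n.
  apply: ccvgD.
    apply: (@ccvg_bd0 _ _ ((1 + A0) * (1 + A0) * (1 + A0))).
      near=> n; rewrite /P !cabsM !ler_pM ?mulr_ge0 ?cabs_ge0 //; near: n; [exact: (bk 1%N)|exact: bk|exact: bk].
    by rewrite -(subrr y); apply: ccvgB => //; exact: ccvg_cst.
  apply: ccvgM; first exact: ccvg_cst.
  apply: ccvgD.
    apply: (@ccvg_bd0 _ _ (A0 * (1 + A0) * (1 + A0))) => //.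
    near=> n; rewrite !cabsM !ler_pM ?mulr_ge0 ?cabs_ge0 //; near: n; [exact: mA|exact: bk|exact: bk].
  apply: ccvgD.
    apply: (@ccvg_bd0 _ _ ((1 + A0) * A0 * (1 + A0))) => //.
    near=> n; rewrite !cabsM !ler_pM ?mulr_ge0 ?cabs_ge0 //; near: n; [exact: bm|exact: mA|exact: bk].
  apply: (@ccvg_bd0 _ _ ((1 + A0) ^+ 2 * A0)) => //.
  near=> n; rewrite cabsM cabsX ler_pM ?exprn_ge0 ?cabs_ge0 //; last by near: n.
  by apply: lerXn2r; rewrite ?nnegrE ?addr_ge0 ?cabs_ge0 //; near: n.
have kQ := kapQ_gt0 A00 A0k.
apply: (@ccvg_squeeze _ _ _ _ _ (fun n => (kapQ A0)^-1 * cabs (d n))); last first.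
  rewrite -[X in _ --> X](mulr0 (kapQ A0)^-1); apply: cvgM; first exact: cvg_cst.
  by rewrite -(@cabs0 R); exact: cvg_cabs.
near=> n.
have E1 : m n = m n ^+ 2 + y * (1 + m n) ^+ 3 + d n.
  have E0 : m n = m n ^+ 2 * zeta n ^+ 2 +
    k n * ((1 + m n * zeta n) * (1 + m n * zeta n ^+ 2) * (1 + m n * zeta n ^+ 3)) by near: n.
  by rewrite {1}E0 /d /P; ring.
have E2 : A = A ^+ 2 + y * (1 + A) ^+ 3 + 0 by rewrite addr0.
have Q := Qdiff_eq E1 E2; rewrite subr0 in Q.
have QB : kapQ A0 <= cabs (Qdiff (m n) A y) by apply: Qdiff_bound => //; near: n.
rewrite mulrC ler_pdivlMr // -Q cabsM ler_wpM2l ?cabs_ge0 //.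
Unshelve. all: by end_near. Qed.

Definition zr (r : R) : R := (1 - Num.sqrt (1 - r ^+ 2)) / r.

Lemma zr_spec r : 0 < r < 1 -> [/\ 0 <= zr r, zr r < 1 & 2 * zr r = r * (1 + zr r ^+ 2)].
Proof.
move=> /andP[r0 r1]; rewrite /zr; set s := Num.sqrt _.
have s2 : s ^+ 2 = 1 - r ^+ 2 by rewrite sqr_sqrtr // subr_ge0 exprn_ile1 ?ltW.
have s0 : 0 <= s by exact: sqrtr_ge0.
have s1 : s <= 1 by nra.
split.
- by apply: divr_ge0; [rewrite subr_ge0|exact: ltW].
- rewrite ltr_pdivrMr // mul1r; nra.
- have r2 : r ^+ 2 = 1 - s ^+ 2 by rewrite s2; ring.
  have rn : r != 0 by rewrite gt_eqF.
  apply: (mulIf rn); rewrite mulrA mulfVK //.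
  transitivity (r ^+ 2 + (1 - s) ^+ 2); first by rewrite r2; ring.
  by field.
Qed.

(** The square root of [1 + i y] with positive real part, in explicit form. *)
Definition vhyp (y : R) : R[i] :=
  let X := Num.sqrt ((1 + Num.sqrt (1 + y ^+ 2)) / 2) in X +i* (y / (2 * X)).

Lemma vhyp_spec y : vhyp y ^+ 2 = 1 +i* y /\ 1 <= Re (vhyp y).
Proof.
rewrite /vhyp; set S := Num.sqrt (1 + y ^+ 2); set X := Num.sqrt _ => /=.
have S2 : S ^+ 2 = 1 + y ^+ 2 by rewrite sqr_sqrtr // addr_ge0 // sqr_ge0.
have S1 : 1 <= S by rewrite -sqrtr1 ler_wsqrtr // lerDl sqr_ge0.
have X2 : X ^+ 2 = (1 + S) / 2 by rewrite sqr_sqrtr // divr_ge0 // addr_ge0 // (le_trans _ S1).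
have X1 : 1 <= X by rewrite -sqrtr1 ler_wsqrtr // ler_pdivlMr //; lra.
have Xn : X != 0 by rewrite gt_eqF // (lt_le_trans _ X1).
split=> //; rewrite expr2; apply: complex_ext; rewrite ?ReM ?ImM /=; last by field.
have -> : X * X - y / (2 * X) * (y / (2 * X)) = X ^+ 2 - y ^+ 2 / 4 / X ^+ 2 by field.
rewrite X2; have -> : y ^+ 2 = (S - 1) * (S + 1).
  by transitivity (S ^+ 2 - 1); [rewrite S2; ring|ring].
by field; rewrite gt_eqF //; lra.
Qed.

Lemma vhyp_ge1 y : 1 <= cabs (vhyp y).
Proof.
have [_ v1] := vhyp_spec y; apply: le_trans (Re_le_cabs _).
exact: le_trans (ler_norm _).
Qed.

End MainLimit.

Lemma D_numerator (K : comNzRingType) (m zj z v : K) :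
  m * zj * (v * (1 - z)) ^+ 2 * (1 + z + z ^+ 2) = v ^+ 2 * (m * zj * (1 - z) * (1 - z ^+ 3)).
Proof. ring. Qed.

(** * The limit of the Laplace transform as an integral over the hyperbola *)

Section LaplaceLimit.
Variables (R : realType) (c : nat -> R) (lam a A0 : R).
Hypotheses (Ac : is_A_coef c) (lam0 : 0 <= lam).
Hypotheses (A00 : 0 < A0) (A0k : 0 < 1 - 4 * A0 + A0 ^+ 2) (A01 : 2 * A0 + A0 ^+ 2 < 1).
Hypothesis (aA : `|a| / 24 < beta A0).
Local Notation leb := (@lebesgue_measure R).
Local Notation nu := (nu R).
Local Notation alp := (alp R).

Definition Bval (v : R[i]) : R[i] := Aval c (a%:C / v ^+ 3) * cexp (- (2 * lam)%:C * v).

Let rho : R := 24 * beta A0.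
Let rho0 : 0 <= rho.
Proof. by rewrite mulr_ge0 // (le_trans _ (ltW aA)) // divr_ge0. Qed.
Let rhoA : A0 ^+ 2 + rho / 24 * (1 + A0) ^+ 3 <= A0.
Proof.
by rewrite (_ : rho / 24 = beta A0) ?beta_fix //; [exact: ltW|rewrite /rho; field].
Qed.

Lemma Aarg_bound (v : R[i]) : 1 <= cabs v -> cabs (a%:C / v ^+ 3) <= rho.
Proof.
move=> v1; rewrite cabsM cabs_real cabsV cabsX.
apply: (@le_trans _ _ `|a|); last first.
  by move: aA; rewrite ltr_pdivrMr // mulrC => /ltW.
by rewrite ler_piMr // invf_le1 ?exprn_ege1 // exprn_gt0 // (lt_le_trans _ v1).
Qed.

(** Chosen so that [(1 + xn n) ^+ nlabel j t] is the exponential of [a] times the normalised number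
    of labels. *)
Definition xn n : R := expR (a / nu n ^+ 3) - 1.
Definition jn n : nat := `|Num.floor (lam * nu n)|%N.

Let nu3_inv : (nu n ^+ 3)^-1 @[n --> \oo] --> (0 : R).
Proof.
rewrite -[X in _ --> X](_ : 0 * (0 * 0) = 0 :> R); last by rewrite mul0r.
under eq_fun do rewrite exprS expr2 !invfM.
by apply: cvgM; [|apply: cvgM]; exact: nu_inv.
Qed.

Lemma xn_lim : xn n * nu n ^+ 3 @[n --> \oo] --> a.
Proof.
have L1 : 4 * a ^+ 2 * (nu n ^+ 3)^-1 @[n --> \oo] --> (0 : R).
  by rewrite -[X in _ --> X](mulr0 (4 * a ^+ 2)); apply: cvgM => //; exact: cvg_cst.
have L2 : a / nu n ^+ 3 @[n --> \oo] --> (0 : R).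
  by rewrite -[X in _ --> X](mulr0 a); apply: cvgM => //; exact: cvg_cst.
have L3 : `|a / nu n ^+ 3| @[n --> \oo] --> (0 : R) by rewrite -(@normr0 _ R); exact: cvg_norm.
apply/cvgrPdist_le => e e0; near=> n.
have n0 : (0 < n)%N by near: n; exact: nbhs_infty_gt.
have v0 : 0 < nu n ^+ 3 by rewrite exprn_gt0 // nu_gt0.
have e1 : `|a / nu n ^+ 3| <= 1 by near: n; apply: (cvgr_le _ L3); rewrite ltr01.
have Q := expR_sub_quad e1.
have -> : a - xn n * nu n ^+ 3 = - ((expR (a / nu n ^+ 3) - 1 - a / nu n ^+ 3) * nu n ^+ 3).
  by rewrite /xn; field; rewrite gt_eqF ?nu_gt0.
rewrite normrN normrM (ger0_norm (ltW v0)).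
apply: (@le_trans _ _ (4 * (a / nu n ^+ 3) ^+ 2 * nu n ^+ 3)); first by rewrite ler_wpM2r // ltW.
have -> : 4 * (a / nu n ^+ 3) ^+ 2 * nu n ^+ 3 = 4 * a ^+ 2 * (nu n ^+ 3)^-1.
  by field; rewrite gt_eqF ?nu_gt0.
by near: n; apply: (cvgr_le _ L1).
Unshelve. all: by end_near. Qed.

Lemma jn_floor n : Num.floor (lam * nu n) = jn n.
Proof. by rewrite /jn gez0_abs // floor_ge0 mulr_ge0 // nu_ge0. Qed.

Lemma jn_lim : (jn n)%:R / nu n @[n --> \oo] --> lam.
Proof.
apply/cvgrPdist_le => e e0; near=> n.
have n0 : (0 < n)%N by near: n; exact: nbhs_infty_gt.
have v0 : 0 < nu n by rewrite nu_gt0.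
have /andP[f1 f2] := floor_itv (lam * nu n).
rewrite jn_floor in f1 f2.
have -> : lam - (jn n)%:R / nu n = (lam * nu n - (jn n)%:R) / nu n by field; rewrite gt_eqF.
rewrite intrD /= in f2; rewrite -!pmulrn in f1 f2.
rewrite normrM ger0_norm ?subr_ge0 // ger0_norm ?invr_ge0 ?(ltW v0) //.
apply: (@le_trans _ _ (nu n)^-1).
  by rewrite ler_piMl ?invr_ge0 ?(ltW v0) // lerBlDl ltW.
by near: n; apply: (cvgr_le _ (@nu_inv R)).
Unshelve. all: by end_near. Qed.

Definition rn n : R := expR (- alp n).

Lemma rn_itv n : (0 < n)%N -> 0 < rn n < 1.
Proof. by move=> n0; rewrite expR_gt0 /= -expR0 ltr_expR oppr_lt0 alp_gt0. Qed.

Definition zn n : R := zr (rn n).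

(** The limit of [x K] is applied at the real point of the circle, where [q = v = 1]: [|xn| kappa]
    tends to [|a| / 24], which is below [beta A0] by the choice of [A0]. *)
Lemma xK_near : \forall n \near \oo, A0 ^+ 2 + `|xn n| * kappa (zn n) * (1 + A0) ^+ 3 <= A0.
Proof.
have hz : \forall n \near \oo, 2 * (zn n)%:C = cexp (- ((alp n)%:C * 1)) * (1 + (zn n)%:C ^+ 2) /\
    cabs (zn n)%:C <= 1.
  near=> n; have n0 : (0 < n)%N by near: n; exact: nbhs_infty_gt.
  have [z0 z1 zE] := zr_spec (rn_itv n0); split; last by rewrite cabs_real ger0_norm // ltW.
  have -> : cexp (- ((alp n)%:C * 1)) = (rn n)%:C.
    by rewrite mulr1 /cexp /= oppr0 cos0 sin0 mulr1.
  have -> : 2 * (zn n)%:C = (2 * zn n)%:C by rewrite [RHS]rmorphM rmorph_nat.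
  by rewrite /zn zE [LHS]rmorphM rmorphD rmorph1 rmorphXn.
have kE : \forall n \near \oo, (1 - (zn n)%:C ^+ 2) * (1 - (zn n)%:C) * (1 - (zn n)%:C ^+ 3) *
    (kappa (zn n))%:C = 1 + (zn n)%:C ^+ 2.
  near=> n; have n0 : (0 < n)%N by near: n; exact: nbhs_infty_gt.
  have [z0 z1 _] := zr_spec (rn_itv n0).
  rewrite -!rmorphXn -[1](rmorph1 (real_complex R)) -!rmorphB -rmorphD -!rmorphM; congr (_%:C).
  have zk i : (0 < i)%N -> 1 - zn n ^+ i != 0.
    by move=> i0; rewrite subr_eq0 eq_sym lt_eqF // exprn_ilt1 // -lt0n.
  rewrite /kappa; have := zk 1%N isT; have := zk 2 isT; have := zk 3 isT; rewrite expr1.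
  by move=> h3 h2 h1; field; rewrite h1 h2 h3.
have one : 0 < Re (1 : R[i]) by [].
have L := lim_xK (@nu_inv R) (@nu_gt0_near R) (@lim_nu_1w R 1) hz (expr1n _ 2) one xn_lim kE.
have L2 : cabs ((xn n)%:C * (kappa (zn n))%:C) @[n --> \oo] --> cabs (a%:C / 1 ^+ 3 / 24) by exact: cvg_cabs.
have E : cabs (a%:C / 1 ^+ 3 / 24) = `|a| / 24.
  by rewrite expr1n divr1 cabsM cabsV cabs_real cabs_nat.
rewrite E in L2; near=> n.
have n0 : (0 < n)%N by near: n; exact: nbhs_infty_gt.
have [z0 z1 zE] := zr_spec (rn_itv n0).
have k0 : 0 <= kappa (zn n) by apply: (@kappa_ge0 _ (rn n)) => //; exact: expR_ge0.
have : cabs ((xn n)%:C * (kappa (zn n))%:C) <= beta A0 by near: n; apply: (cvgr_le _ L2).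
rewrite cabsM !cabs_real (ger0_norm k0) => H.
rewrite -[leRHS](beta_fix (ltW A00)) lerD2l ler_wpM2r // exprn_ge0 // addr_ge0 // ltW //.
Unshelve. all: by end_near. Qed.

Definition Hlim (y : R) : R[i] :=
  cexp ((1 +i* y) ^+ 2) * (2 * (1 +i* y)) *
  (12 * (1 +i* y) * (Bval (vhyp y) / (1 + Bval (vhyp y)) ^+ 2)).

Let wn n (y : R) := wcirc (alp n) (alp n) y.
Let Dn n (y : R) := feval (Ds (xn n) (jn n)) (wn n y).

(** [1 - w] and [D] are both of order [n^(-1/2)], so each receives a factor [nu^2]. Their product
    [nu^4 = n] balances the factor [n + 1] of [expect_pow]. *)
Let hn n (y : R) : R := Re (((1 + wn n y) ^+ 2 / (4 * wn n y)) ^+ n *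
  ((nu n ^+ 2)%:C * (1 - wn n y)) * ((nu n ^+ 2)%:C * Dn n y)).

Let wE n y : wn n y = cexp (- ((alp n)%:C * (1 +i* y))).
Proof. by rewrite /wn (@wcircE _ _ _ _ 1) ?mulr1. Qed.

Let good n := (0 < n)%N /\ A0 ^+ 2 + `|xn n| * kappa (zn n) * (1 + A0) ^+ 3 <= A0.

Lemma good_near : exists N, forall n, (N <= n)%N -> good n.
Proof.
have : \forall n \near \oo, good n.
  by near=> n; split; near: n; [exact: nbhs_infty_gt|exact: xK_near].
by move=> [N _ H]; exists N => n; exact: H.
Unshelve. all: by end_near. Qed.

Let wr n y : cabs (wn n y) <= rn n.
Proof. by rewrite cabs_wcirc. Qed.

Lemma hn_bound n y : good n -> 0 <= y <= pi / alp n ->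
  `|hn n y| <= expR (expR 2) * (24 / (1 - A0) ^+ 2) * ((1 + y) ^+ 2 * expR (- (y ^+ 2 / 9))).
Proof.
move=> [n0 xK] yb; have /andP[y0 _] := yb.
have [z0 z1 zE] := zr_spec (rn_itv n0); have a0 := alp_gt0 R n0.
rewrite (le_trans (Re_le_cabs _)) // !cabsM !cabs_real !(ger0_norm (exprn_ge0 _ (nu_ge0 _ _))).
have b1 : cabs (((1 + wn n y) ^+ 2 / (4 * wn n y)) ^+ n) <= expR (expR 2) * expR (- (y ^+ 2 / 9)).
  by apply: circ_Wn => //; rewrite lexx ltW.
have b2 : nu n ^+ 2 * cabs (1 - wn n y) <= 2 * (1 + y).
  have := circ_1w (alp n) y (ltW a0); rewrite -/(wn n y) normrM (gtr0_norm a0) (ger0_norm y0) => H.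
  have -> : 2 * (1 + y) = nu n ^+ 2 * (alp n + alp n * y).
    by rewrite /alp; field; rewrite gt_eqF // nu_gt0.
  by rewrite ler_wpM2l // exprn_ge0 // nu_ge0.
have b3 : nu n ^+ 2 * cabs (Dn n y) <= 12 / (1 - A0) ^+ 2 * (1 + y).
  have H := @D_bound _ (rn n) (zn n) (xn n) A0 (expR_ge0 _) z0 z1 zE (ltW A00) xK A01 (wn n y) (jn n) (wr n y).
  have k0 : 0 <= 6 / (1 - A0) ^+ 2 by rewrite divr_ge0 // sqr_ge0.
  have -> : 12 / (1 - A0) ^+ 2 * (1 + y) = 6 / (1 - A0) ^+ 2 * (2 * (1 + y)) by ring.
  apply: (@le_trans _ _ (6 / (1 - A0) ^+ 2 * (nu n ^+ 2 * cabs (1 - wn n y)))); last by rewrite ler_wpM2l.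
  by rewrite mulrCA ler_wpM2l // exprn_ge0 // nu_ge0.
have -> : expR (expR 2) * (24 / (1 - A0) ^+ 2) * ((1 + y) ^+ 2 * expR (- (y ^+ 2 / 9))) =
  expR (expR 2) * expR (- (y ^+ 2 / 9)) * (2 * (1 + y)) * (12 / (1 - A0) ^+ 2 * (1 + y)) by ring.
have p2 : 0 <= nu n ^+ 2 by rewrite exprn_ge0 // nu_ge0.
have W0 := cabs_ge0 (((1 + wn n y) ^+ 2 / (4 * wn n y)) ^+ n).
have q1 : 0 <= nu n ^+ 2 * cabs (1 - wn n y) by exact: mulr_ge0 p2 (cabs_ge0 _).
have q2 : 0 <= nu n ^+ 2 * cabs (Dn n y) by exact: mulr_ge0 p2 (cabs_ge0 _).
by apply: (ler_pM (mulr_ge0 W0 q1) q2 _ b3); exact: ler_pM.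
Qed.

Lemma expectE n : good n -> measurable_fun setT (hn n) /\
  unif_expect n (fun t => expR (a * Ylam lam n t)) =
  1 + n.+1%:R / n%:R * (4 ^+ n / ('C(n.*2, n)%:R * nu n ^+ 2)) * (2 / pi) *
    Rintegral leb `[0, pi / alp n] (hn n).
Proof.
move=> gn; have [n0 xK] := gn; have [z0 z1 zE] := zr_spec (rn_itv n0).
have v0 : nu n != 0 by rewrite gt_eqF // nu_gt0.
have F y := @fps_integrand _ (rn n) (zn n) (xn n) A0 (expR_ge0 _) z0 z1 zE (ltW A00) xK A01 (wn n y) (jn n) (wr n y) n.
have [[M fM] _] := F 0.
have [m1 m2] := coef_circle n (alp_gt0 R n0) fM.
have p4 : 4 ^+ n != 0 :> R by rewrite expf_neq0.
pose k : R := 4 ^+ n / nu n ^+ 4.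
have hE : (fun y => Re (feval ((1 + fX) ^+ n.*2 * (1 - fX) * Ds (xn n) (jn n)) (wcirc (alp n) (alp n) y) /
   wcirc (alp n) (alp n) y ^+ n)) = (fun y => k * hn n y).
  apply/funext => y; rewrite -/(wn n y); have [_ ->] := F y.
  rewrite -/(Dn n y) /hn -ReCM; congr (Re _).
  have kE : k%:C * ((nu n ^+ 2)%:C * (nu n ^+ 2)%:C) = 4 ^+ n.
    rewrite -!rmorphM -exprD mulfVK ?expf_neq0 // rmorphXn rmorph_nat //.
  transitivity (((1 + wn n y) ^+ n.*2 / wn n y ^+ n) * ((1 - wn n y) * Dn n y)).
    by move: (_^-1) => I; ring.
  rewrite pow_quot ?wcirc_neq0 // -kE; move: (_ ^+ n) => WW; ring.
have k0 : k != 0 by rewrite mulf_neq0 // invr_eq0 expf_neq0.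
have mh : measurable_fun setT (hn n).
  rewrite hE in m1.
  have -> : hn n = (fun y => k^-1 * (k * hn n y)) by apply/funext => y; rewrite mulrA mulVf // mul1r.
  by apply: measurable_funM.
split=> //.
have -> : (fun t => expR (a * Ylam lam n t)) = (fun t => (1 + xn n) ^+ nlabel (jn n) t).
  apply/funext => t; rewrite /Ylam /Yn -/(nu n) jn_floor nu3 /xn addrC subrK -expRM_natl.
  by congr expR; ring.
rewrite expect_pow m2 hE.
rewrite (@RintegralZ_itv _ _ _ (expR (expR 2) * (24 / (1 - A0) ^+ 2) * expR (81 / 4))) //; last first.
  move=> y yb; rewrite (le_trans (hn_bound gn yb)) // ler_wpM2l //.
    by rewrite mulr_ge0 ?expR_ge0 // divr_ge0 // sqr_ge0.
  have /andP[y0 _] := yb; apply: le_trans (gauss_dom y0) _.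
  by rewrite ler_piMr ?expR_ge0 // -expR0 ler_expR oppr_le0.
rewrite /k /alp -(nu4 R n).
have C0 : ('C(n.*2, n)%:R : R) != 0 by rewrite pnatr_eq0 -lt0n bin_gt0 -addnn leq_addr.
have G (I p P v C S : R) : p != 0 -> v != 0 -> P != 0 -> C != 0 ->
  S / C * (2 / v ^+ 2 / P * (p / v ^+ 4 * I)) = S / v ^+ 4 * (p / (C * v ^+ 2)) * (2 / P) * I.
  by move=> h1 h2 h3 h4; field; rewrite h2 h3 h4.
have P0 : (pi : R) != 0 by rewrite gt_eqF // pi_gt0.
congr (1 + _); exact: (G _ _ _ _ _ _ p4 v0 P0 C0).
Qed.

Lemma hn_lim y : hn n y @[n --> \oo] --> Re (Hlim y).
Proof.
have [N gN] := good_near; have gnear : \forall n \near \oo, good n by exists N.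
have [vq v1] := vhyp_spec y; set v := vhyp y in vq v1.
have v0 : 0 < Re v by exact: lt_le_trans v1.
pose q : R[i] := 1 +i* y.
pose zeta n := feval (Zs R) (wn n y); pose m n := feval (mus (xn n)) (wn n y).
pose kv n := feval (Ks R) (wn n y).
have hw : ccvg \oo (fun n => (nu n ^+ 2)%:C * (1 - wn n y)) (2 * q).
  by apply: near_ccvg (lim_nu_1w q); near=> n; rewrite wE.
have hz : \forall n \near \oo, 2 * zeta n = wn n y * (1 + zeta n ^+ 2) /\ cabs (zeta n) <= 1.
  near=> n; have [n0 xK] : good n by near: n.
  have [z0 z1 zE] := zr_spec (rn_itv n0); have r0 : 0 <= rn n by exact: expR_ge0.
  split; first exact: (zeta_eq r0 z0 zE (wr n y)).
  by apply: le_trans (zeta_le r0 z0 zE (wr n y)) _; exact: ltW.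
have hk : \forall n \near \oo, (1 - zeta n ^+ 2) * (1 - zeta n) * (1 - zeta n ^+ 3) * kv n = 1 + zeta n ^+ 2.
  near=> n; have [n0 xK] : good n by near: n.
  have [z0 z1 zE] := zr_spec (rn_itv n0); have r0 : 0 <= rn n by exact: expR_ge0.
  exact: (kv_eq r0 z0 z1 zE (wr n y)).
have zl := lim_zeta (@nu_inv R) (@nu_gt0_near R) hw hz.
have nzl := lim_nu_zeta (@nu_inv R) (@nu_gt0_near R) hw hz vq v0.
have jl := lim_pow_zeta (@nu_inv R) (@nu_gt0_near R) hw hz vq v0 jn_lim.
have xl := lim_xK (@nu_inv R) (@nu_gt0_near R) hw hz vq v0 xn_lim hk.
have ab := Aarg_bound (vhyp_ge1 y); rewrite -/v in ab.
have A00' := ltW A00.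
have ml : ccvg \oo m (Aval c (a%:C / v ^+ 3)).
  apply: (m_limit A00' A0k _ _ _ zl xl).
  - near=> n; have [n0 xK] : good n by near: n.
    have [z0 z1 zE] := zr_spec (rn_itv n0).
    exact: (m_le (expR_ge0 _) z0 z1 zE A00' xK (wr n y)).
  - by near=> n; have [] : 2 * zeta n = wn n y * (1 + zeta n ^+ 2) /\ cabs (zeta n) <= 1 by near: n.
  - near=> n; have [n0 xK] : good n by near: n.
    have [z0 z1 zE] := zr_spec (rn_itv n0).
    exact: (m_eq (expR_ge0 _) z0 z1 zE A00' xK (wr n y)).
  - exact: (Aval_eq Ac A00' rho0 rhoA ab).
  - exact: (Aval_bound Ac A00' rho0 rhoA ab).
  - rewrite cabsM cabsV cabs_nat ler_pdivrMr // [beta A0 * _]mulrC; exact: ab.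
pose B := Bval v.
have zj i : ccvg \oo (fun n => 1 + m n * (zeta n ^+ i * zeta n ^+ jn n)) (1 + B).
  have -> : 1 + B = 1 + Aval c (a%:C / v ^+ 3) * (1 ^+ i * cexp (- (2 * lam)%:C * v)).
    by rewrite expr1n mul1r.
  apply: ccvgD; first exact: ccvg_cst.
  by apply: ccvgM => //; apply: ccvgM => //; exact: ccvgX.
have B1 : 1 + B != 0.
  have A1 : A0 < 1 by have := A00; have := A01; nra.
  rewrite -cabs_gt0; have := cabs_sub_le 1 (- B); rewrite opprK cabs1 cabsN; apply: lt_le_trans.
  rewrite subr_gt0 (le_lt_trans _ A1) // cabsM.
  apply: le_trans (Aval_bound Ac A00' rho0 rhoA ab).
  rewrite ler_piMr ?cabs_ge0 // cabs_cexp -expR0 ler_expR -rmorphN ReCM mulNr oppr_le0.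
  by rewrite !mulr_ge0 // ltW.
(* In the numerator [(nu (1 - zeta))^2 (1 + zeta + zeta^2)] tends to [3 (2 v)^2 = 12 q]. *)
have Dl : ccvg \oo (fun n => (nu n ^+ 2)%:C * Dn n y) (12 * q * (B / (1 + B) ^+ 2)).
  have H : ccvg \oo (fun n => m n * zeta n ^+ jn n * ((nu n)%:C * (1 - zeta n)) ^+ 2 *
      (1 + zeta n + zeta n ^+ 2) / ((1 + m n * (zeta n ^+ 1 * zeta n ^+ jn n)) *
        (1 + m n * (zeta n ^+ 3 * zeta n ^+ jn n))))
     (B * (2 * v) ^+ 2 * (1 + 1 + 1 ^+ 2) / ((1 + B) * (1 + B))).
    apply: ccvgM; last by apply: ccvgV; [exact: mulf_neq0|exact: ccvgM].
    apply: ccvgM; first by apply: ccvgM; [exact: ccvgM|exact: ccvgX].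
    by apply: ccvgD; [apply: ccvgD => //; exact: ccvg_cst|exact: ccvgX].
  have -> : 12 * q * (B / (1 + B) ^+ 2) = B * (2 * v) ^+ 2 * (1 + 1 + 1 ^+ 2) / ((1 + B) * (1 + B)).
    by rewrite /q -vq expr2; move: (_^-1) => I; ring.
  apply: near_ccvg H; near=> n; have [n0 xK] : good n by near: n.
  have [z0 z1 zE] := zr_spec (rn_itv n0).
  have E := @D_eq _ _ _ _ _ (expR_ge0 _) z0 z1 zE A00' xK A01 (wn n y) (jn n) (wr n y).
  have [n1 n3] := @D_value _ _ _ _ _ (expR_ge0 _) z0 z1 zE A00' xK A01 (wn n y) (jn n) (wr n y).
  rewrite -/(zeta n) -/(m n) -/(Dn n y) in E n1 n3.
  rewrite -!exprD !add1n !add3n.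
  have p0 : (1 + m n * zeta n ^+ (jn n).+1) * (1 + m n * zeta n ^+ (jn n).+3) != 0 by exact: mulf_neq0.
  apply: (mulIf p0); rewrite mulfVK // [in RHS]mulrC.
  transitivity ((nu n ^+ 2)%:C * (m n * zeta n ^+ jn n * (1 - zeta n) * (1 - zeta n ^+ 3))).
    have -> : (nu n ^+ 2)%:C = (nu n)%:C ^+ 2 by rewrite rmorphXn.
    exact: D_numerator.
  by rewrite -E mulrCA.
have Wl : ccvg \oo (fun n => ((1 + wn n y) ^+ 2 / (4 * wn n y)) ^+ n) (cexp (q ^+ 2)).
  by apply: near_ccvg (W_lim q); near=> n; rewrite wE.
by have [] := ccvgM (ccvgM Wl hw) Dl.
Unshelve. all: by end_near. Qed.

Lemma laplace_lim : leb.-integrable `[0, +oo[ (EFin \o (fun y => Re (Hlim y))) /\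
  unif_expect n (fun t => expR (a * Ylam lam n t)) @[n --> \oo] -->
  1 + 2 / Num.sqrt (pi : R) * Rintegral leb `[0, +oo[ (fun y => Re (Hlim y)).
Proof.
have [N gN] := good_near.
pose C := expR (expR 2) * (24 / (1 - A0) ^+ 2) * expR (81 / 4).
have hb n y : (N <= n)%N -> 0 <= y <= pi / alp n -> `|hn n y| <= C * expR (- y).
  move=> nN yb; rewrite (le_trans (hn_bound (gN _ nN) yb)) // /C -[leRHS]mulrA ler_wpM2l //.
    by rewrite mulr_ge0 ?expR_ge0 // divr_ge0 // sqr_ge0.
  by have /andP[y0 _] := yb; exact: gauss_dom.
have [iH L] := @dct_halfline R hn (fun n => pi / alp n) (fun y => Re (Hlim y)) C N
  (fun n nN => (expectE (gN n nN)).1) (@arc_cvgy R) (fun y _ => @hn_lim y) hb.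
split=> //.
have s0 : 0 < Num.sqrt (pi : R) by rewrite sqrtr_gt0 pi_gt0.
have -> : 2 / Num.sqrt (pi : R) = 1 * Num.sqrt pi * (2 / pi).
  have s2 : Num.sqrt (pi : R) ^+ 2 = pi by rewrite sqr_sqrtr // pi_ge0.
  by rewrite -{3}s2; move: (Num.sqrt _) s0 => t t0; field; rewrite gt_eqF.
have L1 : n.+1%:R / n%:R @[n --> \oo] --> (1 : R).
  have H : 1 + (n%:R)^-1 @[n --> \oo] --> (1 + 0 : R).
    apply: cvgD; first exact: cvg_cst.
    by apply/gtr0_cvgV0; [near=> n; rewrite ltr0n; near: n; exact: nbhs_infty_gt|exact: cvgr_idn].
  rewrite addr0 in H; apply: cvg_trans H; apply: near_eq_cvg; near=> n.
  have n0 : n%:R != 0 :> R by rewrite pnatr_eq0 -lt0n; near: n; exact: nbhs_infty_gt.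
  by rewrite -natr1 mulrDl mulfV // mul1r.
have L2 : 4 ^+ n / ('C(n.*2, n)%:R * nu n ^+ 2) @[n --> \oo] --> Num.sqrt (pi : R).
  have H : ('C(n.*2, n)%:R / 4 ^+ n * nu n ^+ 2)^-1 @[n --> \oo] --> (Num.sqrt (pi : R))^-1^-1.
    by apply: cvgV (@central_binomial_lim R); rewrite invr_eq0 gt_eqF.
  rewrite invrK in H; apply: cvg_trans H; apply: near_eq_cvg; near=> n.
  by rewrite [(_ / _ * _)^-1]invfM invf_div -mulrA -invfM.
have L3 : 1 + n.+1%:R / n%:R * (4 ^+ n / ('C(n.*2, n)%:R * nu n ^+ 2)) * (2 / pi) *
    Rintegral leb `[0, pi / alp n] (hn n) @[n --> \oo] -->
  1 + 1 * Num.sqrt pi * (2 / pi) * Rintegral leb `[0, +oo[ (fun y => Re (Hlim y)).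
  apply: cvgD; first exact: cvg_cst.
  by apply: cvgM => //; apply: cvgM; [exact: cvgM|exact: cvg_cst].
apply: cvg_trans L3; apply: near_eq_cvg; near=> n.
have gn : good n by apply: gN; near: n; exact: nbhs_infty_ge.
by have [_ ->] := expectE gn.
Unshelve. all: by end_near. Qed.

End LaplaceLimit.

(** * Contour deformation *)

Section ComplexDerivative.
Variable R : realType.
Implicit Types (f g : R -> R[i]) (t : R) (d : R[i]).

(** Derivative of a curve in the complex plane. Functions of a complex variable are only
    differentiated along curves. *)
Definition cderiv f t d := ccvg (0 : R)^' (fun h : R => (h^-1)%:C * (f (h + t) - f t)) d.

Lemma cderiv_is_derive f t d : cderiv f t d ->
  is_derive t (1 : R) (fun t => Re (f t)) (Re d) /\ is_derive t (1 : R) (fun t => Im (f t)) (Im d).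
Proof.
have K (u : R -> R) (l : R) : (h^-1 * (u (h + t) - u t) @[h --> (0 : R)^'] --> l) ->
    is_derive t (1 : R) u l.
  move=> H; have H' : h^-1 *: (u (h *: (1 : R) + t) - u t) @[h --> (0 : R)^'] --> l.
    by under eq_fun do rewrite -[_ *: 1]/(_ * 1) mulr1.
  by apply: DeriveDef; [apply/cvg_ex; exists l|exact: cvg_lim].
move=> [H1 H2]; split; apply: K.
  by under eq_fun do rewrite -ReB -ReCM.
by under eq_fun do rewrite -ImB -ImCM.
Qed.

Lemma cderiv_continuous f t d : cderiv f t d -> ccvg (0 : R)^' (fun h : R => f (h + t)) (f t).
Proof.
move=> H.
have H1 : ccvg (0 : R)^' (fun h : R => h%:C * ((h^-1)%:C * (f (h + t) - f t)) + f t) (0 * d + f t).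
  apply: ccvgD; last exact: ccvg_cst.
  apply: ccvgM => //; apply: ccvg_real; apply: cvg_within.
rewrite mul0r add0r in H1; apply: near_ccvg H1; near=> h.
have h0 : h != 0 by near: h; exact: nbhs_dnbhs_neq.
by rewrite mulrA -rmorphM mulfV // rmorph1 mul1r subrK.
Unshelve. all: by end_near. Qed.

Lemma cderiv_eq f t d d' : d = d' -> cderiv f t d -> cderiv f t d'. Proof. by move=> ->. Qed.

Lemma cderiv_cst k t : cderiv (fun=> k) t 0.
Proof. by rewrite /cderiv; under eq_fun do rewrite subrr mulr0; exact: ccvg_cst. Qed.

Lemma cderivD f g t d d' : cderiv f t d -> cderiv g t d' -> cderiv (fun t => f t + g t) t (d + d').
Proof.
move=> H1 H2; apply: near_ccvg (ccvgD H1 H2); near=> h; ring.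
Unshelve. all: by end_near. Qed.

Lemma cderivM f g t d d' : cderiv f t d -> cderiv g t d' ->
  cderiv (fun t => f t * g t) t (d * g t + f t * d').
Proof.
move=> H1 H2; have H : ccvg (0 : R)^' (fun h : R => (h^-1)%:C * (f (h + t) - f t) * g (h + t) +
    f t * ((h^-1)%:C * (g (h + t) - g t))) (d * g t + f t * d').
  apply: ccvgD; first by apply: ccvgM => //; exact: cderiv_continuous H2.
  by apply: ccvgM => //; exact: ccvg_cst.
apply: near_ccvg H; near=> h; ring.
Unshelve. all: by end_near. Qed.

Lemma cderivZ k f t d : cderiv f t d -> cderiv (fun t => k * f t) t (k * d).
Proof.
move=> H; apply: cderiv_eq (cderivM (cderiv_cst k t) H); by rewrite mul0r add0r.
Qed.

Lemma cderivX f t d n : cderiv f t d -> cderiv (fun t => f t ^+ n.+1) t (n.+1%:R * f t ^+ n * d).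
Proof.
move=> H; elim: n => [|n IH].
  by apply: cderiv_eq H; rewrite expr0 mulr1 mul1r.
have -> : (fun t => f t ^+ n.+2) = (fun t => f t * f t ^+ n.+1) by apply/funext => u; rewrite exprS.
apply: cderiv_eq (cderivM H IH); rewrite exprS -[in RHS]natr1; ring.
Qed.

Lemma cderivV f t d : f t != 0 -> cderiv f t d ->
  cderiv (fun t => (f t)^-1) t (- d / f t ^+ 2).
Proof.
move=> f0 H; have C := cderiv_continuous H.
have H1 : ccvg (0 : R)^' (fun h : R => - ((h^-1)%:C * (f (h + t) - f t)) / (f (h + t) * f t))
    (- d / (f t * f t)).
  apply: ccvgM; first exact: ccvgN.
  by apply: ccvgV; [exact: mulf_neq0|apply: ccvgM => //; exact: ccvg_cst].
rewrite -expr2 in H1; apply: near_ccvg H1; near=> h.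
have fh : f (h + t) != 0.
  rewrite -cabs_eq0; apply: lt0r_neq0; near: h.
  by apply: (cvgr_gt _ (cvg_cabs C)); rewrite cabs_gt0.
have -> : (f (h + t))^-1 - (f t)^-1 = - (f (h + t) - f t) / (f (h + t) * f t).
  by have := fh; have := f0; move: (f (h + t)) (f t) => x y y0 x0; field; rewrite x0 y0.
by rewrite mulrA mulrN.
Unshelve. all: by end_near. Qed.

Lemma cderiv_cexp f t d : cderiv f t d -> cderiv (fun t => cexp (f t)) t (cexp (f t) * d).
Proof.
move=> H; have C := cderiv_continuous H.
have L0 : ccvg (0 : R)^' (fun h : R => f (h + t) - f t) 0.
  by rewrite -(subrr (f t)); apply: ccvgB => //; exact: ccvg_cst.
have L1 : ccvg (0 : R)^' (fun h : R => (h^-1)%:C * (cexp (f (h + t) - f t) - 1 - (f (h + t) - f t))) 0.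
  apply: (@ccvg_squeeze _ _ _ _ _ (fun h : R => 8 * cabs ((h^-1)%:C * (f (h + t) - f t)) *
      cabs (f (h + t) - f t))); last first.
    rewrite -[X in _ --> X](_ : 8 * cabs d * cabs (0 : R[i]) = 0); last by rewrite cabs0 mulr0.
    apply: cvgM; last exact: cvg_cabs.
    by apply: cvgM; [exact: cvg_cst|exact: cvg_cabs].
  have L2 : cabs (f (h + t) - f t) @[h --> (0 : R)^'] --> cabs (0 : R[i]) by exact: cvg_cabs.
  rewrite cabs0 in L2.
  near=> h; rewrite subr0 !cabsM.
  have s1 : cabs (f (h + t) - f t) <= 1 by near: h; apply: (cvgr_le _ L2); rewrite ltr01.
  have := cexp_sub_quad s1; move: (cabs (h^-1)%:C) (cabs_ge0 (h^-1)%:C) => k k0 Q.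
  by rewrite mulrCA -mulrA ler_wpM2l // -mulrA -expr2.
have H1 : ccvg (0 : R)^' (fun h : R => cexp (f t) * ((h^-1)%:C * (cexp (f (h + t) - f t) - 1 - (f (h + t) - f t)) +
   (h^-1)%:C * (f (h + t) - f t))) (cexp (f t) * (0 + d)).
  by apply: ccvgM; [exact: ccvg_cst|exact: ccvgD].
rewrite add0r in H1; apply: near_ccvg H1; near=> h.
have -> : cexp (f (h + t)) = cexp (f t) * cexp (f (h + t) - f t) by rewrite -cexpD; congr cexp; ring.
ring.
Unshelve. all: by end_near. Qed.

Lemma cderiv_real (u : R -> R) t (l : R) : is_derive t (1 : R) u l -> cderiv (fun t => (u t)%:C) t l%:C.
Proof.
move=> [H1 H2]; have H : h^-1 * (u (h + t) - u t) @[h --> (0 : R)^'] --> l.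
  rewrite -H2; move: H1 => /cvg_ex[l' Hl]; rewrite /derive (cvg_lim _ Hl) //.
  by move: Hl; under eq_fun do rewrite -[_ *: (1 : R)]/(_ * 1) mulr1.
have H3 : ccvg (0 : R)^' (fun h => (h^-1 * (u (h + t) - u t))%:C) l%:C by exact: ccvg_real.
apply: near_ccvg H3; near=> h.
by rewrite rmorphM rmorphB.
Unshelve. all: by end_near. Qed.

End ComplexDerivative.

(** * Comparison of two path integrals by a homotopy *)

Section Homotopy.
Variable R : realType.
Local Notation leb := (@lebesgue_measure R).

Definition ccont (f : R -> R[i]) := forall t : R, ccvg (nbhs t) f (f t).

Lemma ccont_Im f : ccont f -> continuous (fun t => Im (f t)).
Proof. by move=> cf t; have [] := cf t. Qed.
Lemma ccont_cst k : ccont (fun=> k). Proof. by move=> t; exact: ccvg_cst. Qed.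
Lemma ccontD f g : ccont f -> ccont g -> ccont (fun t => f t + g t).
Proof. by move=> cf cg t; exact: ccvgD. Qed.
Lemma ccontB f g : ccont f -> ccont g -> ccont (fun t => f t - g t).
Proof. by move=> cf cg t; exact: ccvgB. Qed.
Lemma ccontM f g : ccont f -> ccont g -> ccont (fun t => f t * g t).
Proof. by move=> cf cg t; exact: ccvgM. Qed.
Lemma ccont_real (u : R -> R) : continuous u -> ccont (fun t => (u t)%:C).
Proof. by move=> cu t; apply: ccvg_real; exact: cu. Qed.

Lemma cabs_itv_bound (f : R -> R[i]) (Y : R) : 0 <= Y -> ccont f ->
  exists M, forall y, 0 <= y <= Y -> cabs (f y) <= M.
Proof.
move=> Y0 cf; have c : continuous (fun y => cabs (f y)) by move=> t; apply: cvg_cabs; exact: cf.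
have [k _ H] := EVT_max Y0 (continuous_subspaceT c).
by exists (cabs (f k)) => y yY; apply: H; rewrite in_itv.
Qed.

Lemma convex_Re (v w : R[i]) (s : R) : 0 <= s <= 1 -> 1 <= Re v -> 1 <= Re w ->
  1 <= Re (v + s%:C * (w - v)).
Proof.
move=> /andP[s0 s1] v1 w1; rewrite ReD ReCM ReB.
by move: (Re v) (Re w) v1 w1 => x y; nra.
Qed.

Variables F dF : R[i] -> R[i].
Hypothesis F_deriv : forall (g : R -> R[i]) t d, (forall u, 1 <= Re (g u)) ->
  cderiv g t d -> cderiv (fun u => F (g u)) t (dF (g t) * d).
Hypothesis F_cont : forall g : R -> R[i], (forall u, 1 <= Re (g u)) ->
  ccont g -> ccont (fun u => F (g u)).
Hypothesis dF_cont : forall g : R -> R[i], (forall u, 1 <= Re (g u)) ->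
  ccont g -> ccont (fun u => dF (g u)).
Hypothesis F_bd : forall M : R, exists C, forall v, 1 <= Re v -> cabs v <= M ->
  cabs (F v) <= C /\ cabs (dF v) <= C.

Variables c0 c1 g0 g1 : R -> R[i].
Hypotheses (c0R : forall y, 1 <= Re (c0 y)) (c1R : forall y, 1 <= Re (c1 y)).
Hypotheses (c0c : ccont c0) (c1c : ccont c1) (g0c : ccont g0) (g1c : ccont g1).
Hypotheses (c0d : forall y : R, 0 < y -> cderiv c0 y (g0 y)) (c1d : forall y : R, 0 < y -> cderiv c1 y (g1 y)).
Hypothesis c01 : c0 0 = c1 0.

(* The squared sine keeps the whole one-parameter family of paths, for all real [s], in the half plane. *)
Let sg (s : R) : R := sin s ^+ 2.
Let dsg (s : R) : R := 2 * sin s * cos s.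
Let v s y := c0 y + (sg s)%:C * (c1 y - c0 y).
Let w s y := g0 y + (sg s)%:C * (g1 y - g0 y).
Let vs s y := (dsg s)%:C * (c1 y - c0 y).
Let ws s y := (dsg s)%:C * (g1 y - g0 y).
(** The common value of the [s]-derivative of [F(v) dv/dy] and the [y]-derivative of [F(v) dv/ds].
    This symmetry stands for Cauchy's theorem. *)
Let K s y := dF (v s y) * vs s y * w s y + F (v s y) * ws s y.

Let sg01 s : 0 <= sg s <= 1.
Proof. by rewrite sqr_ge0 /= -(cos2Dsin2 s) lerDr sqr_ge0. Qed.

Let dsg1 s : `|dsg s| <= 1.
Proof.
have := cos2Dsin2 s; have := sqr_ge0 (sin s - cos s); have := sqr_ge0 (sin s + cos s).
by rewrite /dsg ler_norml; move: (sin s) (cos s) => x y h1 h2 h3; nra.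
Qed.

Let vR s y : 1 <= Re (v s y). Proof. exact: convex_Re. Qed.

Let dsgE s : is_derive s (1 : R) sg (dsg s).
Proof.
have H : is_derive s (1 : R) (fun s => sin s * sin s) (sin s *: cos s + sin s *: cos s) by exact: is_deriveM.
have -> : sg = (fun s => sin s * sin s) by apply/funext => x; rewrite /sg expr2.
by apply: is_derive_eq; rewrite /dsg /GRing.scale /=; ring.
Qed.

Let vdS y s : cderiv (v^~ y) s (vs s y).
Proof.
apply: cderiv_eq (cderivD (cderiv_cst (c0 y) s) (cderivM (cderiv_real (dsgE s)) (cderiv_cst (c1 y - c0 y) s))).
by rewrite mulr0 addr0 add0r.
Qed.

Let wdS y s : cderiv (w^~ y) s (ws s y).
Proof.
apply: cderiv_eq (cderivD (cderiv_cst (g0 y) s) (cderivM (cderiv_real (dsgE s)) (cderiv_cst (g1 y - g0 y) s))).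
by rewrite mulr0 addr0 add0r.
Qed.

Let dcd y : 0 < y -> cderiv (fun y => c1 y - c0 y) y (g1 y - g0 y).
Proof.
move=> y0; have -> : (fun y => c1 y - c0 y) = (fun y => c1 y + -1 * c0 y).
  by apply/funext => t; rewrite mulN1r.
by apply: cderiv_eq (cderivD (c1d y0) (cderivZ (-1) (c0d y0))); rewrite mulN1r.
Qed.

Let vdY s y : 0 < y -> cderiv (v s) y (w s y).
Proof. by move=> y0; exact: cderivD (c0d y0) (cderivZ _ (dcd y0)). Qed.

Let vsdY s y : 0 < y -> cderiv (vs s) y (ws s y).
Proof. by move=> y0; exact: cderivZ _ (dcd y0). Qed.

Let fdS y s : cderiv (fun s => F (v s y) * w s y) s (K s y).
Proof.
exact: cderivM (F_deriv (fun s => vR s y) (vdS y s)) (wdS y s).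
Qed.

Let fdY s y : 0 < y -> cderiv (fun y => F (v s y) * vs s y) y (K s y).
Proof.
move=> y0; apply: cderiv_eq (cderivM (F_deriv (vR s) (vdY s y0)) (vsdY s y0)).
by rewrite /K; congr (_ + _); rewrite mulrAC.
Qed.

Let vc s : ccont (v s).
Proof. by apply: ccontD => //; apply: ccontM; [exact: ccont_cst|exact: ccontB]. Qed.
Let wc s : ccont (w s).
Proof. by apply: ccontD => //; apply: ccontM; [exact: ccont_cst|exact: ccontB]. Qed.
Let vsc s : ccont (vs s).
Proof. by apply: ccontM; [exact: ccont_cst|exact: ccontB]. Qed.
Let wsc s : ccont (ws s).
Proof. by apply: ccontM; [exact: ccont_cst|exact: ccontB]. Qed.
Let fc s : ccont (fun y => F (v s y) * w s y).
Proof. by apply: ccontM => //; apply: F_cont => //; exact: vR. Qed.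
Let Kc s : ccont (K s).
Proof.
apply: ccontD; last by apply: ccontM => //; apply: F_cont => //; exact: vR.
by apply: ccontM => //; apply: ccontM => //; apply: dF_cont => //; exact: vR.
Qed.

Let f s y := Im (F (v s y) * w s y).
Let Phi (Y s : R) := Rintegral leb `[0, Y] (f s).

Let K_bd (Y : R) : 0 <= Y -> exists C, forall s y, 0 <= y <= Y -> cabs (K s y) <= C.
Proof.
move=> Y0; have [M0 H0] := cabs_itv_bound Y0 c0c; have [M1 H1] := cabs_itv_bound Y0 c1c.
have [N0 H2] := cabs_itv_bound Y0 g0c; have [N1 H3] := cabs_itv_bound Y0 g1c.
have [C HC] := F_bd (M0 + (M1 + M0)).
exists (C * (M1 + M0) * (N0 + (N1 + N0)) + C * (N1 + N0)) => s y yY.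
have /andP[sa sb] := sg01 s.
have D1 : cabs (c1 y - c0 y) <= M1 + M0 by rewrite (le_trans (cabs_le_sub _ _)) // lerD ?H1 ?H0.
have D2 : cabs (g1 y - g0 y) <= N1 + N0 by rewrite (le_trans (cabs_le_sub _ _)) // lerD ?H3 ?H2.
have E (k m : R) z : `|k| <= 1 -> cabs z <= m -> cabs (k%:C * z) <= m.
  move=> k1 zm; rewrite cabsM cabs_real (le_trans _ zm) // ler_piMl ?cabs_ge0 //.
have s1 : `|sg s| <= 1 by rewrite ger0_norm.
have B1 : cabs (v s y) <= M0 + (M1 + M0).
  by rewrite (le_trans (cabsD _ _)) // lerD ?H0 // E.
have B2 : cabs (w s y) <= N0 + (N1 + N0).
  by rewrite (le_trans (cabsD _ _)) // lerD ?H2 // E.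
have [B3 B4] := HC _ (vR s y) B1.
have B5 : cabs (vs s y) <= M1 + M0 by exact: E.
have B6 : cabs (ws s y) <= N1 + N0 by exact: E.
have P (z z' : R[i]) m m' : cabs z <= m -> cabs z' <= m' -> cabs (z * z') <= m * m'.
  by move=> h h'; rewrite cabsM ler_pM ?cabs_ge0.
by rewrite (le_trans (cabsD _ _)) // lerD // P // P.
Qed.

(** Differentiation under the integral produces [K], which integrates in [y] to [F(v) dv/ds]. The
    term at 0 vanishes because the two paths start at the same point, so only the far end
    contributes. *)
Let Phi_deriv (Y s : R) : 0 < Y -> is_derive s (1 : R) (Phi Y) (Im (F (v s Y) * vs s Y)).
Proof.
move=> Y0; have [C HC] := K_bd (ltW Y0).
have fd x y : is_derive x (1 : R) (f^~ y) (Im (K x y)) by have [] := cderiv_is_derive (fdS y x).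
have p1 x y : partial1of2 f x y = Im (K x y) by rewrite partial1of2E; have [] := fd x y.
have mB : measurable (`[0, Y]%classic : set R) by exact: measurable_itv.
have Is : (`]s - 1, s + 1[%classic : set R) s by rewrite /= in_itv /=; apply/andP; split; lra.
have intC (u : R -> R) : continuous u -> leb.-integrable `[0, Y] (EFin \o u).
  move=> cu; apply: continuous_compact_integrable; first exact: segment_compact.
  exact: continuous_subspaceT.
have L := @cvg_differentiation_under_integral R _ _ leb f `[0, Y]%classic mB s (s - 1) (s + 1) Is
  (fun x _ => intC _ (ccont_Im (fc x)))
  (fun x y _ _ => @ex_derive _ _ _ _ _ _ _ (fd x y)) (fun=> C).
have C0 : 0 <= C.
  by apply: le_trans (HC s 0 _); rewrite ?cabs_ge0 // lexx ltW.
have {}L := L (fun=> C0) (intC _ (fun x => @cst_continuous _ _ C x)).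
have Cb x y : (`[0, Y]%classic : set R) y -> `|partial1of2 f x y| <= C.
  by rewrite /= in_itv /= => yY; rewrite p1 (le_trans (Im_le_cabs _)) // HC.
have {}L := L (fun x y _ yB => Cb x y yB).
have E : Rintegral leb `[0, Y] (fun y => partial1of2 f s y) = Im (F (v s Y) * vs s Y).
  under eq_Rintegral do rewrite p1.
  rewrite /Rintegral (@continuous_FTC2 _ _ (fun y => Im (F (v s y) * vs s y))) //=.
  - by rewrite /vs c01 subrr !mulr0 /= subr0.
  - by apply: continuous_subspaceT; exact: ccont_Im.
  - have cc : ccont (fun y => F (v s y) * vs s y) by apply: ccontM => //; apply: F_cont => //; exact: vR.
    split; [|apply: cvg_at_right_filter; exact: ccont_Im|apply: cvg_at_left_filter; exact: ccont_Im].
    move=> x /itvP xY; have x0 : 0 < x by rewrite xY.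
    by have [_ []] := cderiv_is_derive (fdY s x0).
  - move=> x /itvP xY; have x0 : 0 < x by rewrite xY.
    rewrite derive1E.
    by have [_ []] := cderiv_is_derive (fdY s x0).
rewrite E in L.
have L' : h^-1 *: (Phi Y (h *: (1 : R) + s) - Phi Y s) @[h --> (0 : R)^'] --> Im (F (v s Y) * vs s Y).
  by under eq_fun do rewrite -[_ *: 1]/(_ * 1) mulr1.
by apply: DeriveDef; [apply/cvg_ex; exists (Im (F (v s Y) * vs s Y))|exact: cvg_lim].
Qed.

(** The mean value bound in [s] from 0 to [pi / 2], where the squared sine goes from 0 to 1; the
    hypothesis on the segment joining the two far ends controls the derivative. *)
Lemma path_integral_diff (Y M : R) : 0 < Y ->
  (forall s, 0 <= s <= 1 -> cabs (F (c0 Y + s%:C * (c1 Y - c0 Y))) * cabs (c1 Y - c0 Y) <= M) ->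
  `|Rintegral leb `[0, Y] (fun y => Im (F (c1 y) * g1 y)) -
    Rintegral leb `[0, Y] (fun y => Im (F (c0 y) * g0 y))| <= M * pi.
Proof.
move=> Y0 HM; have M0 : 0 <= M by apply: le_trans (HM 0 _); rewrite ?mulr_ge0 ?cabs_ge0 // lexx ler01.
have H := mvt_bound (x := pi / 2) (M := M) (fun s => Phi_deriv s Y0).
have s0 : sg 0 = 0 by rewrite /sg sin0 expr0n.
have s1 : sg (pi / 2) = 1 by rewrite /sg sin_pihalf expr1n.
have E0 : Phi Y 0 = Rintegral leb `[0, Y] (fun y => Im (F (c0 y) * g0 y)).
  by apply: eq_Rintegral => y _; rewrite /f /v /w s0 !mul0r !addr0.
have E1 : Phi Y (pi / 2) = Rintegral leb `[0, Y] (fun y => Im (F (c1 y) * g1 y)).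
  by apply: eq_Rintegral => y _; rewrite /f /v /w s1 !mul1r ![_ + (_ - _)]addrC !subrK.
rewrite -E0 -E1; apply: le_trans (H _) _; last first.
  by rewrite ler_wpM2l // ger0_norm ?divr_ge0 ?pi_ge0 // ler_pdivrMr //; have := pi_ge0 R; lra.
move=> t _; apply: le_trans (Im_le_cabs _) _; rewrite cabsM; apply: le_trans (HM _ (sg01 t)).
rewrite ler_wpM2l ?cabs_ge0 // cabsM cabs_real ler_piMl ?cabs_ge0 //.
Qed.

End Homotopy.

Lemma ccvg_Qdiff (R : realType) T (F : set_system T) {FF : Filter F} (f g y : T -> R[i]) lf lg ly :
  ccvg F f lf -> ccvg F g lg -> ccvg F y ly ->
  ccvg F (fun x => Qdiff (f x) (g x) (y x)) (Qdiff lf lg ly).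
Proof.
move=> Hf Hg Hy; rewrite /Qdiff; have c1 := @ccvg_cst R T F FF 1.
have f1 : ccvg F (fun x => 1 + f x) (1 + lf) by exact: ccvgD.
have g1 : ccvg F (fun x => 1 + g x) (1 + lg) by exact: ccvgD.
apply: ccvgB; first by apply: ccvgB => //; exact: ccvgD.
apply: ccvgM => //; apply: ccvgD; last exact: ccvgX.
by apply: ccvgD; [exact: ccvgX|exact: ccvgM].
Qed.

(** * Regularity of the integrand on the half plane [Re v >= 1] *)

Section Integrand.
Variables (R : realType) (c : nat -> R) (lam a A0 : R).
Hypotheses (Ac : is_A_coef c) (lam0 : 0 <= lam).
Hypotheses (A00 : 0 < A0) (A0k : 0 < 1 - 4 * A0 + A0 ^+ 2) (A01 : 2 * A0 + A0 ^+ 2 < 1).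
Hypothesis (aA : `|a| / 24 < beta A0).
Local Notation Bval := (Bval c lam a).

Let rho : R := 24 * beta A0.
Let rho0 : 0 <= rho.
Proof. by rewrite mulr_ge0 // (le_trans _ (ltW aA)) // divr_ge0. Qed.
Let rhoA : A0 ^+ 2 + rho / 24 * (1 + A0) ^+ 3 <= A0.
Proof.
by rewrite (_ : rho / 24 = beta A0) ?beta_fix //; [exact: ltW|rewrite /rho; field].
Qed.
Let A01' : A0 < 1. Proof. have := A01; have := A00; nra. Qed.

Let Re_cabs (v : R[i]) : 1 <= Re v -> 1 <= cabs v.
Proof. by move=> v1; apply: le_trans (Re_le_cabs _); exact: le_trans (ler_norm _). Qed.
Let Re_neq0 (v : R[i]) : 1 <= Re v -> v != 0.
Proof. by move=> /Re_cabs v1; rewrite -cabs_gt0 (lt_le_trans _ v1). Qed.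

Definition Aof (v : R[i]) : R[i] := Aval c (a%:C / v ^+ 3).
Definition yof (v : R[i]) : R[i] := a%:C / v ^+ 3 / 24.

Lemma Aof_bound v : 1 <= Re v -> cabs (Aof v) <= A0.
Proof. by move=> /Re_cabs v1; apply: (Aval_bound Ac (ltW A00) rho0 rhoA); exact: (Aarg_bound aA). Qed.

Lemma yof_bound v : 1 <= Re v -> cabs (yof v) <= beta A0.
Proof.
move=> /Re_cabs v1; rewrite /yof cabsM cabsV cabs_nat ler_pdivrMr // [leRHS]mulrC; exact: (Aarg_bound aA v1).
Qed.

Lemma Aof_eq v : 1 <= Re v -> Aof v = Aof v ^+ 2 + yof v * (1 + Aof v) ^+ 3.
Proof. by move=> /Re_cabs v1; exact: (Aval_eq Ac (ltW A00) rho0 rhoA (Aarg_bound aA v1)). Qed.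

Definition Qof v w := Qdiff (Aof v) (Aof w) (yof v).

Lemma Qof_bound v w : 1 <= Re v -> 1 <= Re w -> kapQ A0 <= cabs (Qof v w).
Proof. by move=> v1 w1; apply: Qdiff_bound; rewrite ?(ltW A00) ?Aof_bound ?yof_bound. Qed.

Lemma Qof_neq0 v w : 1 <= Re v -> 1 <= Re w -> Qof v w != 0.
Proof.
by move=> v1 w1; rewrite -cabs_gt0 (lt_le_trans _ (Qof_bound v1 w1)) // kapQ_gt0 // ltW.
Qed.

(** An exact difference formula: continuity and differentiability of [Aof] along curves follow from
    those of the rational function [yof], without differentiating the power series. *)
Lemma Aof_diff v w : 1 <= Re v -> 1 <= Re w ->
  Aof v - Aof w = (yof v - yof w) * (1 + Aof w) ^+ 3 / Qof v w.
Proof.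
move=> v1 w1; apply: (@mulIf _ (Qof v w)); first exact: Qof_neq0.
rewrite divfK ?Qof_neq0 //.
rewrite /Qof (@Qdiff_eq _ _ _ _ 0 ((yof w - yof v) * (1 + Aof w) ^+ 3)).
- by rewrite sub0r -mulNr opprB.
- by rewrite addr0; exact: Aof_eq.
- by rewrite -addrA -mulrDl [_ + (_ - _)]addrC subrK; exact: Aof_eq.
Qed.

Lemma ccontX n (f : R -> R[i]) : ccont f -> ccont (fun t => f t ^+ n).
Proof. by move=> cf t; exact: ccvgX. Qed.
Lemma ccontV (f : R -> R[i]) : (forall t, f t != 0) -> ccont f -> ccont (fun t => (f t)^-1).
Proof. by move=> f0 cf t; exact: ccvgV. Qed.
Lemma ccont_cexp (f : R -> R[i]) : ccont f -> ccont (fun t => cexp (f t)).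
Proof. by move=> cf t; exact: ccvg_cexp. Qed.

Lemma ccvg_Aof (F : set_system R) {FF : Filter F} (g : R -> R[i]) l : (forall u, 1 <= Re (g u)) ->
  1 <= Re l -> ccvg F g l -> ccvg F (fun u => Aof (g u)) (Aof l).
Proof.
move=> g1 l1 gl.
have yl : ccvg F (fun u => yof (g u)) (yof l).
  apply: ccvgM; last exact: ccvg_cst.
  apply: ccvgM; first exact: ccvg_cst.
  by apply: ccvgV; [rewrite expf_neq0 // Re_neq0|exact: ccvgX].
have L : cabs (yof (g u) - yof l) * ((1 + A0) ^+ 3 / kapQ A0) @[u --> F] --> (0 : R).
  rewrite -[X in _ --> X](mul0r ((1 + A0) ^+ 3 / kapQ A0)).
  by apply: cvgM; [exact/ccvg_abs|exact: cvg_cst].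
apply: ccvg_squeeze L; near=> u.
have P (x y z : R[i]) : cabs (x * y / z) = cabs x * (cabs y / cabs z) by rewrite !cabsM cabsV mulrA.
rewrite Aof_diff // P cabsX ler_wpM2l ?cabs_ge0 //.
have k0 : 0 < kapQ A0 by rewrite kapQ_gt0 // ltW.
apply: ler_pM; rewrite ?exprn_ge0 ?invr_ge0 ?cabs_ge0 //.
  apply: lerXn2r; rewrite ?nnegrE ?cabs_ge0 ?addr_ge0 ?(ltW A00) //.
  by rewrite (le_trans (cabsD _ _)) // cabs1 lerD2l Aof_bound.
have Qb := Qof_bound (g1 u) l1; rewrite lef_pV2 // posrE //; exact: lt_le_trans Qb.
Unshelve. all: by end_near. Qed.

Definition dyof (v : R[i]) : R[i] := a%:C * (- (3 * v ^+ 2) / (v ^+ 3) ^+ 2) / 24.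
Definition dAof v := dyof v * (1 + Aof v) ^+ 3 / Qof v v.

Lemma cderiv_yof (g : R -> R[i]) t d : 1 <= Re (g t) ->
  cderiv g t d -> cderiv (fun u => yof (g u)) t (dyof (g t) * d).
Proof.
move=> g1 gd; have g0 : g t ^+ 3 != 0 by rewrite expf_neq0 // Re_neq0.
apply: cderiv_eq (cderivM (cderivZ a%:C (cderivV g0 (cderivX 2 gd))) (cderiv_cst (24^-1) t)).
rewrite mulr0 addr0 /dyof; move: (24^-1 : R[i]) ((g t ^+ 3 ^+ 2)^-1) (g t) => x y z; ring.
Qed.

Lemma cderiv_Aof (g : R -> R[i]) t d : (forall u, 1 <= Re (g u)) ->
  cderiv g t d -> cderiv (fun u => Aof (g u)) t (dAof (g t) * d).
Proof.
move=> g1 gd; have yd := cderiv_yof (g1 t) gd.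
have AL : ccvg (0 : R)^' (fun h => Aof (g (h + t))) (Aof (g t)).
  by apply: ccvg_Aof => //; exact: cderiv_continuous gd.
have yL := cderiv_continuous yd.
have H : ccvg (0 : R)^' (fun h => (h^-1)%:C * (yof (g (h + t)) - yof (g t)) * (1 + Aof (g t)) ^+ 3 /
    Qof (g (h + t)) (g t)) (dyof (g t) * d * (1 + Aof (g t)) ^+ 3 / Qof (g t) (g t)).
  apply: ccvgM; first by apply: ccvgM => //; exact: ccvg_cst.
  apply: ccvgV; first exact: Qof_neq0.
  exact: (ccvg_Qdiff AL (@ccvg_cst R R (0 : R)^' _ (Aof (g t))) yL).
have E : dyof (g t) * d * (1 + Aof (g t)) ^+ 3 / Qof (g t) (g t) = dAof (g t) * d.
  have G (x y z q : R[i]) : x * y * z * q = x * z * q * y by ring.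
  exact: G.
rewrite E in H; apply: near_ccvg H; near=> h.
by rewrite Aof_diff // !mulrA.
Unshelve. all: by end_near. Qed.

Local Notation cE v := (cexp (- (2 * lam)%:C * v)).

Lemma BvalE v : Bval v = Aof v * cE v. Proof. by []. Qed.

Lemma Bval_bound v : 1 <= Re v -> cabs (Bval v) <= A0.
Proof.
move=> v1; rewrite BvalE cabsM cabs_cexp; apply: le_trans (Aof_bound v1).
rewrite ler_piMr ?cabs_ge0 // -expR0 ler_expR -rmorphN ReCM mulNr oppr_le0 mulr_ge0 //.
  by rewrite mulr_ge0.
by rewrite (le_trans _ v1).
Qed.

Lemma Bval1 v : 1 <= Re v -> 1 - A0 <= cabs (1 + Bval v).
Proof.
move=> v1; have := cabs_sub_le 1 (- Bval v); rewrite cabs1 cabsN opprK; apply: le_trans.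
by rewrite lerD2l lerN2 Bval_bound.
Qed.

Lemma Bval1_neq0 v : 1 <= Re v -> (1 + Bval v) ^+ 2 != 0.
Proof.
by move=> v1; rewrite expf_neq0 // -cabs_gt0 (lt_le_trans _ (Bval1 v1)) // subr_gt0.
Qed.

Definition dBval v := dAof v * cE v + Aof v * (cE v * - (2 * lam)%:C).

Definition Fint (v : R[i]) : R[i] := Bval v / (1 + Bval v) ^+ 2 * v ^+ 5 * cexp (v ^+ 4).

Definition dFrat v := dBval v / (1 + Bval v) ^+ 2 +
  Bval v * (- (2 * (1 + Bval v) ^+ 1 * dBval v) / (1 + Bval v) ^+ 2 ^+ 2).
Definition dFint (v : R[i]) : R[i] :=
  (dFrat v * v ^+ 5 + Bval v / (1 + Bval v) ^+ 2 * (5 * v ^+ 4)) * cexp (v ^+ 4) +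
  Bval v / (1 + Bval v) ^+ 2 * v ^+ 5 * (cexp (v ^+ 4) * (4 * v ^+ 3)).

Lemma cderiv_Bval (g : R -> R[i]) t d : (forall u, 1 <= Re (g u)) ->
  cderiv g t d -> cderiv (fun u => Bval (g u)) t (dBval (g t) * d).
Proof.
move=> g1 gd; have H := cderivM (cderiv_Aof g1 gd) (cderiv_cexp (cderivZ (- (2 * lam)%:C) gd)).
apply: cderiv_eq H; rewrite /dBval.
have G (x y z q r : R[i]) : x * r * y + z * (y * (q * r)) = (x * y + z * (y * q)) * r by ring.
exact: G.
Qed.

Lemma cderiv_Fint (g : R -> R[i]) t d : (forall u, 1 <= Re (g u)) ->
  cderiv g t d -> cderiv (fun u => Fint (g u)) t (dFint (g t) * d).
Proof.
move=> g1 gd; have Bd := cderiv_Bval g1 gd.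
have H1 := cderivV (Bval1_neq0 (g1 t)) (cderivX 1 (cderivD (cderiv_cst 1 t) Bd)).
have H2 := cderivM (cderivM (cderivM Bd H1) (cderivX 4 gd)) (cderiv_cexp (cderivX 3 gd)).
apply: cderiv_eq H2; rewrite /dFint /dFrat.
have G (b db p e v5 v4 v3 r i q : R[i]) : ((db * r * i + b * (- (2 * p * (0 + db * r)) * q)) * v5 +
    b * i * (5 * v4 * r)) * e + b * i * v5 * (e * (4 * v3 * r)) =
  (((db * i + b * (- (2 * p * db) * q)) * v5 + b * i * (5 * v4)) * e + b * i * v5 * (e * (4 * v3))) * r.
  by ring.
exact: G.
Qed.

Lemma ccont_Bval (g : R -> R[i]) : (forall u, 1 <= Re (g u)) -> ccont g -> ccont (fun u => Bval (g u)).
Proof.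
move=> g1 gc; apply: ccontM; first by move=> t; apply: ccvg_Aof.
by apply: ccont_cexp; apply: ccontM => //; exact: ccont_cst.
Qed.

Lemma ccont_dAof (g : R -> R[i]) : (forall u, 1 <= Re (g u)) -> ccont g -> ccont (fun u => dAof (g u)).
Proof.
move=> g1 gc.
have cA : ccont (fun u => Aof (g u)) by move=> t; apply: ccvg_Aof.
have cy : ccont (fun u => yof (g u)).
  apply: ccontM; last exact: ccont_cst.
  apply: ccontM; first exact: ccont_cst.
  by apply: ccontV; [move=> t; rewrite expf_neq0 // Re_neq0|exact: ccontX].
have cdy : ccont (fun u => dyof (g u)).
  apply: ccontM; last exact: ccont_cst.
  apply: ccontM; first exact: ccont_cst.
  apply: ccontM.
    have -> : (fun t => - (3 * g t ^+ 2)) = (fun t => -3 * g t ^+ 2) by apply/funext => t; rewrite mulNr.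
    by apply: ccontM; [exact: ccont_cst|exact: ccontX].
  by apply: ccontV; [move=> t; rewrite !expf_neq0 // Re_neq0|do 2 apply: ccontX].
apply: ccontM.
  apply: ccontM => //; apply: ccontX; apply: ccontD => //; exact: ccont_cst.
apply: ccontV; first by move=> t; exact: Qof_neq0.
by move=> t; exact: (ccvg_Qdiff (cA t) (cA t) (cy t)).
Qed.

Lemma ccont_Fint (g : R -> R[i]) : (forall u, 1 <= Re (g u)) -> ccont g -> ccont (fun u => Fint (g u)).
Proof.
move=> g1 gc; have Bc := ccont_Bval g1 gc.
apply: ccontM; last by apply: ccont_cexp; exact: ccontX.
apply: ccontM; last exact: ccontX.
apply: ccontM => //; apply: ccontV; first by move=> t; exact: Bval1_neq0.
by apply: ccontX; apply: ccontD => //; exact: ccont_cst.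
Qed.

Lemma ccont_dFint (g : R -> R[i]) : (forall u, 1 <= Re (g u)) -> ccont g -> ccont (fun u => dFint (g u)).
Proof.
move=> g1 gc; have Bc := ccont_Bval g1 gc.
have cc k := ccont_cst (R := R) k.
have gX n : ccont (fun u => g u ^+ n) by exact: ccontX.
have eX : ccont (fun u => cexp (g u ^+ 4)) by exact: ccont_cexp.
have B1 : ccont (fun u => 1 + Bval (g u)) by exact: ccontD.
have B2 : ccont (fun u => ((1 + Bval (g u)) ^+ 2)^-1).
  by apply: ccontV; [move=> t; exact: Bval1_neq0|exact: ccontX].
have B4 : ccont (fun u => ((1 + Bval (g u)) ^+ 2 ^+ 2)^-1).
  by apply: ccontV; [move=> t; rewrite expf_neq0 // Bval1_neq0|do 2 apply: ccontX].
have cexpc : ccont (fun u => cE (g u)) by apply: ccont_cexp; exact: ccontM.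
have cA : ccont (fun u => Aof (g u)) by move=> t; apply: ccvg_Aof.
have dB : ccont (fun u => dBval (g u)).
  by apply: ccontD; [apply: ccontM => //; exact: ccont_dAof|apply: ccontM => //; exact: ccontM].
have dR : ccont (fun u => dFrat (g u)).
  apply: ccontD; first exact: ccontM.
  apply: ccontM => //; apply: ccontM => //.
  have -> : (fun t => - (2 * (1 + Bval (g t)) ^+ 1 * dBval (g t))) =
      (fun t => -2 * (1 + Bval (g t)) ^+ 1 * dBval (g t)).
    by apply/funext => t; rewrite !mulNr.
  by apply: ccontM => //; apply: ccontM => //; exact: ccontX.
apply: ccontD.
  apply: ccontM => //; apply: ccontD; first exact: ccontM.
  by apply: ccontM; exact: ccontM.
apply: ccontM; first by apply: ccontM => //; exact: ccontM.
by apply: ccontM => //; exact: ccontM.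
Qed.

End Integrand.

Section Bounded.
Variables (R : realType) (M : R).
Implicit Types f g : R[i] -> R[i].

Definition hbounded f := exists C, forall v, 1 <= Re v -> cabs v <= M -> cabs (f v) <= C.

Lemma hbounded_cst k : hbounded (fun=> k). Proof. by exists (cabs k). Qed.
Lemma hbounded_id : hbounded id. Proof. by exists M. Qed.
Lemma hboundedD f g : hbounded f -> hbounded g -> hbounded (fun v => f v + g v).
Proof.
move=> [C HC] [D HD]; exists (C + D) => v v1 vM.
by rewrite (le_trans (cabsD _ _)) // lerD ?HC ?HD.
Qed.
Lemma hboundedN f : hbounded f -> hbounded (fun v => - f v).
Proof. by move=> [C HC]; exists C => v v1 vM; rewrite cabsN HC. Qed.
Lemma hboundedM f g : hbounded f -> hbounded g -> hbounded (fun v => f v * g v).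
Proof.
move=> [C HC] [D HD]; exists (C * D) => v v1 vM.
by rewrite cabsM ler_pM ?cabs_ge0 ?HC ?HD.
Qed.
Lemma hboundedX f n : hbounded f -> hbounded (fun v => f v ^+ n).
Proof.
move=> [C HC]; exists (C ^+ n) => v v1 vM; rewrite cabsX.
by apply: lerXn2r; rewrite ?nnegrE ?cabs_ge0 ?HC // (le_trans (cabs_ge0 _) (HC v v1 vM)).
Qed.
Lemma hboundedV f k : 0 < k -> (forall v, 1 <= Re v -> k <= cabs (f v)) -> hbounded (fun v => (f v)^-1).
Proof.
move=> k0 kf; exists k^-1 => v v1 vM; rewrite cabsV lef_pV2 ?posrE ?kf //.
by rewrite (lt_le_trans k0) // kf.
Qed.
Lemma hbounded_cexp f : hbounded f -> hbounded (fun v => cexp (f v)).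
Proof.
move=> [C HC]; exists (expR C) => v v1 vM; rewrite cabs_cexp ler_expR.
by rewrite (le_trans (ler_norm _)) // (le_trans (Re_le_cabs _)) // HC.
Qed.
End Bounded.

Section IntegrandBounds.
Variables (R : realType) (c : nat -> R) (lam a A0 : R).
Hypotheses (Ac : is_A_coef c) (lam0 : 0 <= lam).
Hypotheses (A00 : 0 < A0) (A0k : 0 < 1 - 4 * A0 + A0 ^+ 2) (A01 : 2 * A0 + A0 ^+ 2 < 1).
Hypothesis (aA : `|a| / 24 < beta A0).
Local Notation Bval := (Bval c lam a).
Local Notation Fint := (Fint c lam a).
Local Notation dFint := (dFint c lam a).
Local Notation leb := (@lebesgue_measure R).

Let A01' : A0 < 1. Proof. have := A01; have := A00; nra. Qed.
Let KF : R := A0 / (1 - A0) ^+ 2.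
Let KF0 : 0 <= KF. Proof. by rewrite divr_ge0 ?exprn_ge0 ?subr_ge0 // ltW. Qed.

Lemma Fint_hbounded M : hbounded M Fint /\ hbounded M dFint.
Proof.
have hv n : hbounded M (fun v : R[i] => v ^+ n) by exact: (hboundedX n (@hbounded_id R M)).
have hc (k : R[i]) := @hbounded_cst R M k.
have k0 : 0 < kapQ A0 by rewrite kapQ_gt0 // ltW.
have hV n : hbounded M (fun v : R[i] => (v ^+ n)^-1).
  apply: (@hboundedV _ _ _ 1) => // v v1; rewrite cabsX exprn_ege1 //.
  by apply: le_trans (Re_le_cabs _); exact: le_trans (ler_norm _).
have hB : hbounded M Bval by exists A0 => v v1 _; exact: (Bval_bound Ac lam0 A00 aA).
have hA : hbounded M (Aof c a) by exists A0 => v v1 _; exact: (Aof_bound Ac A00 aA).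
have B1 v : 1 <= Re v -> 1 - A0 <= cabs (1 + Bval v) by exact: (Bval1 Ac lam0 A00 aA).
have d0 : 0 < 1 - A0 by rewrite subr_gt0.
have h2 : hbounded M (fun v => ((1 + Bval v) ^+ 2)^-1).
  apply: (@hboundedV _ _ _ ((1 - A0) ^+ 2)) => [|v v1]; first by rewrite exprn_gt0.
  by rewrite cabsX; apply: lerXn2r; rewrite ?nnegrE ?cabs_ge0 ?B1 // ltW.
have h4 : hbounded M (fun v => ((1 + Bval v) ^+ 2 ^+ 2)^-1).
  apply: (@hboundedV _ _ _ ((1 - A0) ^+ 2 ^+ 2)) => [|v v1]; first by rewrite !exprn_gt0.
  rewrite !cabsX; apply: lerXn2r; rewrite ?nnegrE ?exprn_ge0 ?cabs_ge0 ?(ltW d0) //.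
  by apply: lerXn2r; rewrite ?nnegrE ?cabs_ge0 ?B1 // ltW.
have hE : hbounded M (fun v => cexp (v ^+ 4)) by exact: hbounded_cexp.
have hE' : hbounded M (fun v => cexp (- (2 * lam)%:C * v)).
  by apply: hbounded_cexp; apply: hboundedM => //; exact: hbounded_id.
have hF : hbounded M (fun v => Bval v / (1 + Bval v) ^+ 2) by exact: hboundedM.
split; first by apply: hboundedM => //; exact: hboundedM.
have hA1 : hbounded M (fun v => 1 + Aof c a v) by exact: hboundedD.
have hdA : hbounded M (dAof c a).
  apply: hboundedM; last first.
    apply: (@hboundedV _ _ _ (kapQ A0)) => // v v1.
    exact: (Qof_bound Ac A00 aA).
  apply: hboundedM; last exact: hboundedX.
  apply: hboundedM => //; apply: hboundedM => //; apply: hboundedM.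
    by apply: hboundedN; exact: hboundedM.
  apply: (@hboundedV _ _ _ 1) => // v v1; rewrite !cabsX !exprn_ege1 //.
  by apply: le_trans (Re_le_cabs _); exact: le_trans (ler_norm _).
have hdB : hbounded M (dBval c lam a).
  by apply: hboundedD; [exact: hboundedM|apply: hboundedM => //; exact: hboundedM].
have h1B : hbounded M (fun v => (1 + Bval v) ^+ 1) by apply: hboundedX; exact: hboundedD.
have hdR : hbounded M (dFrat c lam a).
  apply: hboundedD; first exact: hboundedM.
  apply: hboundedM => //; apply: hboundedM => //; apply: hboundedN.
  by apply: hboundedM => //; exact: hboundedM.
apply: hboundedD.
  apply: hboundedM => //; apply: hboundedD; first exact: hboundedM.
  by apply: hboundedM => //; exact: hboundedM.
apply: hboundedM; first exact: hboundedM.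
by apply: hboundedM => //; exact: hboundedM.
Qed.

Lemma Frat_bound v : 1 <= Re v -> cabs (Bval v / (1 + Bval v) ^+ 2) <= KF.
Proof.
move=> v1; have b := Bval_bound Ac lam0 A00 aA v1; have b1 := Bval1 Ac lam0 A00 aA v1.
rewrite cabsM cabsV cabsX; apply: ler_pM; rewrite ?invr_ge0 ?exprn_ge0 ?cabs_ge0 //.
have d0 : 0 < 1 - A0 by rewrite subr_gt0.
rewrite lef_pV2 ?posrE ?exprn_gt0 //; last exact: lt_le_trans b1.
by apply: lerXn2r; rewrite ?nnegrE ?cabs_ge0 // ltW.
Qed.

(* Between the ray and the hyperbola, [e^{v^4}] beats every power of [v]. *)
Lemma Fint_decay v : 1 <= Re v -> 0 <= Im v -> Im v <= Re v <= 1 + Im v ->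
  cabs (Fint v) <= KF * (expR 18 * expR (- (2 * Im v))).
Proof.
move=> v1 h0 /andP[hX Xh]; rewrite /Fint cabsM cabsM -mulrA.
rewrite ler_pM ?mulr_ge0 ?cabs_ge0 ?Frat_bound // cabs_cexp cabsX.
have X0 : 0 <= Re v by rewrite (le_trans _ v1).
have va : cabs v <= expR (2 * Im v).
  apply: le_trans (expR_ge1Dx _); apply: le_trans (cabs_le_ReIm _) _.
  by rewrite !ger0_norm //; lra.
apply: (@le_trans _ _ (expR (2 * Im v) ^+ 5 * expR (Re (v ^+ 4)))).
  rewrite ler_wpM2r ?expR_ge0 //; apply: lerXn2r; rewrite ?nnegrE ?cabs_ge0 ?expR_ge0 //.
rewrite -expRM_natl -!expRD ler_expR.
have -> : Re (v ^+ 4) = (Re v ^+ 2 - Im v ^+ 2) ^+ 2 - 4 * (Re v * Im v) ^+ 2.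
  by rewrite !exprS expr0 mulr1 !(ReM, ImM); ring.
move: (Re v) (Im v) h0 hX Xh v1 X0 => X h h0 hX Xh v1 X0.
(* The exponent is at most [10 h + (1 + 2 h)^2 - 4 h^4]. With [4 h^4 >= 12 h^2 - 9] it is bounded by
   [18 - 2 h - 8 (h - 1)^2]. *)
have e1 : (X ^+ 2 - h ^+ 2) ^+ 2 <= (1 + 2 * h) ^+ 2.
  apply: lerXn2r; rewrite ?nnegrE; [nra|lra|nra].
have e2 : h ^+ 4 <= (X * h) ^+ 2.
  have -> : h ^+ 4 = (h * h) ^+ 2 by ring.
  by apply: lerXn2r; rewrite ?nnegrE; nra.
have e3 : 0 <= (2 * h ^+ 2 - 3) ^+ 2 by exact: sqr_ge0.
have e4 : 0 <= (h - 1) ^+ 2 by exact: sqr_ge0.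
have e5 : 4 * h ^+ 4 = (2 * h ^+ 2 - 3) ^+ 2 + 12 * h ^+ 2 - 9 by ring.
rewrite !expr2 in e1 e2 e3 e4 e5 *; lra.
Qed.

End IntegrandBounds.

(** * The hyperbola and the ray *)

Section Paths.
Variable R : realType.

(** From [vhyp x ^+ 2 - vhyp y ^+ 2 = i (x - y)]. As the denominator has modulus at least 2,
    continuity and the derivative follow at once. *)
Lemma vhyp_diff (x y : R) : vhyp x - vhyp y = (0 +i* (x - y)) / (vhyp x + vhyp y).
Proof.
have [x2 x1] := vhyp_spec x; have [y2 y1] := vhyp_spec y.
have n0 : vhyp x + vhyp y != 0.
  by apply/eqP => /(congr1 (@complex.Re R)); rewrite ReD -[Re 0]/(0 : R) => E; move: x1 y1 E; lra.
apply: (@mulIf _ (vhyp x + vhyp y)) => //; rewrite divfK // -subr_sqr x2 y2.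
by apply: complex_ext; rewrite ?ReB ?ImB //= subrr.
Qed.

Lemma vhyp_sum_ge (x y : R) : 2 <= cabs (vhyp x + vhyp y).
Proof.
have [_ x1] := vhyp_spec x; have [_ y1] := vhyp_spec y.
apply: le_trans (Re_le_cabs _); apply: le_trans (ler_norm _); rewrite ReD.
by move: (Re _) (Re _) x1 y1 => p q; lra.
Qed.

Lemma ccvg_vhyp (F : set_system R) {FF : Filter F} (f : R -> R) (t : R) :
  f x @[x --> F] --> t -> ccvg F (fun x => vhyp (f x)) (vhyp t).
Proof.
move=> ft; apply: (@ccvg_squeeze _ _ _ _ _ (fun x => `|f x - t|)); last first.
  rewrite -(@normr0 _ R) -(subrr t).
  by apply: cvg_norm; apply: cvgB => //; exact: cvg_cst.
near=> x; have S := vhyp_sum_ge (f x) t.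
rewrite vhyp_diff cabsM cabsV ler_pdivrMr; last exact: lt_le_trans S.
have -> : cabs (0 +i* (f x - t)) = `|f x - t|.
  by rewrite /cabs /= expr0n /= add0r sqrtr_sqr.
by rewrite ler_peMr // (le_trans _ S) // ler1n.
Unshelve. all: by end_near. Qed.

Definition dvhyp (y : R) : R[i] := (0 +i* 1) / (vhyp y + vhyp y).

Lemma ccont_vhyp : ccont (@vhyp R). Proof. by move=> t; apply: ccvg_vhyp. Qed.

Lemma ccont_dvhyp : ccont dvhyp.
Proof.
apply: ccontM; first exact: ccont_cst.
apply: ccontV; last by apply: ccontD; exact: ccont_vhyp.
by move=> t; rewrite -cabs_gt0 (lt_le_trans _ (vhyp_sum_ge t t)).
Qed.

Lemma cderiv_vhyp (t : R) : cderiv (@vhyp R) t (dvhyp t).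
Proof.
have H : ccvg (0 : R)^' (fun h => (0 +i* 1) / (vhyp (h + t) + vhyp t)) (dvhyp t).
  apply: ccvgM; first exact: ccvg_cst.
  apply: ccvgV; first by rewrite -cabs_gt0 (lt_le_trans _ (vhyp_sum_ge t t)).
  apply: ccvgD; last exact: ccvg_cst.
  apply: ccvg_vhyp; rewrite -[X in _ --> X]add0r.
  by apply: cvgD; [exact: cvg_within|exact: cvg_cst].
apply: near_ccvg H; near=> h.
have h0 : h != 0 by near: h; exact: nbhs_dnbhs_neq.
rewrite vhyp_diff addrK mulrA; congr (_ / _).
by apply: complex_ext; rewrite ?ReCM ?ImCM /= ?mulr0 // mulVf.
Unshelve. all: by end_near. Qed.

(** The absolute value keeps [Re >= 1] for all real [y], as the homotopy requires; the corner it
    makes at 0 is why derivatives of the paths are only assumed for positive parameters. *)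
Definition vray (y : R) : R[i] := 1 + `|y|%:C * @e_ip4 R.

Lemma ccont_vray : ccont vray.
Proof.
apply: ccontD; first exact: ccont_cst.
apply: ccontM; last exact: ccont_cst.
by apply: ccont_real; exact: norm_continuous.
Qed.

Lemma cderiv_vray (t : R) : 0 < t -> cderiv vray t (@e_ip4 R).
Proof.
move=> t0; apply: near_ccvg (@ccvg_cst R R (0 : R)^' _ (@e_ip4 R)); near=> h.
have h0 : h != 0 by near: h; exact: nbhs_dnbhs_neq.
have ht : 0 < h + t.
  near: h; have L : h + t @[h --> (0 : R)^'] --> 0 + t.
    by apply: cvgD; [exact: cvg_within|exact: cvg_cst].
  by apply: (cvgr_gt _ L); rewrite add0r.
rewrite /vray !gtr0_norm //.
have -> : 1 + (h + t)%:C * @e_ip4 R - (1 + t%:C * @e_ip4 R) = h%:C * @e_ip4 R by rewrite rmorphD; ring.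
by rewrite mulrA -rmorphM mulVf // rmorph1 mul1r.
Unshelve. all: by end_near. Qed.

Lemma ReIm_vray (t : R) : 0 <= t ->
  Re (vray t) = 1 + t * (Num.sqrt 2 / 2) /\ Im (vray t) = t * (Num.sqrt 2 / 2).
Proof. by move=> t0; rewrite /vray ReD ImD ReCM ImCM ger0_norm //= add0r. Qed.

Lemma sqrt2_ge1 : 1 <= Num.sqrt (2 : R) <= 2.
Proof.
rewrite -{1}(@sqrtr1 R) ler_wsqrtr ?ler1n //= -[leRHS](_ : Num.sqrt (2 ^+ 2) = 2).
  by rewrite ler_wsqrtr // -natrX ler_nat.
by rewrite sqrtr_sqr ger0_norm.
Qed.

Lemma vray_ge1 (t : R) : 1 <= Re (vray t).
Proof.
have /andP[s1 _] := sqrt2_ge1; rewrite /vray ReD ReCM /= lerDl mulr_ge0 // divr_ge0 // (le_trans _ s1) //.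
Qed.

Lemma vhyp_ReIm (y : R) : 0 <= y ->
  [/\ 0 <= Im (vhyp y), Re (vhyp y) ^+ 2 = 1 + Im (vhyp y) ^+ 2 & y = 2 * Re (vhyp y) * Im (vhyp y)].
Proof.
move=> y0; have [E v1] := vhyp_spec y.
have E1 := congr1 (@complex.Re _) E; have E2 := congr1 (@complex.Im _) E.
move: E1 E2; rewrite expr2 ReM ImM; move: (vhyp y) v1 => [X h] /= X1 E1 E2.
by split; nra.
Qed.

Lemma strip_segment (Y s : R) : 0 <= Y -> 0 <= s <= 1 ->
  let v := @vhyp R Y + s%:C * (vray Y - vhyp Y) in
  [/\ 1 <= Re v, Im (vhyp Y) <= Im v & Im v <= Re v <= 1 + Im v].
Proof.
move=> Y0 s01 v; have v1 : 1 <= Re v by apply: convex_Re; rewrite ?vray_ge1 //; have [] := vhyp_spec Y.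
have [h0 E1 E2] := vhyp_ReIm Y0; have [r1 r2] := ReIm_vray Y0; have [_ X1] := vhyp_spec Y.
rewrite /v in v1 *; move: (vray Y) r1 r2 v1 => r r1 r2 v1.
split=> //; rewrite !(ReD, ImD, ReN, ImN, ReCM, ImCM).
  have /andP[q1 _] := sqrt2_ge1; rewrite r2.
  move: (Re (vhyp Y)) (Im (vhyp Y)) (Num.sqrt 2) h0 E1 E2 X1 q1 s01 => X h q h0 E1 E2 X1 q1 /andP[s0 s1].
  (* From [Y = 2 X h >= 2 h]: the end of the ray is higher than that of the hyperbola. *)
  have hY : h <= Y * (q / 2) by nra.
  nra.
rewrite r1 r2; move: (Y * (Num.sqrt 2 / 2)) => H.
move: (Re (vhyp Y)) (Im (vhyp Y)) h0 E1 E2 X1 s01 => X h h0 E1 E2 X1 /andP[s0 s1].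
have e1 : h <= X by nra.
have e2 : X <= 1 + h by nra.
by apply/andP; split; nra.
Qed.

Lemma cabs_segment (Y : R) : 0 <= Y -> cabs (vray Y - vhyp Y) <= 2 * (1 + Y).
Proof.
move=> Y0; rewrite (le_trans (cabs_le_sub _ _)) //.
have e1 : cabs (@e_ip4 R) = 1.
  apply/eqP; rewrite -(@eqrXn2 _ 2) ?cabs_ge0 ?ler01 // cabs_sqr /= expr1n.
  have -> : (Num.sqrt 2 / 2) ^+ 2 + (Num.sqrt 2 / 2) ^+ 2 = Num.sqrt (2 : R) ^+ 2 / 2 by field.
  by rewrite sqr_sqrtr // divff.
have r : cabs (vray Y) <= 1 + Y.
  by rewrite (le_trans (cabsD _ _)) // cabs1 cabsM cabs_real e1 mulr1 normr_id ger0_norm.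
have [E v1] := vhyp_spec Y; have va := vhyp_ge1 Y.
have h : cabs (vhyp Y) <= 1 + Y.
  have : cabs (vhyp Y) ^+ 2 <= 1 + Y.
    by rewrite -cabsX E (le_trans (cabs_le_ReIm _)) //= normr1 ger0_norm.
  by apply: le_trans; rewrite expr2 ler_peMr // cabs_ge0.
lra.
Qed.

Lemma vhyp0_vray0 : @vhyp R 0 = vray 0.
Proof.
have -> : vray 0 = 1 by rewrite /vray normr0 mul0r addr0.
rewrite /vhyp expr2 mul0r addr0 sqrtr1 -[1 + 1](natrD _ 1 1) divff ?pnatr_eq0 // sqrtr1 mul0r.
by apply: complex_ext.
Qed.

End Paths.

(** * From the hyperbola to the ray *)

Section Deformation.
Variables (R : realType) (c : nat -> R) (lam a A0 : R).
Hypotheses (Ac : is_A_coef c) (lam0 : 0 <= lam).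
Hypotheses (A00 : 0 < A0) (A0k : 0 < 1 - 4 * A0 + A0 ^+ 2) (A01 : 2 * A0 + A0 ^+ 2 < 1).
Hypothesis (aA : `|a| / 24 < beta A0).
Local Notation Bval := (Bval c lam a).
Local Notation Fint := (Fint c lam a).
Local Notation Hlim := (Hlim c lam a).
Local Notation leb := (@lebesgue_measure R).
Local Notation e := (@e_ip4 R).
Local Notation vray := (@vray R).
Local Notation vhyp := (@vhyp R).
Local Notation dvhyp := (@dvhyp R).
Let KF : R := A0 / (1 - A0) ^+ 2.

(** With [v^2 = 1 + i y] one has [dv = i dy / (2 v)], and [Hlim] carries the constant [2 * 12 = 24]:
    the quotient is [i / 48]. *)
Lemma Fint_vhyp y : Fint (vhyp y) * dvhyp y = (0 +i* (48^-1)) * Hlim y.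
Proof.
rewrite /Fint /dvhyp /Hlim; have [<- v1] := vhyp_spec y.
have v0 : vhyp y != 0 by rewrite -cabs_gt0 (lt_le_trans _ (vhyp_ge1 y)).
rewrite -exprM; have -> : (0 +i* (48^-1) : R[i]) = (0 +i* 1) / 48.
  have -> : (48 : R[i])^-1 = (48^-1)%:C by rewrite fmorphV rmorph_nat.
  by apply: complex_ext; rewrite mulrC ?ReCM ?ImCM /= ?mulr0 ?mulr1.
have n48 : (48 : R[i]) != 0 by rewrite pnatr_eq0.
have two : (2 : R[i]) != 0 by rewrite pnatr_eq0.
have E48 : (48 : R[i]) = 2 * (2 * 12) by rewrite -!natrM.
rewrite E48 in n48 *; rewrite -mulr2n -[_ *+ 2]mulr_natl.
have n12 : (12 : R[i]) != 0 by rewrite pnatr_eq0.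
have G (K : fieldType) (q v i x t w : K) : v != 0 -> t != 0 -> w != 0 ->
   q * v ^+ 5 * x * (i / (t * v)) = i / (t * (t * w)) * (x * (t * v ^+ 2) * (w * v ^+ 2 * q)).
  by move=> hv ht hw; field; rewrite hv ht hw.
exact: G.
Qed.

Let KF0 : 0 <= KF.
Proof. by rewrite divr_ge0 ?exprn_ge0 ?(ltW A00) // subr_ge0; have := A01; have := A00; nra. Qed.

Lemma vray_decay t : 0 <= t -> `|Im (Fint (vray t) * e)| <= KF * expR 18 * expR (- t).
Proof.
move=> t0; rewrite (le_trans (Im_le_cabs _)) // cabsM.
have [E1 E2] := ReIm_vray t0; have /andP[s1 s2] := sqrt2_ge1 R.
have I0 : 0 <= Im (vray t) by rewrite E2 mulr_ge0 // divr_ge0 // (le_trans _ s1).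
have e1 : cabs e <= 1.
  rewrite -(@ler_pXn2r _ 2) ?nnegrE ?cabs_ge0 ?ler01 // cabs_sqr /= expr1n.
  have -> : (Num.sqrt 2 / 2) ^+ 2 + (Num.sqrt 2 / 2) ^+ 2 = Num.sqrt (2 : R) ^+ 2 / 2 by field.
  by rewrite sqr_sqrtr // divff.
apply: (@le_trans _ _ (cabs (Fint (vray t)))); first by rewrite ler_piMr ?cabs_ge0.
have h : Im (vray t) <= Re (vray t) <= 1 + Im (vray t) by rewrite E1 E2 lexx lerDr ler01.
apply: le_trans (Fint_decay Ac lam0 A00 A01 aA (vray_ge1 t) I0 h) _.
rewrite -[leRHS]mulrA ler_wpM2l // ler_wpM2l ?expR_ge0 // ler_expR lerN2 E2.
by move: (Num.sqrt 2) s1 t0 => q; nra.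
Qed.

Lemma vhyp_decay y : 0 <= y ->
  `|Im (Fint (vhyp y) * dvhyp y)| <= KF * (24 * expR (81 / 4 + 1)) * expR (- y).
Proof.
move=> y0; rewrite (le_trans (Im_le_cabs _)) // Fint_vhyp cabsM.
have u1 : cabs (1 +i* y) <= 1 + y by rewrite (le_trans (cabs_le_ReIm _)) //= normr1 ger0_norm.
have i1 : cabs (0 +i* (48^-1)) <= (1 : R).
  by rewrite /cabs /= expr0n /= add0r sqrtr_sqr ger0_norm ?invr_ge0 // invf_le1 ?ler1n.
apply: (@le_trans _ _ (cabs (Hlim y))); first by rewrite ler_piMl ?cabs_ge0.
rewrite /Hlim cabsM [cabs (cexp _ * _)]cabsM cabs_cexp.
have [_ v1] := vhyp_spec y; have B := Frat_bound Ac lam0 A00 A01 aA v1.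
have -> : Re ((1 +i* y) ^+ 2) = 1 - y ^+ 2 by rewrite expr2 ReM /=; ring.
rewrite [cabs (12 * _ * _)]cabsM [cabs (12 * _)]cabsM [cabs (2 * _)]cabsM !cabs_nat.
move: (cabs (1 +i* y)) (cabs_ge0 (1 +i* y)) u1 => u u0 u1.
move: (cabs _) (cabs_ge0 (Bval (vhyp y) / (1 + Bval (vhyp y)) ^+ 2)) B => b b0 B.
have G := gauss_dom y0.
have e1 : expR (1 - y ^+ 2) <= expR 1 * expR (- (y ^+ 2 / 9)).
  by rewrite -expRD ler_expR lerD2l lerN2 ler_pdivrMr //; have := sqr_ge0 y; nra.
apply: (@le_trans _ _ (KF * (24 * (expR 1 * ((1 + y) ^+ 2 * expR (- (y ^+ 2 / 9))))))); last first.
  rewrite -[leRHS]mulrA ler_wpM2l // -[leRHS]mulrA ler_wpM2l // [81 / 4 + 1]addrC expRD -[leRHS]mulrA.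
  by rewrite ler_wpM2l ?expR_ge0.
have -> : expR (1 - y ^+ 2) * (2 * u) * (12 * u * b) = b * (24 * (expR (1 - y ^+ 2) * u ^+ 2)) by ring.
rewrite ler_pM ?mulr_ge0 ?expR_ge0 ?exprn_ge0 // ler_wpM2l //.
rewrite [(1 + y) ^+ 2 * _]mulrC [leRHS]mulrA; apply: ler_pM; rewrite ?expR_ge0 ?exprn_ge0 //.
by apply: lerXn2r; rewrite ?nnegrE // addr_ge0.
Qed.

Let F_deriv := @cderiv_Fint R c lam a A0 Ac lam0 A00 A0k A01 aA.
Let F_cont := @ccont_Fint R c lam a A0 Ac lam0 A00 A0k A01 aA.
Let dF_cont := @ccont_dFint R c lam a A0 Ac lam0 A00 A0k A01 aA.

Let F_bd M : exists C, forall v, 1 <= Re v -> cabs v <= M ->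
  cabs (Fint v) <= C /\ cabs (dFint c lam a v) <= C.
Proof.
have [[C HC] [D HD]] := Fint_hbounded Ac lam0 A00 A0k A01 aA M.
exists (Num.max C D) => v v1 vM; split; rewrite le_max; apply/orP; [left; exact: HC|right; exact: HD].
Qed.

(** On the hyperbola [y = 2 X h <= 2 (1 + h) h], so the parameter must grow quadratically for the
    height [h] to reach [n]. *)
Let Yn (n : nat) : R := 2 * (1 + n%:R) ^+ 2.

Let segment_bound n s : 0 <= s <= 1 ->
  cabs (Fint (vhyp (Yn n) + s%:C * (vray (Yn n) - vhyp (Yn n)))) * cabs (vray (Yn n) - vhyp (Yn n))
    <= KF * expR 18 * 24 * expR (- n%:R).
Proof.
move=> s01; have Y0 : 0 <= Yn n by rewrite mulr_ge0 // exprn_ge0 // addr_ge0.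
have [v1 hv hX] := strip_segment Y0 s01; have D := cabs_segment Y0.
have [h0 E1 E2] := vhyp_ReIm Y0; have [_ X1] := vhyp_spec (Yn n).
have FD := Fint_decay Ac lam0 A00 A01 aA v1 (le_trans h0 hv) hX.
move: (vhyp (Yn n) + _) v1 hv hX FD => v v1 hv hX FD.
have nh : n%:R <= Im (vhyp (Yn n)).
  have {}E2 : 2 * (1 + n%:R) ^+ 2 = 2 * Re (vhyp (Yn n)) * Im (vhyp (Yn n)) by exact: E2.
  move: E1 E2 X1 h0; move: (vhyp (Yn n)) => [X h] /=; move: (n%:R : R) (ler0n R n) => m m0 E1 E2 X1 h0.
  rewrite leNgt; apply/negP => hm; have Xm : X <= 1 + m by nra.
  have : X * h <= (1 + m) * m by apply: ler_pM; lra.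
  nra.
(* The segment has length at most [2 (1 + Y)], with [Y] quadratic in the height;
   [(1 + k/2)^2 <= exp k] absorbs it into half of the decay [exp (- 2 k)]. *)
have Yh : 1 + Yn n <= 12 * expR (Im v).
  have : Yn n <= 2 * (1 + Im v) ^+ 2.
    rewrite E2; move: (vhyp (Yn n)) (Im v) E1 X1 h0 hv => [X h] k /= E1 X1 h0 hv.
    have Xh : X <= 1 + h by nra.
    have : X * h <= (1 + k) * (1 + k) by apply: ler_pM; lra.
    by rewrite expr2; lra.
  have e1 : (1 + Im v / 2) ^+ 2 <= expR (Im v).
    have -> : expR (Im v) = expR (Im v / 2) ^+ 2 by rewrite -expRM_natl; congr expR; field.
    have k0 : 0 <= Im v by exact: le_trans hv.
    apply: lerXn2r; rewrite ?nnegrE ?expR_ge0 ?expR_ge1Dx //.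
    by rewrite addr_ge0 // divr_ge0.
  have k0 : 0 <= Im v by exact: le_trans hv.
  move: (Im v) (expR (Im v)) k0 e1 (Yn n) => k E k0 e1 Y; nra.
apply: (@le_trans _ _ (KF * (expR 18 * expR (- (2 * Im v))) * (2 * (12 * expR (Im v))))).
  rewrite ler_pM ?cabs_ge0 // (le_trans D) // ler_wpM2l //.
have -> : KF * (expR 18 * expR (- (2 * Im v))) * (2 * (12 * expR (Im v))) = KF * expR 18 * 24 *
   (expR (- (2 * Im v)) * expR (Im v)) by ring.
apply: ler_wpM2l; first exact: (mulr_ge0 (mulr_ge0 KF0 (expR_ge0 _)) (ler0n _ _)).
rewrite -expRD ler_expR.
by move: (Im v) (Im (vhyp _)) nh hv => p q; lra.
Qed.

Lemma contour_deformation :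
  leb.-integrable `[0, +oo[ (EFin \o (fun t => Im (Fint (vray t) * e))) /\
  Rintegral leb `[0, +oo[ (fun t => Im (Fint (vray t) * e)) =
  Rintegral leb `[0, +oo[ (fun y => Im (Fint (vhyp y) * dvhyp y)).
Proof.
have vh1 y : 1 <= Re (vhyp y) by have [] := vhyp_spec y.
have Yoo : Yn n @[n --> \oo] --> +oo.
  apply/cvgryPge => A; near=> n.
  apply: (@le_trans _ _ n%:R); first by near: n; exact: nbhs_infty_ger.
  by rewrite /Yn; move: (n%:R : R) (ler0n R n) => m m0; nra.
have m1 : measurable_fun setT (fun t => Im (Fint (vray t) * e)).
  apply: continuous_measurable_fun; apply: ccont_Im; apply: ccontM; last exact: ccont_cst.
  by apply: F_cont; [exact: vray_ge1|exact: ccont_vray].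
have m0 : measurable_fun setT (fun y => Im (Fint (vhyp y) * dvhyp y)).
  apply: continuous_measurable_fun; apply: ccont_Im; apply: ccontM; last exact: ccont_dvhyp.
  by apply: F_cont => //; exact: ccont_vhyp.
(* Applied to a constant sequence of functions: this gives integrability on the half line and
   convergence of the truncated integrals. *)
have [I1 L1] := dct_halfline (N := 0) (fun _ _ => m1) Yoo (fun y _ => @cvg_cst _ _ _ _ _)
  (fun n y _ yY => vray_decay (proj1 (andP yY))).
have [I0 L0] := dct_halfline (N := 0) (fun _ _ => m0) Yoo (fun y _ => @cvg_cst _ _ _ _ _)
  (fun n y _ yY => vhyp_decay (proj1 (andP yY))).
split=> //.
have c01 : vhyp 0 = vray 0.
  exact: vhyp0_vray0.
have Y0 n : 0 < Yn n by rewrite mulr_gt0 // exprn_gt0 // ltr_wpDr.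
have D n := path_integral_diff F_deriv F_cont dF_cont F_bd vh1 (@vray_ge1 R) (@ccont_vhyp R) (@ccont_vray R)
  (@ccont_dvhyp R) (@ccont_cst R e) (fun y _ => cderiv_vhyp y) (@cderiv_vray R) c01 (Y0 n) (@segment_bound n).
have Z : KF * expR 18 * 24 * expR (- n%:R) * pi @[n --> \oo] --> (0 : R).
  rewrite -[X in _ --> X](_ : KF * expR 18 * 24 * 0 * pi = 0); last by rewrite mulr0 mul0r.
  apply: cvgM; last exact: cvg_cst.
  apply: cvgM; first exact: cvg_cst.
  apply: (@cvg_comp _ _ _ (fun n : nat => n%:R : R) (fun x => expR (- x)) _ (pinfty_nbhs R)).
    exact: cvgr_idn.
  exact: cvgr_expR.
apply/eqP; rewrite -subr_eq0; apply/eqP.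
have L : Rintegral leb `[0, Yn n] (fun t => Im (Fint (vray t) * e)) -
    Rintegral leb `[0, Yn n] (fun y => Im (Fint (vhyp y) * dvhyp y)) @[n --> \oo] --> (0 : R).
  apply: norm_cvg0; apply: (@squeeze_cvgr _ _ _ _ (fun=> 0) (fun n => KF * expR 18 * 24 * expR (- n%:R) * pi)) => //; last exact: cvg_cst.
  by near=> n; rewrite normr_ge0 /= D.
exact: (cvg_unique _ (cvgB L1 L0) L).
Unshelve. all: by end_near. Qed.

End Deformation.

Section LaplaceFormula.
Variables (R : realType) (c : nat -> R) (lam a A0 : R).
Hypotheses (Ac : is_A_coef c) (lam0 : 0 <= lam).
Hypotheses (A00 : 0 < A0) (A0k : 0 < 1 - 4 * A0 + A0 ^+ 2) (A01 : 2 * A0 + A0 ^+ 2 < 1).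
Hypothesis (aA : `|a| / 24 < beta A0).
Local Notation Bval := (Bval c lam a).
Local Notation Fint := (Fint c lam a).
Local Notation Hlim := (Hlim c lam a).
Local Notation leb := (@lebesgue_measure R).
Local Notation e := (@e_ip4 R).
Local Notation vray := (@vray R).
Local Notation vhyp := (@vhyp R).
Local Notation dvhyp := (@dvhyp R).
(** Schwarz reflection, as the coefficients of [A] are real. *)
Lemma Fint_conj v : 1 <= cabs v -> Fint (conjc v) = conjc (Fint v).
Proof.
move=> v1; have rho0 : 0 <= 24 * beta A0 by rewrite mulr_ge0 // (le_trans _ (ltW aA)) // divr_ge0.
have rhoA : A0 ^+ 2 + 24 * beta A0 / 24 * (1 + A0) ^+ 3 <= A0.
  by rewrite (_ : 24 * beta A0 / 24 = beta A0) ?beta_fix //; [exact: ltW|field].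
have RC (r : R) : conjc r%:C = r%:C by apply: complex_ext => //=; rewrite oppr0.
have cM (z w : R[i]) : conjc (z * w) = conjc z * conjc w by exact: rmorphM.
have cX (z : R[i]) n : conjc (z ^+ n) = conjc z ^+ n by exact: rmorphXn.
have cV (z : R[i]) : conjc (z^-1) = (conjc z)^-1 by exact: fmorphV.
have E : Bval (conjc v) = conjc (Bval v).
  rewrite !BvalE cM; congr (_ * _).
    by rewrite /Aof -(Aval_conj Ac (ltW A00) rho0 rhoA (Aarg_bound aA v1)) cM cV cX RC.
  by rewrite -cexp_conj cM -rmorphN RC.
have B1 : conjc (1 + Bval v) = 1 + conjc (Bval v) by apply: complex_ext; rewrite ?ReD ?ImD; case: (Bval v) => x y //=; rewrite add0r add0r.
have FE w : Fint w = Bval w / (1 + Bval w) ^+ 2 * w ^+ 5 * cexp (w ^+ 4) by [].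
rewrite !FE; move: (Bval v) (Bval (conjc v)) E B1 => b b' E B1.
have P (x y z w : R[i]) : conjc (x / y * z * w) = conjc x / conjc y * conjc z * conjc w by rewrite !cM cV.
by rewrite E P -cexp_conj !cX B1.
Qed.

(** The lower ray is the conjugate of the upper one, so the real parts cancel and the contour
    integral is [2 i J]. With [J = H / 48], the prefactor [48 / (i sqrt pi)] becomes
    [2 / sqrt pi]. *)
Lemma L_lapE : L_lap c lam a =
  (1 + 2 / Num.sqrt pi * Rintegral leb `[0, +oo[ (fun y => Re (Hlim y)))%:C.
Proof.
have [I1 E] := (contour_deformation Ac lam0 A00 A0k A01 aA).
have S : [set x : R | 0 <= x] = `[0, +oo[%classic.
  by apply/seteqP; split=> x; rewrite /= in_itv /= andbT.
rewrite /L_lap /Gamma_int /ray_int /cint_pos S.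
set Jr := Rintegral leb `[0, +oo[ (fun t => Re (Fint (vray t) * e)).
set J := Rintegral leb `[0, +oo[ (fun t => Im (Fint (vray t) * e)) in E.
have T0 (t : R) : t \in `[0, +oo[%classic -> 0 <= t by rewrite inE /= in_itv /= andbT.
have P t : 0 <= t -> 1 + t%:C * e = vray t by move=> t0; rewrite /vray ger0_norm.
have C t : 0 <= t -> Fint (1 + t%:C * @e_mip4 R) * @e_mip4 R = conjc (Fint (vray t) * e).
  move=> t0; have em : @e_mip4 R = conjc e by [].
  have cM (z w : R[i]) : conjc (z * w) = conjc z * conjc w by exact: rmorphM.
  rewrite cM -Fint_conj; last first.
    by apply: le_trans (Re_le_cabs _); apply: le_trans (ler_norm _); exact: vray_ge1.
  rewrite em; congr (Fint _ * _); rewrite -P //; apply: complex_ext => /=.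
    by rewrite ?ReD ?ImD ?ReCM ?ImCM /=; ring.
  by rewrite ?ReD ?ImD ?ReCM ?ImCM /=; ring.
have RJ (u : R[i]) : Re (conjc u) = Re u by case: u.
have IJ (u : R[i]) : Im (conjc u) = - Im u by case: u.
have E1 : Rintegral leb `[0, +oo[ (fun t => Re (Fint (1 + t%:C * e) * e)) = Jr.
  by apply: eq_Rintegral => t /T0 t0; rewrite P.
have E2 : Rintegral leb `[0, +oo[ (fun t => Im (Fint (1 + t%:C * e) * e)) = J.
  by apply: eq_Rintegral => t /T0 t0; rewrite P.
have E3 : Rintegral leb `[0, +oo[ (fun t => Re (Fint (1 + t%:C * @e_mip4 R) * @e_mip4 R)) = Jr.
  apply: eq_Rintegral => t /T0 t0; by rewrite C // RJ.
have E4 : Rintegral leb `[0, +oo[ (fun t => Im (Fint (1 + t%:C * @e_mip4 R) * @e_mip4 R)) = - J.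
  rewrite -mulN1r /J -RintegralZl //; apply: eq_Rintegral => t /T0 t0.
  by rewrite C // mulN1r IJ.
rewrite E1 E2 E3 E4.
have EJ : J = 48^-1 * Rintegral leb `[0, +oo[ (fun y => Re (Hlim y)).
  have [IH _] := laplace_lim Ac lam0 A00 A0k A01 aA.
  rewrite E -RintegralZl //; apply: eq_Rintegral => y _.
  by rewrite Fint_vhyp ImM /= mul0r add0r.
have sp : Num.sqrt (pi : R) != 0 by rewrite gt_eqF // sqrtr_gt0 pi_gt0.
move: EJ => ->; move: (Rintegral _ _ _) (Num.sqrt _) sp => H s s0.
have G (K : fieldType) (i t x h : K) : i != 0 -> t != 0 -> 48%:R / (i * t) * (i * (x + x)) = (48%:R * (x + x)) / t.
  by move=> i0 t0; rewrite invfM; move: (48%:R : K) => q; field; rewrite i0 t0.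
have -> : (Jr +i* (48^-1 * H)) - (Jr +i* - (48^-1 * H)) = 'i * ((48^-1 * H)%:C + (48^-1 * H)%:C).
  by apply: complex_ext; rewrite ?ReB ?ImB ?ReM ?ImM /= ?addr0 ?add0r; ring.
rewrite G ?eq_complex /= ?oner_eq0 ?andbF //; last by rewrite eqxx andbT.
have -> : (48 : R[i]) = 48%:C by rewrite rmorph_nat.
rewrite -rmorphD -rmorphM -fmorphV -rmorphM -[X in X + _](rmorph1 (real_complex R)) -rmorphD; congr (_%:C).
by field.
Qed.

End LaplaceFormula.

(** * Weierstrass approximation *)

Local Close Scope complex_scope.

Section Bernstein.
Variable R : realType.

(* The Bernstein polynomial [\sum_k 'C(N, k) g k X^k (1 - X)^(N - k)], by Pascal's recursion. *)
Fixpoint bern N (g : nat -> R) : {poly R} :=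
  if N is M.+1 then (1 - 'X) * bern M g + 'X * bern M (fun k => g k.+1) else (g 0%N)%:P.

Lemma bern_mono N (g h : nat -> R) (u : R) : 0 <= u <= 1 ->
  (forall k, (k <= N)%N -> g k <= h k) -> (bern N g).[u] <= (bern N h).[u].
Proof.
move=> /andP[u0 u1]; elim: N g h => [|N IH] g h gh /=; first by rewrite !hornerC gh.
rewrite !hornerE lerD // ler_wpM2l ?subr_ge0 // IH // => k kN; apply: gh => //.
exact: leqW.
Qed.

(** The second moment of a binomial law; the shift [a] lets the recursion close. *)
Lemma bern_quad N (A B a u : R) :
  (bern N (fun k => A + B * (k%:R + a) ^+ 2)).[u] =
  A + B * ((N%:R * u + a) ^+ 2 + N%:R * u * (1 - u)).
Proof.
elim: N a => [|N IH] a /=; first by rewrite hornerC; ring.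
rewrite !hornerE IH.
have -> : (fun k : nat => A + B * (k.+1%:R + a) ^+ 2) = (fun k : nat => A + B * (k%:R + (1 + a)) ^+ 2).
  by apply/funext => k; rewrite -natr1 addrA.
by rewrite IH -natr1; ring.
Qed.

Lemma Heine_itv01 (f : R -> R) (e : R) : continuous f -> 0 < e ->
  exists2 d, 0 < d & forall x y, 0 <= x <= 1 -> 0 <= y <= 1 -> `|x - y| < d -> `|f x - f y| < e.
Proof.
move=> cf e0; have e2 : 0 < e / 2 by rewrite divr_gt0.
have /compact_near_coveringP NC := @segment_compact R 0 1.
have [x x01|d0 d0_gt0 Hd] := NC _ (nbhs (0 : R)^'+) (fun d x => forall y, `|x - y| < d -> `|f x - f y| < e) _.
  have /cvgrPdist_lt/(_ _ e2) [r /= r0 Hr] := cf x.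
  have r2 : 0 < r / 2 by rewrite divr_gt0.
  exists (ball x (r / 2), [set d | d < r / 2]) => /=.
    by split; [exact: nbhsx_ballx|exact: nbhs_right_lt].
  move=> [x' d] /= [xx' dr] y x'y.
  have h1 : `|f x - f x'| < e / 2 by apply: Hr => /=; rewrite (lt_trans xx') // ltr_pdivrMr // ltr_pMr // ltr1n.
  have h2 : `|f x - f y| < e / 2.
    apply: Hr => /=; rewrite -(subrK x' x) -addrA (le_lt_trans (ler_normD _ _)) //.
    rewrite (splitr r) ltrD //; exact: lt_trans x'y dr.
  rewrite (splitr e) -(subrK (f x) (f x')) -addrA (le_lt_trans (ler_normD _ _)) // ltrD // distrC //.
exists (d0 / 2); first by rewrite divr_gt0.
move=> x y x01 _ xy; apply: (Hd (d0 / 2)) => //=.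
- by rewrite sub0r normrN ger0_norm ?divr_ge0 ?(ltW d0_gt0) // ltr_pdivrMr // ltr_pMr // ltr1n.
- by rewrite divr_gt0.
Qed.

(** By uniform continuity near [u] and boundedness away from it, [f] at the nodes lies between two
    quadratics centred at [u]. The operator is positive, and its value on these quadratics is
    explicit. *)
Lemma Weierstrass_itv01 (f : R -> R) (e : R) : continuous f -> 0 < e ->
  exists p : {poly R}, forall u, 0 <= u <= 1 -> `|f u - p.[u]| <= e.
Proof.
move=> cf e0; have e2 : 0 < e / 2 by rewrite divr_gt0.
have [d d0 Hd] := Heine_itv01 cf e2.
have cabs : continuous (fun x => `|f x|) by move=> x; apply: cvg_norm; exact: cf.
have [x0 _ Hx0] := EVT_max ler01 (continuous_subspaceT cabs).
pose M := `|f x0|; have HM x : 0 <= x <= 1 -> `|f x| <= M by move=> x01; apply: Hx0; rewrite in_itv.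
have M0 : 0 <= M by exact: normr_ge0.
(* Large enough for the variance term, at most [2 M / (d^2 N)], to be below [e / 2]. *)
pose N := (Num.truncn (4 * M / d ^+ 2 / e)).+1.
have N0 : 0 < N%:R :> R by rewrite ltr0n.
have NB : 2 * M / d ^+ 2 / N%:R <= e / 2.
  have : 4 * M / d ^+ 2 / e < N%:R by rewrite /N truncnS_gt.
  rewrite ltr_pdivrMr // => H; rewrite ler_pdivrMr //.
  have -> : 2 * M / d ^+ 2 = 4 * M / d ^+ 2 / 2 by field; rewrite gt_eqF.
  by rewrite ler_pdivrMr // (_ : e / 2 * N%:R * 2 = N%:R * e) ?ltW //; field.
exists (bern N (fun k => f (k%:R / N%:R))) => u u01.
pose B := 2 * M / d ^+ 2 / N%:R ^+ 2.
have B0 : 0 <= B by rewrite !divr_ge0 ?mulr_ge0 ?exprn_ge0 // ltW.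
have K k : (k <= N)%N -> `|f (k%:R / N%:R) - f u| <= e / 2 + B * (k%:R + - (N%:R * u)) ^+ 2.
  move=> kN; have k01 : 0 <= (k%:R / N%:R : R) <= 1.
    by rewrite divr_ge0 //= ler_pdivrMr // mul1r ler_nat.
  have Q0 : 0 <= B * (k%:R - N%:R * u) ^+ 2 by rewrite mulr_ge0 // sqr_ge0.
  have [kd|kd] := ltrP `|k%:R / N%:R - u| d.
    by rewrite (le_trans (ltW (Hd _ _ k01 u01 kd))) // lerDl.
  rewrite (le_trans (ler_normB _ _)) //; apply: (@le_trans _ _ (2 * M)).
    by rewrite mulr2n mulrDl !mul1r lerD ?HM.
  apply: (@le_trans _ _ (B * (k%:R - N%:R * u) ^+ 2)); last by rewrite lerDr ltW.
  have -> : B * (k%:R - N%:R * u) ^+ 2 = 2 * M / d ^+ 2 * (k%:R / N%:R - u) ^+ 2.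
    by rewrite /B; field; rewrite !gt_eqF.
  rewrite -mulrA ler_peMr ?mulr_ge0 // mulrC ler_pdivlMr ?exprn_gt0 // mul1r.
  by rewrite -[leRHS]real_normK ?num_real //; apply: lerXn2r; rewrite ?nnegrE ?(ltW d0).
have V : e / 2 + B * ((N%:R * u + - (N%:R * u)) ^+ 2 + N%:R * u * (1 - u)) <= e.
  rewrite subrr expr0n add0r -lerBrDl (_ : e - e / 2 = e / 2); last by field.
  rewrite (le_trans _ NB) //.
  have -> : 2 * M / d ^+ 2 / N%:R = B * N%:R by rewrite /B; field; rewrite !gt_eqF.
  by rewrite ler_wpM2l // -mulrA ler_piMr //; move: u01 => /andP[]; nra.
have U : (bern N (fun k => f (k%:R / N%:R))).[u] <=
    (bern N (fun k => (f u + e / 2) + B * (k%:R + - (N%:R * u)) ^+ 2)).[u].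
  by apply: bern_mono => // k /K; rewrite ler_norml => /andP[_]; lra.
have L : (bern N (fun k => (f u - e / 2) + (- B) * (k%:R + - (N%:R * u)) ^+ 2)).[u] <=
    (bern N (fun k => f (k%:R / N%:R))).[u].
  by apply: bern_mono => // k /K; rewrite ler_norml mulNr => /andP[]; lra.
rewrite !bern_quad in U L.
by rewrite ler_norml; move: V U L; rewrite mulNr; move: (B * _) (_.[u]) => b q; lra.
Qed.

End Bernstein.

(** * Limit law from Laplace transforms *)

Section ExpTaylor.
Variable R : realType.

Lemma pow_fact_le_expR k (z : R) : 0 <= z -> z ^+ k / k`!%:R <= expR z.
Proof.
move=> z0; apply: (@le_trans _ _ (series (exp_coeff z) k.+1)).
  rewrite /series /= big_nat_recr //= lerDr sumr_ge0 // => i _.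
  by rewrite /exp_coeff divr_ge0 // exprn_ge0.
apply: nondecreasing_cvgn_le; last exact: is_cvg_series_exp_coeff.
by apply: nondecreasing_series => i _ _; rewrite /exp_coeff divr_ge0 // exprn_ge0.
Qed.

(** The remainder for [y] is traded against the exponential of a larger [z], with gain [q ^ k]. For
    [y] and [z] proportional to [x] this is uniform in [x >= 0]. *)
Lemma expR_taylor k (y z q : R) : 0 <= q <= 1 -> 0 <= z -> `|y| <= q * z ->
  `|expR y - \sum_(i < k) y ^+ i / i`!%:R| <= q ^+ k * expR z.
Proof.
move=> /andP[q0 q1] z0 yz.
have c0 i : 0 <= exp_coeff z i by rewrite /exp_coeff divr_ge0 // exprn_ge0.
have H N : (k <= N)%N -> `|series (exp_coeff y) N - \sum_(i < k) y ^+ i / i`!%:R| <= q ^+ k * expR z.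
  move=> kN; rewrite /series /= (big_cat_nat _ kN) //= big_mkord addrAC subrr add0r.
  apply: le_trans (ler_norm_sum _ _ _) _.
  apply: (@le_trans _ _ (\sum_(k <= i < N) q ^+ k * exp_coeff z i)).
    apply: ler_sum_nat => i /andP[ki _]; rewrite /exp_coeff normrM normrX.
    rewrite (ger0_norm (x := _^-1)) ?invr_ge0 // mulrA ler_wpM2r ?invr_ge0 //.
    apply: (@le_trans _ _ ((q * z) ^+ i)).
      by apply: lerXn2r; rewrite ?nnegrE ?mulr_ge0.
    by rewrite exprMn ler_wpM2r ?exprn_ge0 // ler_wiXn2l.
  rewrite -mulr_sumr ler_wpM2l ?exprn_ge0 //.
  apply: (@le_trans _ _ (series (exp_coeff z) N)).
    by rewrite /series /= [leRHS](big_cat_nat _ kN) //= lerDr sumr_ge0.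
  apply: nondecreasing_cvgn_le; last exact: is_cvg_series_exp_coeff.
  by apply: nondecreasing_series => i _ _.
have L : `|series (exp_coeff y) N - \sum_(i < k) y ^+ i / i`!%:R| @[N --> \oo] -->
    `|expR y - \sum_(i < k) y ^+ i / i`!%:R|.
  apply: cvg_norm; apply: cvgB; last exact: cvg_cst.
  exact: is_cvg_series_exp_coeff.
rewrite -(cvg_lim _ L) //; apply: limr_le; first by apply/cvg_ex; eexists; exact: L.
near=> N; apply: H; near: N; exact: nbhs_infty_ge.
Unshelve. all: by end_near. Qed.

End ExpTaylor.

Lemma cdf_probability (R : realType) (F : R -> R) :
  {homo F : x y / x <= y} -> (forall x, F y @[y --> x^'+] --> F x) ->
  F @ -oo --> (0 : R) -> F @ +oo --> (1 : R) ->
  exists mu : probability R R, forall r : R, mu `]-oo, r]%classic = (F r)%:E.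
Proof.
move=> Fnd Frc FN Fy.
pose G : cumulativeBounded (0 : R) (1 : R) := HB.pack F (isCumulative.Build R _ R F Fnd Frc)
  (isCumulativeBounded.Build R 0 1 F FN Fy).
have := @cdf_lebesgue_stieltjes_id R G.
rewrite /cdf; set mu := distribution _ _ => H.
by exists mu => r; exact: H.
Qed.

(** * Positive linear functionals with convergent Laplace transforms *)

Section Functional.
Variables (R : realType) (E : nat -> (R -> R) -> R).
Hypothesis ED : forall n f g, E n (fun x => f x + g x) = E n f + E n g.
Hypothesis EZ : forall n k f, E n (fun x => k * f x) = k * E n f.
Hypothesis E1 : forall n, E n (fun=> 1) = 1.
Hypothesis E_mono : forall n (f g : R -> R), (forall x : R, 0 <= x -> f x <= g x) -> E n f <= E n g.
Implicit Types f g G : R -> R.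
Variable a0 : R.
Hypothesis a0_gt0 : 0 < a0.
Hypothesis E_exp : forall a : R, `|a| < a0 -> cvgn (fun n => E n (fun x => expR (a * x))).

Definition Ecvg f := cvgn (fun n => E n f).

Lemma E_eq n f g : (forall x : R, 0 <= x -> f x = g x) -> E n f = E n g.
Proof. by move=> fg; apply/le_anti/andP; split; apply: E_mono => x x0; rewrite fg. Qed.

Lemma Ecvg_eq f g : (forall x : R, 0 <= x -> f x = g x) -> Ecvg f -> Ecvg g.
Proof. by move=> fg; rewrite /Ecvg (_ : E^~ f = E^~ g) //; apply/funext => n; exact: E_eq. Qed.

Lemma EcvgD f g : Ecvg f -> Ecvg g -> Ecvg (fun x => f x + g x).
Proof.
move=> cf cg; rewrite /Ecvg (_ : (fun n => _) = (fun n => E n f + E n g)); first exact: is_cvgD.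
by apply/funext => n; rewrite ED.
Qed.

Lemma EcvgZ k f : Ecvg f -> Ecvg (fun x => k * f x).
Proof.
move=> cf; rewrite /Ecvg (_ : (fun n => _) = (fun n => k * E n f)); first exact: is_cvgMr.
by apply/funext => n; rewrite EZ.
Qed.

Lemma Ecvg_cst k : Ecvg (fun=> k).
Proof.
apply: (@Ecvg_eq (fun x => k * 1)); first by move=> x _; rewrite mulr1.
by apply: EcvgZ; rewrite /Ecvg; under eq_fun do rewrite E1; exact: is_cvg_cst.
Qed.

Lemma Ecvg_sum (k : nat) (f : nat -> R -> R) : (forall i, (i < k)%N -> Ecvg (f i)) ->
  Ecvg (fun x => \sum_(i < k) f i x).
Proof.
elim: k => [|k IH] H.
  by apply: (@Ecvg_eq (fun=> 0)); [move=> x _; rewrite big_ord0|exact: Ecvg_cst].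
apply: (@Ecvg_eq (fun x => \sum_(i < k) f i x + f k x)); first by move=> x _; rewrite big_ord_recr.
by apply: EcvgD; [apply: IH => i ik; apply: H; exact: ltnW|exact: H].
Qed.

Lemma E_dist n f g G : (forall x : R, 0 <= x -> `|f x - g x| <= G x) -> `|E n f - E n g| <= E n G.
Proof.
move=> H; have B : E n f - E n g = E n (fun x => f x + -1 * g x) by rewrite ED EZ mulN1r.
have N : - E n G = E n (fun x => -1 * G x) by rewrite EZ mulN1r.
rewrite B ler_norml N; apply/andP; split; apply: E_mono => x x0;
  by move: (H x x0); rewrite ler_norml !mulN1r => /andP[].
Qed.

Definition Ebounded G := exists K : R, \forall n \near \oo, E n G <= K.

Lemma Ebounded_exp c : `|c| < a0 -> Ebounded (fun x => expR (c * x)).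
Proof.
move=> /E_exp cv; exists (limn (fun n => E n (fun x => expR (c * x))) + 1).
by apply: (cvgr_le _ cv); rewrite ltrDl.
Qed.

(** Completeness of the reals: [E n f] stays within a small multiple of the bounded sequence [E n G]
    of a convergent sequence, hence is Cauchy. *)
Lemma Ecvg_approx f G : Ebounded G ->
  (forall e : R, 0 < e -> exists g, Ecvg g /\ forall x : R, 0 <= x -> `|f x - g x| <= e * G x) -> Ecvg f.
Proof.
move=> [K0 GK0] H; pose K := `|K0| + 1.
have K_gt0 : 0 < K by rewrite ltr_wpDl.
apply: cauchy_cvg; apply/cauchyP => e e0.
have e2 : 0 < e / (2 * K) by rewrite divr_gt0 // mulr_gt0.
have [g [cg fg]] := H _ e2; exists (limn (fun n => E n g)).
have h2 : 0 < e / 2 by rewrite divr_gt0.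
suff : \forall n \near \oo, ball (limn (fun n => E n g)) e (E n f) by [].
near=> n; rewrite /ball /= (_ : _ - E n f = (limn (fun n => E n g) - E n g) + (E n g - E n f)); last by ring.
apply: le_lt_trans (ler_normD _ _) _; rewrite (splitr e); apply: ltr_leD.
  by near: n; move/cvgrPdist_lt : cg => /(_ _ h2).
rewrite distrC; apply: le_trans (E_dist _ fg) _; rewrite EZ.
apply: (@le_trans _ _ (e / (2 * K) * K)); last first.
  by rewrite le_eqVlt; apply/orP; left; apply/eqP; field; rewrite gt_eqF.
rewrite ler_wpM2l ?(ltW e2) //; apply: (@le_trans _ _ K0); first by near: n.
by rewrite /K (le_trans (ler_norm _)) // lerDl.
Unshelve. all: by end_near. Qed.

(** By strong induction: [k! / h^k] times the Taylor remainder of order [k] of [exp (h x)] tends to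
    [x^k] as [h] tends to 0, uniformly with respect to [exp (c x)]. *)
Lemma Ecvg_moment k : Ecvg (fun x => x ^+ k).
Proof.
have [n] := ubnP k; elim: n k => // n IH k /ltnSE kn.
pose c := a0 / 2; have c0 : 0 < c by rewrite divr_gt0.
have ca : `|c| < a0 by rewrite gtr0_norm // ltr_pdivrMr // ltr_pMr // ltr1n.
apply: (Ecvg_approx (Ebounded_exp ca)) => e e0.
have k0 : 0 < k`!%:R :> R by rewrite ltr0n fact_gt0.
(* The approximation error is [k! h / c^(k+1) exp (c x)]; the second bound on [h] makes it at most
   [e exp (c x)]. *)
pose h := Num.min c (e * c ^+ k.+1 / k`!%:R).
have h0 : 0 < h by rewrite lt_min c0 /= divr_gt0 // mulr_gt0 // exprn_gt0.
have hc : h <= c by rewrite ge_min lexx.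
have he : h <= e * c ^+ k.+1 / k`!%:R by rewrite ge_min lexx orbT.
exists (fun x => k`!%:R / h ^+ k * (expR (h * x) + -1 * \sum_(i < k) (h ^+ i / i`!%:R) * x ^+ i)); split.
  apply: EcvgZ; apply: EcvgD.
    by apply: E_exp; rewrite gtr0_norm // (le_lt_trans hc) // -(gtr0_norm c0).
  apply: EcvgZ; apply: (@Ecvg_sum k (fun i x => h ^+ i / i`!%:R * x ^+ i)) => i ik; apply: EcvgZ; apply: IH.
  exact: leq_trans ik kn.
move=> x x0; have q01 : 0 <= h / c <= 1 by rewrite divr_ge0 ?ler_pdivrMr ?mul1r ?hc ?ltW.
have T := @expR_taylor R k.+1 (h * x) (c * x) (h / c) q01.
have cx : 0 <= c * x by rewrite mulr_ge0 // ltW.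
have {}T := T cx; have hx : `|h * x| <= h / c * (c * x).
  by rewrite mulrA divfK ?gt_eqF // ger0_norm // mulr_ge0 // ltW.
have {}T := T hx.
have E1' : \sum_(i < k) (h ^+ i / i`!%:R) * x ^+ i = \sum_(i < k) (h * x) ^+ i / i`!%:R.
  by apply: eq_bigr => i _; rewrite exprMn mulrAC.
have -> : x ^+ k - k`!%:R / h ^+ k * (expR (h * x) + -1 * \sum_(i < k) (h ^+ i / i`!%:R) * x ^+ i) =
   - (k`!%:R / h ^+ k) * (expR (h * x) - \sum_(i < k.+1) (h * x) ^+ i / i`!%:R).
  rewrite E1' big_ord_recr /= exprMn; move: (\sum_(i < k) _) (expR _) => S X.
  have hk : h ^+ k != 0 by rewrite expf_neq0 // gt_eqF.
  by move: (h ^+ k) hk (k`!%:R : R) k0 => H Hn F F0; field; rewrite Hn gt_eqF.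
have F0 : 0 <= k`!%:R / h ^+ k by rewrite divr_ge0 ?exprn_ge0 // ltW.
rewrite normrM normrN (ger0_norm F0).
apply: (@le_trans _ _ (k`!%:R / h ^+ k * ((h / c) ^+ k.+1 * expR (c * x)))).
  by rewrite ler_wpM2l // divr_ge0 ?exprn_ge0 // ltW.
rewrite mulrA ler_wpM2r ?expR_ge0 //.
have -> : k`!%:R / h ^+ k * (h / c) ^+ k.+1 = k`!%:R * h / c ^+ k.+1.
  rewrite expr_div_n exprS; have hk : h ^+ k != 0 by rewrite expf_neq0 // gt_eqF.
  have ck : c ^+ k.+1 != 0 by rewrite expf_neq0 // gt_eqF.
  by move: (h ^+ k) hk (c ^+ k.+1) ck => H Hn C Cn; field; rewrite Hn Cn.
by rewrite ler_pdivrMr ?exprn_gt0 // mulrC -ler_pdivlMr.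
Qed.

(** Small enough that [exp (3 s x)], the weight in the next approximation, has bounded
    expectations. *)
Let s := a0 / 4.
Let s0 : 0 < s. Proof. by rewrite divr_gt0. Qed.

(** The hypothesis covers [exp (- j s x)] only for [j s < a0]. Larger [j] are reached by expanding
    one factor at a time: the others are at most 1, so the remainder is always dominated by
    [exp (3 s x)]. *)
Lemma Ecvg_moment_exp j k : Ecvg (fun x => x ^+ k * expR (- (s * x)) ^+ j).
Proof.
elim: j k => [|j IH] k.
  by apply: (@Ecvg_eq (fun x => x ^+ k)); [move=> x _; rewrite expr0 mulr1|exact: Ecvg_moment].
have ca : `|3 * s| < a0 by rewrite gtr0_norm ?mulr_gt0 // /s; have := a0_gt0; lra.
have C0 : 0 < k`!%:R / s ^+ k by rewrite divr_gt0 ?exprn_gt0 // ltr0n fact_gt0.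
apply: (Ecvg_approx (Ebounded_exp ca)) => e e0.
have [I HI] : exists I, (2^-1) ^+ I <= e / (k`!%:R / s ^+ k).
  have L : (2^-1 : R) ^+ n @[n --> \oo] --> (0 : R).
    by apply: cvg_expr; rewrite ger0_norm ?invr_ge0 // invf_lt1 // ltr1n.
  have d0 : 0 < e / (k`!%:R / s ^+ k) by rewrite divr_gt0.
  have [I _ HI] := cvgr_le _ L _ d0.
  by exists I; exact: (HI I (leqnn I)).
exists (fun x => \sum_(i < I) ((-1) ^+ i * s ^+ i / i`!%:R) * (x ^+ (k + i) * expR (- (s * x)) ^+ j)); split.
  by apply: (@Ecvg_sum I (fun i x => ((-1) ^+ i * s ^+ i / i`!%:R) * (x ^+ (k + i) * expR (- (s * x)) ^+ j))) => i _; apply: EcvgZ.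
move=> x x0; have q01 : 0 <= (2^-1 : R) <= 1 by rewrite invr_ge0 ler0n /= invf_le1 // ler1n.
have sx : 0 <= s * x by rewrite mulr_ge0 // ltW.
have T := @expR_taylor R I (- (s * x)) (2 * (s * x)) 2^-1 q01.
have {}T : `|expR (- (s * x)) - \sum_(i < I) (- (s * x)) ^+ i / i`!%:R| <= 2^-1 ^+ I * expR (2 * (s * x)).
  apply: T; first exact: mulr_ge0.
  by rewrite mulrA mulVf ?pnatr_eq0 // mul1r normrN ger0_norm.
have -> : \sum_(i < I) ((-1) ^+ i * s ^+ i / i`!%:R) * (x ^+ (k + i) * expR (- (s * x)) ^+ j) =
   x ^+ k * expR (- (s * x)) ^+ j * \sum_(i < I) (- (s * x)) ^+ i / i`!%:R.
  rewrite mulr_sumr; apply: eq_bigr => i _.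
  rewrite -[- (s * x)]mulN1r !exprMn exprD mulN1r.
  by move: (expR _ ^+ j) (i`!%:R^-1) ((-1) ^+ i) (s ^+ i) (x ^+ k) (x ^+ i) => A B C D F G; ring.
rewrite exprSr mulrA -mulrBr normrM ger0_norm; last by rewrite mulr_ge0 ?exprn_ge0 // expR_ge0.
have P : x ^+ k <= k`!%:R / s ^+ k * expR (s * x).
  have := @pow_fact_le_expR R k _ sx; rewrite exprMn ler_pdivrMr ?ltr0n ?fact_gt0 // => H.
  by rewrite mulrAC ler_pdivlMr ?exprn_gt0 // mulrC (le_trans H) // mulrC.
have e1 : expR (- (s * x)) ^+ j <= 1 by rewrite exprn_ile1 ?expR_ge0 // -expR0 ler_expR oppr_le0.
apply: (@le_trans _ _ (k`!%:R / s ^+ k * expR (s * x) * (2^-1 ^+ I * expR (2 * (s * x))))).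
  apply: ler_pM => //; first by rewrite mulr_ge0 ?exprn_ge0 // expR_ge0.
  apply: le_trans P; rewrite ler_piMr ?exprn_ge0 //.
have -> : expR (3 * s * x) = expR (s * x) * expR (2 * (s * x)) by rewrite -expRD; congr expR; ring.
move: HI; rewrite ler_pdivlMr // => HI.
have X0 : 0 <= expR (s * x) * expR (2 * (s * x)) by rewrite mulr_ge0 // expR_ge0.
move: (k`!%:R / s ^+ k) (2^-1 ^+ I) (expR (s * x)) (expR (2 * (s * x))) HI X0 => A B C D HI X0.
have -> : A * C * (B * D) = B * A * (C * D) by ring.
by rewrite ler_wpM2r.
Qed.

Lemma Ecvg_poly (p : {poly R}) : Ecvg (fun x => p.[expR (- (s * x))]).
Proof.
apply: (@Ecvg_eq (fun x => \sum_(i < size p) p`_i * (x ^+ 0 * expR (- (s * x)) ^+ i))).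
  by move=> x _; rewrite horner_coef; apply: eq_bigr => i _; rewrite mul1r.
by apply: (@Ecvg_sum (size p) (fun i x => p`_i * (x ^+ 0 * expR (- (s * x)) ^+ i))) => i _; apply: EcvgZ; exact: Ecvg_moment_exp.
Qed.

Lemma poly_approx f (M e : R) : continuous f -> 0 <= M -> (forall x, M <= x -> f x = f M) -> 0 < e ->
  exists p : {poly R}, forall x, 0 <= x -> `|f x - p.[expR (- (s * x))]| <= e.
Proof.
move=> cf M0 fM e0; pose eta := expR (- (s * M)).
(* [f] in the variable [u = exp (- s x)]. Cutting at [eta] avoids the logarithm at 0 and is
   harmless, [f] being constant beyond [M]. *)
pose phi (u : R) := f (- ln (Num.max u eta) / s).
have cphi : continuous phi.
  move=> u; apply: (continuous_comp (f := fun u => - ln (Num.max u eta) / s)); last exact: cf.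
  apply: cvgM; last exact: cvg_cst.
  apply: cvgN; apply: (continuous_comp (f := fun u => Num.max u eta)).
    by apply: continuous_max; [exact: cvg_id|exact: cvg_cst].
  by apply: continuous_ln; rewrite lt_max expR_gt0 orbT.
have [p Hp] := Weierstrass_itv01 cphi e0; exists p => x x0.
have u01 : 0 <= expR (- (s * x)) <= 1 by rewrite expR_ge0 /= -expR0 ler_expR oppr_le0 mulr_ge0 // ltW.
suff -> : f x = phi (expR (- (s * x))) by exact: Hp.
rewrite /phi /eta; have [xM|Mx] := lerP x M.
  rewrite (elimT max_idPl) ?ler_expR ?lerN2 ?ler_wpM2l ?(ltW s0) // expRK opprK mulrC mulKf // gt_eqF //.
rewrite (elimT max_idPr) ?ler_expR ?lerN2 ?ler_wpM2l ?(ltW s0) ?(ltW Mx) // expRK opprK mulrC mulKf ?gt_eqF //.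
by rewrite fM // ltW.
Qed.

Lemma Ecvg_eventually_cst f M : continuous f -> 0 <= M -> (forall x, M <= x -> f x = f M) -> Ecvg f.
Proof.
move=> cf M0 fM; apply: (@Ecvg_approx _ (fun=> 1)).
  by exists 1; near=> n; rewrite E1.
move=> e e0; have [p Hp] := poly_approx cf M0 fM e0.
by exists (fun x => p.[expR (- (s * x))]); split; [exact: Ecvg_poly|move=> x /Hp; rewrite mulr1].
Unshelve. all: by end_near. Qed.

Definition ell f := limn (fun n => E n f).

Lemma ell_le f g : Ecvg f -> Ecvg g -> (forall x : R, 0 <= x -> f x <= g x) -> ell f <= ell g.
Proof. by move=> cf cg fg; apply: ler_lim => //; near=> n; exact: E_mono. Unshelve. all: by end_near. Qed.

Lemma ellD f g : Ecvg f -> Ecvg g -> ell (fun x => f x + g x) = ell f + ell g.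
Proof. by move=> cf cg; rewrite /ell; under eq_fun do rewrite ED; exact: limD. Qed.

Lemma ellZ k f : Ecvg f -> ell (fun x => k * f x) = k * ell f.
Proof. by move=> cf; rewrite /ell; under eq_fun do rewrite EZ; apply: cvg_lim => //; apply: cvgM; [exact: cvg_cst|exact: cf]. Qed.

Lemma ell_cst k : ell (fun=> k) = k.
Proof.
rewrite /ell (_ : (fun n => _) = (fun=> k)); first exact: lim_cst.
by apply/funext => n; rewrite -[RHS]mulr1 -(E1 n) -EZ; apply: E_eq => x _; rewrite mulr1.
Qed.

Definition clamp (t : R) : R := Num.min 1 (Num.max 0 t).

Lemma clampP t : [/\ 0 <= clamp t, clamp t <= 1, (t <= 0 -> clamp t = 0) & (1 <= t -> clamp t = 1)].
Proof.
by rewrite /clamp; have [h1|h1] := lerP 0 t; [have [h2|h2] := lerP 1 t|have [h2|h2] := lerP 1 (0 : R)];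
  split=> //; try (move=> ?); lra.
Qed.

Lemma clamp_id t : 0 <= t -> t <= 1 -> clamp t = t.
Proof. by move=> t0 t1; rewrite /clamp (elimT max_idPr) // (elimT min_idPr). Qed.

Lemma clamp_le t t' : t <= t' -> clamp t <= clamp t'.
Proof.
move=> tt; have [p1 p2 p3 p4] := clampP t; have [q1 q2 q3 q4] := clampP t'.
have [h1|h1] := lerP t 0; have [h2|h2] := lerP t' 0; have [h3|h3] := lerP 1 t; have [h4|h4] := lerP 1 t';
  by rewrite ?(p3 h1) ?(q3 h2) ?(p4 h3) ?(q4 h4) ?(clamp_id (ltW h1) (ltW h3)) ?(clamp_id (ltW h2) (ltW h4)); lra.
Qed.

Lemma clamp_lip t t' : t <= t' -> clamp t' <= clamp t + (t' - t).
Proof.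
move=> tt; have [p1 p2 p3 p4] := clampP t; have [q1 q2 q3 q4] := clampP t'.
have [h1|h1] := lerP t 0; have [h2|h2] := lerP t' 0; have [h3|h3] := lerP 1 t; have [h4|h4] := lerP 1 t';
  by rewrite ?(p3 h1) ?(q3 h2) ?(p4 h3) ?(q4 h4) ?(clamp_id (ltW h1) (ltW h3)) ?(clamp_id (ltW h2) (ltW h4)); lra.
Qed.

(** A continuous cutoff: 1 up to [y], 0 from [y + 1 / (k + 1)] on, linear between. *)
Definition chi (y : R) (k : nat) (x : R) : R := clamp (k.+1%:R * (y - x) + 1).

Lemma chi_left y k x : x <= y -> chi y k x = 1.
Proof. by move=> xy; rewrite /chi; have [_ _ _ ->] := clampP (k.+1%:R * (y - x) + 1); rewrite // lerDr mulr_ge0 // subr_ge0. Qed.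

Lemma chi_right y k x : y + k.+1%:R^-1 <= x -> chi y k x = 0.
Proof.
move=> xy; rewrite /chi; have [_ _ -> //] := clampP (k.+1%:R * (y - x) + 1).
have : k.+1%:R * (y - x + k.+1%:R^-1) <= 0 :> R by rewrite mulr_ge0_le0 // addrAC subr_le0.
by rewrite mulrDr mulfV ?pnatr_eq0 //.
Qed.

Lemma chi_continuous y k : continuous (chi y k).
Proof.
move=> x.
have -> : chi y k = ((fun=> 1) \min ((fun=> 0) \max (fun x => k.+1%:R * (y - x) + 1)))%R by [].
apply: continuous_min; first exact: cvg_cst.
apply: continuous_max; first exact: cvg_cst.
apply: cvgD; last exact: cvg_cst.
apply: cvgM; first exact: cvg_cst.
by apply: cvgB; [exact: cvg_cst|exact: cvg_id].
Qed.

Lemma Ecvg_chi y k : Ecvg (chi y k).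
Proof.
apply: (@Ecvg_eventually_cst _ (Num.max 0 (y + k.+1%:R^-1))); first exact: chi_continuous.
  by rewrite le_max lexx.
by move=> x; rewrite ge_max => /andP[_ H]; rewrite !chi_right // le_max lexx orbT.
Qed.

Let Fset y := range (fun k => ell (chi y k)).
(** Cutoffs dominate the indicator of [x <= y]; taking the infimum over them makes the function
    right-continuous. *)
Definition Fcdf y := inf (Fset y).

Let Flb y : has_lbound (Fset y).
Proof.
exists 0 => _ [k _ <-]; rewrite -[leLHS](ell_cst 0).
by apply: ell_le; [exact: Ecvg_cst|exact: Ecvg_chi|move=> x _; have [] := clampP (k.+1%:R * (y - x) + 1)].
Qed.

Let Fne y : Fset y !=set0. Proof. by exists (ell (chi y 0)), 0%N. Qed.

Lemma Fcdf_le y k : Fcdf y <= ell (chi y k).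
Proof. by apply: ge_inf => //; exists k. Qed.

Lemma Fcdf_ge y m : (forall k, m <= ell (chi y k)) -> m <= Fcdf y.
Proof. by move=> H; apply: lb_le_inf => // _ [k _ <-]. Qed.

Lemma Fcdf_adherent y e : 0 < e -> exists k, ell (chi y k) < Fcdf y + e.
Proof.
by move=> e0; have [_ [k _ <-] H] := inf_adherent e0 (conj (Fne y) (Flb y)); exists k.
Qed.

Lemma Fcdf_mono : {homo Fcdf : x y / x <= y}.
Proof.
move=> y y' yy; apply: Fcdf_ge => k; apply: le_trans (Fcdf_le y k) _.
apply: ell_le; [exact: Ecvg_chi|exact: Ecvg_chi|move=> x _].
by apply: clamp_le; rewrite lerD2r ler_wpM2l // lerD2r.
Qed.

(** A cutoff nearly optimal at [y] stays so at nearby [y'], since [chi] is Lipschitz in [y] with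
    constant [k + 1]. *)
Lemma Fcdf_rcont y : Fcdf y' @[y' --> y^'+] --> Fcdf y.
Proof.
apply/cvgrPdist_le => e e0; have e2 : 0 < e / 2 by rewrite divr_gt0.
have [k Hk] := Fcdf_adherent y e2.
have d0 : 0 < e / 2 / k.+1%:R by rewrite divr_gt0.
near=> y'; have yy : y < y' by near: y'; exact: nbhs_right_gt.
have yd : y' - y < e / 2 / k.+1%:R.
  by rewrite ltrBlDl; near: y'; apply: nbhs_right_lt; rewrite ltrDl.
rewrite distrC ger0_norm ?subr_ge0 ?Fcdf_mono ?ltW //.
have : ell (chi y' k) <= ell (chi y k) + k.+1%:R * (y' - y).
  rewrite -(ell_cst (k.+1%:R * (y' - y))) -ellD; [|exact: Ecvg_chi|exact: Ecvg_cst].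
  apply: ell_le; [exact: Ecvg_chi|apply: EcvgD; [exact: Ecvg_chi|exact: Ecvg_cst]|move=> x _].
  have T : k.+1%:R * (y - x) + 1 <= k.+1%:R * (y' - x) + 1 by rewrite lerD2r ler_wpM2l // lerD2r ltW.
  rewrite (_ : k.+1%:R * (y' - y) = k.+1%:R * (y' - x) + 1 - (k.+1%:R * (y - x) + 1)); last by ring.
  exact: clamp_lip.
have := Fcdf_le y' k; move: yd; rewrite ltr_pdivlMr // mulrC.
move: (k.+1%:R * (y' - y)) => t; lra.
Unshelve. all: by end_near. Qed.

Lemma Fcdf_neg y : y < 0 -> Fcdf y = 0.
Proof.
move=> y0; have k0 : 0 < - y by rewrite oppr_gt0.
pose k := Num.truncn (- y)^-1.
have kk : y + k.+1%:R^-1 <= 0.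
  have : (- y)^-1 < k.+1%:R by rewrite /k truncnS_gt.
  by rewrite invf_plt ?posrE // => /ltW; rewrite -subr_le0 opprK addrC.
apply/le_anti/andP; split; last first.
  apply: Fcdf_ge => l; rewrite -[leLHS](ell_cst 0).
  by apply: ell_le; [exact: Ecvg_cst|exact: Ecvg_chi|move=> x _; have [] := clampP (l.+1%:R * (y - x) + 1)].
apply: le_trans (Fcdf_le y k) _; rewrite -[leRHS](ell_cst 0).
apply: ell_le; [exact: Ecvg_chi|exact: Ecvg_cst|move=> x x0].
by rewrite chi_right // (le_trans kk).
Qed.

Lemma Fcdf_le1 y : Fcdf y <= 1.
Proof.
apply: le_trans (Fcdf_le y 0) _; rewrite -[leRHS](ell_cst 1).
by apply: ell_le; [exact: Ecvg_chi|exact: Ecvg_cst|move=> x _; have [] := clampP (1%:R * (y - x) + 1)].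
Qed.

Lemma Fcdf_ninfty : Fcdf @ -oo --> (0 : R).
Proof.
apply/cvgrPdist_le => e e0; near=> y.
rewrite Fcdf_neg ?subrr ?normr0 ?ltW //; near: y; apply: nbhs_ninfty_lt; exact: num_real.
Unshelve. all: by end_near. Qed.

(** Chernoff's bound: every cutoff is at least [1 - exp (s (x - y))]. *)
Lemma Fcdf_pinfty : Fcdf @ +oo --> (1 : R).
Proof.
have sa : `|s| < a0 by rewrite gtr0_norm // /s ltr_pdivrMr // ltr_pMr // ltr1n.
have cs : Ecvg (fun x => expR (s * x)) by exact: E_exp.
pose K := ell (fun x => expR (s * x)).
have L y : 1 - expR (- (s * y)) * K <= Fcdf y.
  apply: Fcdf_ge => k; rewrite -[X in X - _](ell_cst 1) -mulNr /K -ellZ // -ellD; [|exact: Ecvg_cst|exact: EcvgZ].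
  apply: ell_le; [apply: EcvgD; [exact: Ecvg_cst|exact: EcvgZ]|exact: Ecvg_chi|move=> x _].
  rewrite mulNr -expRD; have [xy|yx] := lerP x y; first by rewrite chi_left // gerBl expR_ge0.
  have : 1 <= expR (- (s * y) + s * x) by rewrite -expR0 ler_expR addrC subr_ge0 ler_wpM2l ?ltW.
  by have [h _ _ _] := clampP (k.+1%:R * (y - x) + 1); rewrite -/(chi y k x) in h; lra.
have Z : 1 - expR (- (s * y)) * K @[y --> +oo] --> (1 : R).
  rewrite -[X in _ --> X](_ : 1 - 0 * K = 1); last by rewrite mul0r subr0.
  apply: cvgB; first exact: cvg_cst.
  apply: cvgM; last exact: cvg_cst.
  apply: (@cvg_comp _ _ _ (fun y => s * y) (fun y => expR (- y)) _ (pinfty_nbhs R)); last exact: cvgr_expR.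
  apply/cvgryPge => A; near=> y; rewrite mulrC -ler_pdivrMr //; near: y; exact: nbhs_pinfty_ge.
apply: (@squeeze_cvgr _ _ _ _ (fun y => 1 - expR (- (s * y)) * K) (fun=> 1)) => //; last exact: cvg_cst.
by near=> y; rewrite L Fcdf_le1.
Unshelve. all: by end_near. Qed.

Lemma exists_limit_law : exists mu : probability R R, forall r : R, mu `]-oo, r]%classic = (Fcdf r)%:E.
Proof. exact: cdf_probability Fcdf_mono Fcdf_rcont Fcdf_ninfty Fcdf_pinfty. Qed.

Variable mu : probability R R.
Hypothesis muF : forall r : R, mu `]-oo, r]%classic = (Fcdf r)%:E.
Local Notation D := (`[0, +oo[%classic : set R).
Local Notation int f := (mu.-integrable D (EFin \o f)).
Local Notation m f := (Rintegral mu D f).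

Lemma mu_neg : mu [set x : R | x < 0] = 0%E.
Proof.
have -> : [set x : R | x < 0] = \bigcup_n `]-oo, (- (n.+1%:R^-1 : R))]%classic.
  apply/seteqP; split=> x /=.
    move=> x0; exists (Num.truncn (- x)^-1) => //=; rewrite in_itv /= lerNr.
    have : (- x)^-1 < (Num.truncn (- x)^-1).+1%:R by rewrite truncnS_gt.
    by rewrite invf_plt ?posrE ?oppr_gt0 // => /ltW.
  by move=> [n _] /=; rewrite in_itv /= => /le_lt_trans; apply; rewrite oppr_lt0 invr_gt0.
have N n : mu.-negligible (`]-oo, (- (n.+1%:R^-1 : R))]%classic : set R).
  apply/negligibleP; first exact: measurable_itv.
  by rewrite [LHS]muF Fcdf_neg // oppr_lt0 invr_gt0.
have [A [mA A0 sub]] := negligible_bigcup N.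
apply/eqP; rewrite -measure_le0 -A0; apply: le_measure => //; rewrite inE //.
by apply: bigcup_measurable => n _; exact: measurable_itv.
Qed.

Let mD : measurable D. Proof. exact: measurable_itv. Qed.

Let setCD : ~` D = [set x : R | x < 0].
Proof. by apply/seteqP; split=> x /=; rewrite in_itv /= andbT ltNge => /negP. Qed.

Let muCD : mu (~` D) = 0%E. Proof. by rewrite setCD mu_neg. Qed.

Let muD : mu D = 1%E.
Proof. by have := probability_setC mu (measurableC mD); rewrite setCK muCD sube0. Qed.

Let D_ge0 (x : R) : D x -> 0 <= x. Proof. by rewrite /= in_itv /= andbT. Qed.

Lemma int_cst k : int (fun=> k).
Proof. by apply: (integrableS measurableT mD) => //; exact: finite_measure_integrable_cst. Qed.

Lemma int_le f g : measurable_fun setT f -> (forall x : R, 0 <= x -> `|f x| <= g x) -> int g -> int f.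
Proof.
move=> mf fg; apply: le_integrable => //; first by apply/measurable_EFinP; exact: measurable_funTS.
by move=> x /D_ge0 x0; rewrite /= lee_fin (le_trans (fg x x0)) // ler_norm.
Qed.

Lemma intD f g : int f -> int g -> int (fun x => f x + g x).
Proof. by move=> fi gi; have := integrableD mD fi gi; apply: eq_integrable. Qed.

Lemma intZ k f : int f -> int (fun x => k * f x).
Proof. by move=> fi; have := integrableZl mD k fi; apply: eq_integrable. Qed.

Lemma mint_le f g : int f -> int g -> (forall x : R, 0 <= x -> f x <= g x) -> m f <= m g.
Proof. by move=> fi gi fg; apply: le_Rintegral => // x /D_ge0; exact: fg. Qed.

Lemma mint_cst k : m (fun=> k) = k.
Proof. rewrite Rintegral_cst //; have H : fine (mu D) = 1 by rewrite muD.
by rewrite [X in _ * X]H mulr1. Qed.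

Lemma mint_step (z : R) : int (fun x : R => (x <= z)%R%:R) /\ m (fun x : R => (x <= z)%R%:R) = Fcdf z.
Proof.
have E2 : (fun x : R => (x <= z)%R%:R) = \1_(`]-oo, z]%classic : set R) :> (R -> R).
  by apply/funext => x; rewrite indicE mem_setE in_itv.
have mA : measurable (`]-oo, z]%classic : set R) by exact: measurable_itv.
have mf : measurable_fun setT (fun x : R => (x <= z)%R%:R : R) by rewrite E2; exact: measurable_indic.
split; first by apply: (int_le mf _ (int_cst 1)) => x _; case: (x <= z); rewrite ?normr1 ?normr0.
have Z : mu (`]-oo, z]%classic `\` D) = 0%E.
  apply/eqP; rewrite -measure_le0 -muCD; apply: le_measure; rewrite ?inE //; first exact: measurableD.
  exact: measurableC.
rewrite E2 /Rintegral integral_indic // -[RHS]/(fine (Fcdf z)%:E) -muF; congr fine.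
by rewrite [RHS](measureDI mu mA mD) [X in (X + _)%E]Z add0e.
Qed.

Lemma Ecvg_ell f : Ecvg f -> E n f @[n --> \oo] --> ell f. Proof. by []. Qed.

Lemma ell_sum (k : nat) (f : nat -> R -> R) : (forall i, (i < k)%N -> Ecvg (f i)) ->
  ell (fun x => \sum_(i < k) f i x) = \sum_(i < k) ell (f i).
Proof.
elim: k => [|k IH] H.
  rewrite big_ord0 -[RHS](ell_cst 0); congr ell; apply/funext => x; exact: big_ord0.
rewrite big_ord_recr /= -IH; last by move=> i ik; apply: H; exact: ltnW.
rewrite -ellD; [|by apply: Ecvg_sum => i ik; apply: H; exact: ltnW|exact: H].
by congr ell; apply/funext => x; rewrite big_ord_recr.
Qed.

Lemma mint_sum (k : nat) (f : nat -> R -> R) : (forall i, int (f i)) ->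
  int (fun x => \sum_(i < k) f i x) /\ m (fun x => \sum_(i < k) f i x) = \sum_(i < k) m (f i).
Proof.
move=> H; elim: k => [|k [IH1 IH2]].
  rewrite big_ord0 (_ : (fun x => _) = (fun=> 0)); first by rewrite mint_cst; split=> //; exact: int_cst.
  by apply/funext => x; exact: big_ord0.
rewrite (_ : (fun x => _) = (fun x => \sum_(i < k) f i x + f k x)); last first.
  by apply/funext => x; rewrite big_ord_recr.
by rewrite big_ord_recr /= -IH2 RintegralD //; split=> //; exact: intD.
Qed.

(* [\sum_(i < N) (i.+1 <= t)] is the integer part of [t], for [t <= N]. *)
Lemma count_le (N : nat) (t : R) : 0 <= t <= N%:R ->
  t - 1 <= \sum_(i < N) (i.+1%:R <= t)%R%:R <= t.
Proof.
have up n : 0 <= t -> \sum_(i < n) (i.+1%:R <= t)%R%:R <= t.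
  move=> t0; elim: n => [|n IH]; first by rewrite big_ord0.
  rewrite big_ord_recr /=; have [h|h] := boolP (n.+1%:R <= t); last by rewrite addr0.
  apply: le_trans h; rewrite -natr1 lerD2r; apply: (@le_trans _ _ (\sum_(i < n) 1)).
    by apply: ler_sum => i _; rewrite lern1 leq_b1.
  by rewrite sumr_const card_ord.
move=> /andP[t0 tN]; rewrite up // andbT; elim: N tN => [|N IH] tN.
  by rewrite big_ord0; lra.
rewrite big_ord_recr /=; have [h|h] := lerP t N%:R.
  by rewrite (le_trans (IH h)) // lerDl.
apply: (@le_trans _ _ N%:R); first by move: tN; rewrite -natr1; lra.
apply: (@le_trans _ _ (\sum_(i < N) (i.+1%:R <= t)%R%:R)); last by rewrite lerDl.
rewrite (eq_bigr (fun=> 1)) ?sumr_const ?card_ord // => i _.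
by rewrite (le_trans _ (ltW h)) // ler_nat.
Qed.

Definition Jcvg f := int f /\ E n f @[n --> \oo] --> m f.

(** Both [m f] and [ell f] are compared with one Riemann sum of [Fcdf]. Since [f] decreases, the
    number of level points [z i] that are at least [x] is the integer part of [(N + 1) f x]. *)
Lemma Jcvg_exp b : 0 < b -> Ecvg (fun x => expR (- (b * x))) -> Jcvg (fun x => expR (- (b * x))).
Proof.
move=> b0 cf; set f := (fun x => _) in cf *.
have f01 x : 0 <= x -> 0 <= f x <= 1.
  by move=> x0; rewrite expR_ge0 /= -expR0 ler_expR oppr_le0 mulr_ge0 // ltW.
have cnt : continuous f.
  move=> x; apply: (continuous_comp (f := fun x => - (b * x))); last exact: continuous_expR.
  by apply: cvgN; apply: cvgM; [exact: cvg_cst|exact: cvg_id].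
have mf : measurable_fun setT f by exact: continuous_measurable_fun.
have fi : int f.
  by apply: (int_le mf _ (int_cst 1)) => x /f01 /andP[h1 h2]; rewrite ger0_norm.
split=> //; suff -> : m f = ell f by exact: cf.
have key N : `|m f - ell f| <= 2 / N.+1%:R.
  pose z (i : nat) : R := - ln (i.+1%:R / N.+1%:R) / b.
  have Np : 0 < N.+1%:R :> R by [].
  have zE i x : (x <= z i) = (i.+1%:R <= N.+1%:R * f x).
    rewrite /z ler_pdivlMr // lerNr -ler_expR lnK ?posrE ?divr_gt0 // ler_pdivrMr //; congr (_ <= _).
    by rewrite mulrC [x * b]mulrC.
  have zlt i : z i.+1 < z i.
    by rewrite /z ltr_pM2r ?invr_gt0 // ltrN2 ltr_ln ?posrE ?divr_gt0 // ltr_pM2r ?invr_gt0 // ltr_nat.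
  have cntb x : 0 <= x -> N.+1%:R * f x - 1 <= \sum_(i < N.+1) (x <= z i)%R%:R <= N.+1%:R * f x.
    move=> x0; under eq_bigr do rewrite zE; have /andP[h1 h2] := f01 x x0.
    by apply: count_le; rewrite mulr_ge0 //= ler_piMr.
  pose S := \sum_(i < N.+1) Fcdf (z i).
  have [si sE] := @mint_sum N.+1 (fun i x => (x <= z i)%R%:R) (fun i => (mint_step (z i)).1).
  have {}sE : m (fun x => \sum_(i < N.+1) (x <= z i)%R%:R) = S.
    by rewrite sE; apply: eq_bigr => i _; exact: (mint_step _).2.
  have m1 : S <= N.+1%:R * m f.
    rewrite -sE -RintegralZl //; apply: mint_le => //; first exact: intZ.
    by move=> x /cntb /andP[].
  have m2 : N.+1%:R * m f - 1 <= S.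
    rewrite -sE -RintegralZl // -[X in _ - X](mint_cst 1) -RintegralB //; [|exact: intZ|exact: int_cst].
    apply: mint_le => //; first by apply: (intD (intZ _ fi)); exact: (int_cst (-1)).
    by move=> x /cntb /andP[].
  (* Cutoffs dominate the steps, and those chosen nearly optimal cost [e] in total. *)
  have l1 : N.+1%:R * ell f - 1 <= S.
    apply/ler_addgt0Pr => e e0.
    have e1 : 0 < e / N.+1%:R by rewrite divr_gt0.
    have [k Hk] := choice (fun i => Fcdf_adherent (z i) e1).
    have C1 : Ecvg (fun x => \sum_(i < N.+1) chi (z i) (k i) x).
      by apply: (@Ecvg_sum N.+1 (fun i => chi (z i) (k i))) => i _; exact: Ecvg_chi.
    apply: (@le_trans _ _ (ell (fun x => \sum_(i < N.+1) chi (z i) (k i) x))).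
      have cm1 : Ecvg (fun=> -1) by exact: Ecvg_cst.
      have -> : N.+1%:R * ell f - 1 = ell (fun x => N.+1%:R * f x + -1).
        have cN : Ecvg (fun x => N.+1%:R * f x) by exact: EcvgZ.
        by rewrite (@ellD _ (fun=> -1)) // ellZ // ell_cst.
      apply: ell_le => //; first by apply: EcvgD => //; exact: EcvgZ.
      move=> x x0; have /andP[+ _] := cntb x x0; move/le_trans; apply.
      apply: ler_sum => i _; have [xz|_] := lerP x (z i); first by rewrite chi_left.
      by have [] := clampP ((k i).+1%:R * (z i - x) + 1).
    rewrite (@ell_sum N.+1 (fun i => chi (z i) (k i))); last by move=> i _; exact: Ecvg_chi.
    apply: (@le_trans _ _ (\sum_(i < N.+1) (Fcdf (z i) + e / N.+1%:R))).
      by apply: ler_sum => i _; rewrite ltW.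
    by rewrite big_split /= lerD2l sumr_const card_ord -[leLHS]mulr_natr divfK ?gt_eqF.
  (* In the other direction, a cutoff at [z i.+1] steep enough stays below the step at [z i]. This
     shift of index loses one term of [S], at most 1. *)
  have l2 : S - 1 <= N.+1%:R * ell f.
    have Hk0 i : exists k : nat, z i.+1 + k.+1%:R^-1 <= z i.
      have d0 : 0 < z i - z i.+1 by rewrite subr_gt0.
      exists (Num.truncn (z i - z i.+1)^-1).
      have : (z i - z i.+1)^-1 < (Num.truncn (z i - z i.+1)^-1).+1%:R by rewrite truncnS_gt.
      by rewrite invf_plt ?posrE // => /ltW; rewrite lerBrDl.
    have [k Hk] := choice Hk0.
    have C1 : Ecvg (fun x => \sum_(i < N) chi (z i.+1) (k i) x).
      by apply: (@Ecvg_sum N (fun i => chi (z i.+1) (k i))) => i _; exact: Ecvg_chi.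
    apply: (@le_trans _ _ (ell (fun x => \sum_(i < N) chi (z i.+1) (k i) x))); last first.
      rewrite -ellZ //; apply: ell_le => //; first exact: EcvgZ.
      move=> x x0; have /andP[_] := cntb x x0; apply: le_trans.
      rewrite big_ord_recr /= ler_wpDr //; apply: ler_sum => i _.
      have [xz|xz] := lerP x (z i); first by have [] := clampP ((k i).+1%:R * (z i.+1 - x) + 1).
      by rewrite chi_right // (le_trans (Hk i)) // ltW.
    rewrite (@ell_sum N (fun i => chi (z i.+1) (k i))); last by move=> i _; exact: Ecvg_chi.
    rewrite /S big_ord_recl /= lerBlDr addrC lerD ?Fcdf_le1 //.
    by apply: ler_sum => i _; rewrite /bump /= add1n; exact: Fcdf_le.
  rewrite ler_pdivlMr // -[X in _ * X](ger0_norm (ltW Np)) -normrM mulrC mulrBr ler_norml.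
  by move: m1 m2 l1 l2; move: (N.+1%:R * m f) (N.+1%:R * ell f) => p q; lra.
apply/eqP; rewrite -subr_eq0 -normr_le0; apply/ler_addgt0Pr => e e0; rewrite add0r.
apply: le_trans (key (Num.truncn (2 / e))) _; rewrite ler_pdivrMr // mulrC -ler_pdivrMr //.
by rewrite ltW // truncnS_gt.
Qed.

Lemma JcvgD f g : Jcvg f -> Jcvg g -> Jcvg (fun x => f x + g x).
Proof.
move=> [fi fc] [gi gc]; split; first exact: intD.
by rewrite RintegralD //; under eq_fun do rewrite ED; exact: cvgD.
Qed.

Lemma JcvgZ k f : Jcvg f -> Jcvg (fun x => k * f x).
Proof.
move=> [fi fc]; split; first exact: intZ.
by rewrite RintegralZl //; under eq_fun do rewrite EZ; apply: cvgM => //; exact: cvg_cst.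
Qed.

Lemma Jcvg_cst k : Jcvg (fun=> k).
Proof.
split; first exact: int_cst.
rewrite mint_cst -[X in _ --> X](ell_cst k); apply: Ecvg_ell; exact: Ecvg_cst.
Qed.

Lemma Jcvg_sum (k : nat) (f : nat -> R -> R) : (forall i, Jcvg (f i)) ->
  Jcvg (fun x => \sum_(i < k) f i x).
Proof.
move=> H; elim: k => [|k IH].
  by rewrite (_ : (fun x => _) = (fun=> 0)); [exact: Jcvg_cst|apply/funext => x; exact: big_ord0].
rewrite (_ : (fun x => _) = (fun x => \sum_(i < k) f i x + f k x)); first exact: JcvgD.
by apply/funext => x; rewrite big_ord_recr.
Qed.

Lemma Jcvg_approx f G : measurable_fun setT f -> int G -> Ebounded G ->
  (forall e : R, 0 < e -> exists g, Jcvg g /\ forall x : R, 0 <= x -> `|f x - g x| <= e * G x) -> Jcvg f.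
Proof.
move=> mf Gi [K0 GK0] H.
have fi : int f.
  have [g [[gi _] fg]] := H 1 ltr01.
  apply: (@int_le f (fun x => `|g x| + G x)) => //.
    move=> x x0; have := fg x x0; rewrite mul1r => fgx.
    by rewrite -[X in `|X|](subrK (g x)) (le_trans (ler_normD _ _)) // addrC lerD2l.
  by apply: intD => //; have := integrable_abse gi; apply: eq_integrable.
split=> //; pose K := `|K0| + `|m G| + 1.
have K_gt0 : 0 < K by rewrite ltr_wpDl // addr_ge0.
apply/cvgrPdist_le => e e0; have h2 : 0 < e / 2 by rewrite divr_gt0.
have e2 : 0 < e / 2 / K by rewrite divr_gt0.
have [g [[gi gc] fg]] := H _ e2.
have mfg : `|m f - m g| <= e / 2 / K * m G.
  have egi : int (fun x => e / 2 / K * G x) by exact: intZ.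
  have u1 : m f <= m g + e / 2 / K * m G.
    rewrite -RintegralZl // -RintegralD //; apply: mint_le => //; first exact: intD.
    by move=> x /fg; rewrite ler_norml => /andP[_]; rewrite lerBlDl.
  have u2 : m g <= m f + e / 2 / K * m G.
    rewrite -RintegralZl // -RintegralD //; apply: mint_le => //; first exact: intD.
    by move=> x /fg; rewrite ler_norml => /andP[+ _]; rewrite lerNl opprB lerBlDl.
  by rewrite ler_norml; move: u1 u2; move: (m f) (m g) (_ * m G) => p q r; lra.
near=> n.
have En : `|E n f - E n g| <= e / 2 / K * K0.
  apply: le_trans (E_dist _ fg) _; rewrite EZ ler_wpM2l ?(ltW e2) //; near: n; exact: GK0.
have Eg : `|m g - E n g| <= e / 2 by near: n; move/cvgrPdist_le : gc; apply.
have KK : e / 2 / K * K0 + e / 2 / K * m G <= e / 2.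
  rewrite -mulrDr -[leRHS](divfK (lt0r_neq0 K_gt0)) ler_wpM2l ?(ltW e2) // /K.
  have := ler_norm K0; have := ler_norm (m G); move: `|K0| `|m G| (m G) => p q r; lra.
have -> : m f - E n f = (m f - m g) + (m g - E n g) - (E n f - E n g) by ring.
apply: le_trans (ler_normB _ _) _; apply: le_trans (lerD (ler_normD _ _) (lexx _)) _.
move: mfg En Eg KK; move: `|_| `|m g - _| `|_ - E n g| (_ * K0) (_ * m G) => p q r t w; lra.
Unshelve. all: by end_near. Qed.

Lemma Jcvg_poly (p : {poly R}) : Jcvg (fun x => p.[expR (- (s * x))]).
Proof.
rewrite (_ : (fun x => _) = (fun x => \sum_(i < size p) p`_i * expR (- (i%:R * s * x)))); last first.
  apply/funext => x; rewrite horner_coef; apply: eq_bigr => i _.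
  by rewrite -expRM_natl mulrN mulrA.
apply: (@Jcvg_sum (size p) (fun i x => p`_i * expR (- (i%:R * s * x)))) => i; apply: JcvgZ.
case: i => [|i].
  rewrite (_ : (fun x => _) = (fun=> 1)); first exact: Jcvg_cst.
  by apply/funext => x; rewrite !mul0r oppr0 expR0.
apply: Jcvg_exp; first by rewrite mulr_gt0.
apply: (@Ecvg_eq (fun x => x ^+ 0 * expR (- (s * x)) ^+ i.+1)); last exact: Ecvg_moment_exp.
by move=> x _; rewrite mul1r -expRM_natl mulrN mulrA.
Qed.

Lemma Jcvg_eventually_cst f M : continuous f -> 0 <= M -> (forall x, M <= x -> f x = f M) -> Jcvg f.
Proof.
move=> cf M0 fM; apply: (@Jcvg_approx _ (fun=> 1)).
- exact: continuous_measurable_fun.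
- exact: int_cst.
- by exists 1; near=> n; rewrite E1.
move=> e e0; have [p Hp] := poly_approx cf M0 fM e0.
by exists (fun x => p.[expR (- (s * x))]); split; [exact: Jcvg_poly|move=> x /Hp; rewrite mulr1].
Unshelve. all: by end_near. Qed.

Let min_continuous (M : R) : continuous (fun x : R => Num.min x M).
Proof. by move=> x; apply: continuous_min; [exact: cvg_id|exact: cvg_cst]. Qed.

Let exp_continuous (c : R) : continuous (fun x : R => expR (c * x)).
Proof.
move=> x; apply: (continuous_comp (f := fun x => c * x)); last exact: continuous_expR.
by apply: cvgM; [exact: cvg_cst|exact: cvg_id].
Qed.

(** The truncations [exp (c min (x, n))] are eventually constant, so their integrals are limits of
    expectations bounded by [ell]; monotone convergence concludes. *)
Lemma int_exp c : 0 <= c < a0 -> int (fun x => expR (c * x)).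
Proof.
move=> /andP[c0 ca]; pose g (n : nat) (x : R) : R := expR (c * Num.min x n%:R).
have gc n : continuous (g n).
  by move=> x; apply: (continuous_comp (f := fun x : R => Num.min x n%:R) (g := fun x : R => expR (c * x))); [exact: min_continuous|exact: exp_continuous].
have gJ n : Jcvg (g n).
  apply: (@Jcvg_eventually_cst _ n%:R) => // x nx.
  by rewrite /g (elimT min_idPr) // minxx.
have cE : Ecvg (fun x => expR (c * x)) by apply: E_exp; rewrite ger0_norm.
pose K := ell (fun x => expR (c * x)).
have mK n : m (g n) <= K.
  have [_ L] := gJ n; rewrite -(cvg_lim _ L) //.
  apply: ell_le => //; first by apply/cvg_ex; eexists; exact: L.
  by move=> x x0; rewrite ler_expR ler_wpM2l // ge_min lexx.
pose g' n x := (g n x)%:E.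
have mg' n : measurable_fun D (g' n).
  apply/measurable_EFinP; apply: measurable_funTS; exact: continuous_measurable_fun.
have g0 n x : D x -> (0 <= g' n x)%E by move=> _; rewrite lee_fin expR_ge0.
have nd x : D x -> nondecreasing_seq (g'^~ x).
  move=> _ n n' nn; rewrite lee_fin ler_expR ler_wpM2l // le_min ge_min lexx /= ge_min ler_nat nn orbT //.
have MC := @cvg_monotone_convergence _ _ _ mu _ mD _ mg' g0 nd.
have lg x : limn (g'^~ x) = (expR (c * x))%:E.
  apply: cvg_lim => //; apply: cvg_near_cst; near=> n; rewrite /g' /g (elimT min_idPl) //.
  near: n; exact: nbhs_infty_ger.
apply/integrableP; split.
  apply/measurable_EFinP; apply: measurable_funTS; apply: continuous_measurable_fun; exact: exp_continuous.
apply: (@le_lt_trans _ _ K%:E); last exact: ltry.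
have -> : (\int[mu]_(x in D) `|(EFin \o (fun x : R => expR (c * x))) x| = \int[mu]_(x in D) limn (g'^~ x))%E.
  by apply: eq_integral => x _; rewrite lg /= ger0_norm ?expR_ge0.
rewrite -(cvg_lim _ MC) //; apply: lime_le; first by apply/cvg_ex; eexists; exact: MC.
near=> n; have [gi _] := gJ n; have := mK n; rewrite -lee_fin fineK //; exact: integrable_fin_num gi.
Unshelve. all: by end_near. Qed.

(** With [c'] halfway between [c] and [a0], freezing [f] beyond [M] costs at most
    [2 C exp (- (c' - c) M)] times [exp (c' x)]. *)
Lemma Jcvg_growth f C c : continuous f -> 0 <= c < a0 ->
  (forall x : R, 0 <= x -> `|f x| <= C * expR (c * x)) -> Jcvg f.
Proof.
move=> cf /andP[c0 ca] fC; pose c' := (c + a0) / 2.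
have cc : c < c' by rewrite /c' ltr_pdivlMr //; lra.
have ca' : c' < a0 by rewrite /c' ltr_pdivrMr //; lra.
have c'0 : 0 <= c' by lra.
have C0 : 0 <= C by have := fC 0 (lexx _); rewrite mulr0 expR0 mulr1; apply: le_trans.
apply: (@Jcvg_approx _ (fun x => expR (c' * x))).
- exact: continuous_measurable_fun.
- by apply: int_exp; rewrite c'0.
- by apply: Ebounded_exp; rewrite ger0_norm.
move=> e e0.
have L : 2 * C * expR (- ((c' - c) * n%:R)) @[n --> \oo] --> (0 : R).
  rewrite -[X in _ --> X](mulr0 (2 * C)); apply: cvgM; first exact: cvg_cst.
  apply: (@cvg_comp _ _ _ (fun n : nat => (c' - c) * n%:R) (fun y => expR (- y)) _ (pinfty_nbhs R)); last exact: cvgr_expR.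
  apply/cvgryPge => A; near=> n; rewrite mulrC -ler_pdivrMr ?subr_gt0 //; near: n; exact: nbhs_infty_ger.
have [M _ HM] := cvgr_le _ L _ e0; have {}HM := HM M (leqnn M).
exists (fun x => f (Num.min x M%:R)); split.
  apply: (@Jcvg_eventually_cst _ M%:R) => //.
    by move=> x; apply: (continuous_comp (f := fun x : R => Num.min x M%:R) (g := f)); [exact: min_continuous|exact: cf].
  by move=> x Mx; rewrite (elimT min_idPr) // minxx.
move=> x x0; have [xM|Mx] := lerP x M%:R.
  by rewrite subrr normr0 mulr_ge0 ?expR_ge0 // ltW.
apply: (@le_trans _ _ (2 * C * expR (- ((c' - c) * M%:R)) * expR (c' * x))); last by rewrite ler_wpM2r ?expR_ge0.
apply: le_trans (ler_normB _ _) _.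
apply: (@le_trans _ _ (C * expR (c * x) + C * expR (c * x))).
  apply: lerD; first exact: fC.
  by apply: le_trans (fC _ _) _ => //; rewrite ler_wpM2l // ler_expR ler_wpM2l // ltW.
have -> : C * expR (c * x) + C * expR (c * x) = 2 * C * expR (c * x) by ring.
rewrite -[leRHS]mulrA; apply: ler_wpM2l; first by rewrite mulr_ge0.
rewrite -expRD ler_expR; have -> : c * x = - ((c' - c) * x) + c' * x by ring.
by rewrite lerD2r lerN2 ler_wpM2l ?subr_ge0 ?ltW.
Unshelve. all: by end_near. Qed.

(** The negative half line is null for [mu]. *)
Lemma Jcvg_setT f : measurable_fun setT f -> Jcvg f ->
  mu.-integrable setT (EFin \o f) /\ E n f @[n --> \oo] --> Rintegral mu setT f.
Proof.
move=> mf [fi fc]; have TD : setT `\` ~` D = D by rewrite setTD setCK.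
have mC := measurableC mD.
have fT : mu.-integrable setT (EFin \o f).
  have mfE : measurable_fun setT (EFin \o f) by exact/measurable_EFinP.
  by apply/(negligible_integrable mC measurableT mfE muCD); rewrite TD.
split=> //; rewrite (_ : Rintegral mu setT f = m f) //.
by rewrite /Rintegral (negligible_integral mC measurableT fT muCD) TD.
Qed.

End Functional.

(** * Convergence of the label profile *)

Section UniformExpectation.
Variable R : realType.
Implicit Types f g : ltree -> R.

Lemma unif_expectE n f :
  unif_expect n f = (\sum_(t <- forests n 0 n) f (LNode 0 t)) / (\sum_(t <- forests n 0 n) (1 : R)).
Proof. by rewrite /unif_expect !sum_labelled_trees. Qed.

Lemma unif_expectD n f g : unif_expect n (fun t => f t + g t) = unif_expect n f + unif_expect n g.
Proof. by rewrite !unif_expectE big_split /= mulrDl. Qed.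

Lemma unif_expectZ n k f : unif_expect n (fun t => k * f t) = k * unif_expect n f.
Proof. by rewrite !unif_expectE -mulr_sumr mulrA. Qed.

(** The case [x = 0] of the explicit formula; it contains the fact that the set of trees is not
    empty. *)
Lemma unif_expect1 n : unif_expect n (fun=> 1) = 1 :> R.
Proof.
have := expect_pow n 0 (0 : R); rewrite /Ds mus0 !mul0r mulr0 fcoef0.
by rewrite mulr0 addr0; under eq_fun do rewrite expr1n.
Qed.

Lemma unif_expect_le n f g : (forall t, f t <= g t) -> unif_expect n f <= unif_expect n g.
Proof.
move=> fg; rewrite !unif_expectE ler_wpM2r //; last exact: ler_sum.
by rewrite invr_ge0; apply: sumr_ge0 => t _; exact: ler01.
Qed.

Lemma Ylam_ge0 (lam : R) n t : 0 <= Ylam lam n t.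
Proof. by rewrite /Ylam /Yn divr_ge0 // powR_ge0. Qed.

End UniformExpectation.

Theorem theorem14 (R : realType) (c : nat -> R) (lam : R) :
  is_A_coef c -> 0 <= lam ->
  exists mu : probability R R,
    (* Y(lambda) is non-negative *)
    mu [set x : R | x < 0] = 0%E /\
    (* its Laplace transform is L(lambda, .) on (-4/sqrt 3, 4/sqrt 3) *)
    (forall a : R, `|a| < 4 / Num.sqrt 3 ->
       mu.-integrable setT (fun x => (expR (a * x))%:E) /\
       complex.Im (L_lap c lam a) = 0 /\
       (\int[mu]_x (expR (a * x))%:E = (complex.Re (L_lap c lam a))%:E)%E) /\
    (* convergence in distribution *)
    (forall f : R -> R, continuous f -> (exists M : R, forall x, `|f x| <= M) ->
       (fun n => unif_expect n (fun t => f (Ylam lam n t))) @ \oo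
         --> Rintegral mu setT f) /\
    (* pointwise convergence of the Laplace transforms *)
    (forall a : R, `|a| < 4 / Num.sqrt 3 ->
       (fun n => unif_expect n (fun t => expR (a * Ylam lam n t))) @ \oo
         --> complex.Re (L_lap c lam a)) /\
    (* convergence of all moments *)
    (forall k : nat,
       mu.-integrable setT (fun x => (x ^+ k)%:E) /\
       (fun n => unif_expect n (fun t => Ylam lam n t ^+ k)) @ \oo
         --> Rintegral mu setT (fun x => x ^+ k)).
Proof.
move=> Ac lam0; set a0 : R := 4 / Num.sqrt 3.
have a0_gt0 : 0 < a0 by rewrite divr_gt0 // sqrtr_gt0.
have Lap a : `|a| < a0 -> complex.Im (L_lap c lam a) = 0 /\
    ((fun n => unif_expect n (fun t => expR (a * Ylam lam n t))) @ \oo --> complex.Re (L_lap c lam a)).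
  move=> /exists_A0 [A0 [A00 A0k A01 aA]].
  rewrite (L_lapE Ac lam0 A00 A0k A01 aA); split=> //.
  exact: (laplace_lim Ac lam0 A00 A0k A01 aA).2.
(* Monotonicity of [E n] only needs a comparison on the half line, since the variable is
   non-negative. *)
pose E n (f : R -> R) := unif_expect n (fun t => f (Ylam lam n t)).
have ED n f g : E n (fun x => f x + g x) = E n f + E n g by exact: unif_expectD.
have EZ n k f : E n (fun x => k * f x) = k * E n f by exact: unif_expectZ.
have E1 n : E n (fun=> 1) = 1 by exact: unif_expect1.
have E_mono n (f g : R -> R) : (forall x : R, 0 <= x -> f x <= g x) -> E n f <= E n g.
  by move=> fg; apply: unif_expect_le => t; apply: fg; exact: Ylam_ge0.
have E_exp a : `|a| < a0 -> cvgn (fun n => E n (fun x => expR (a * x))).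
  by move=> /Lap [_ L]; apply/cvg_ex; eexists; exact: L.
have [mu muF] := exists_limit_law ED EZ E1 E_mono a0_gt0 E_exp.
have growth (f : R -> R) C k : continuous f -> 0 <= k < a0 ->
    (forall x : R, 0 <= x -> `|f x| <= C * expR (k * x)) ->
    mu.-integrable setT (EFin \o f) /\ E n f @[n --> \oo] --> Rintegral mu setT f.
  move=> cf ka fC; apply: (Jcvg_setT ED EZ E1 E_mono a0_gt0 E_exp muF).
    exact: continuous_measurable_fun.
  exact: (Jcvg_growth ED EZ E1 E_mono a0_gt0 E_exp muF cf ka fC).
have gexp a : `|a| < a0 -> mu.-integrable setT (EFin \o (fun x => expR (a * x))) /\
    E n (fun x => expR (a * x)) @[n --> \oo] --> Rintegral mu setT (fun x => expR (a * x)).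
  move=> aa; apply: (growth _ 1 `|a|); last 2 first.
  - by rewrite normr_ge0.
  - move=> x x0; rewrite mul1r ger0_norm ?expR_ge0 // ler_expR ler_wpM2r //; exact: ler_norm.
  move=> x; apply: (continuous_comp (f := fun x => a * x)); last exact: continuous_expR.
  by apply: cvgM; [exact: cvg_cst|exact: cvg_id].
exists mu; split; first exact: (mu_neg ED EZ E1 E_mono a0_gt0 E_exp muF).
split.
  move=> a aa; have [ie le] := gexp a aa; have [L1 L2] := Lap a aa; split=> //; split=> //.
  rewrite -(cvg_unique _ le L2) //.
  by rewrite /Rintegral fineK //; exact: (integrable_fin_num measurableT ie).
split.
  move=> f cf [M fM]; apply: (growth f M 0 cf _ _).2; first by rewrite lexx.
  by move=> x _; rewrite mul0r expR0 mulr1.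
split; first by move=> a /Lap[].
move=> k; have h0 : 0 < a0 / 2 by rewrite divr_gt0.
(* From [z^k / k! <= exp z] at [z = (a0 / 2) x]. *)
apply: (growth _ (k`!%:R / (a0 / 2) ^+ k) (a0 / 2)).
- by move=> x; exact: exprn_continuous.
- by rewrite ltW //= ltr_pdivrMr // ltr_pMr // ltr1n.
move=> x x0; rewrite ger0_norm ?exprn_ge0 //.
have hx : 0 <= a0 / 2 * x by rewrite mulr_ge0 // ltW.
have := pow_fact_le_expR k hx; rewrite exprMn ler_pdivrMr ?ltr0n ?fact_gt0 // => H.
by rewrite mulrAC ler_pdivlMr ?exprn_gt0 // mulrC (le_trans H) // mulrC.
Qed.
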